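(* Let $\mathfrak g$ be one of $sl(\infty)$, $o(\infty)$, $sp(\infty)$ and let $r\in\mathbb Z_{\ge0}$. The $\mathbb Z_{\ge 0}$-graded ring $\mathcal A_{\mathfrak g}^r=\operatorname{End}_{\mathfrak g}T^{\leq r}$ is Koszul.
   Context: The ground field is $\mathbb C$. The Lie algebra $\mathfrak g$ is one of $sl(\infty)=\varinjlim sl(n)$, $o(\infty)=\varinjlim o(n)$, $sp(\infty)=\varinjlim sp(2n)$ (left upper corner inclusions). $V$ is the natural representation of $\mathfrak g$ (the direct limit of the natural representations $V_n$ of the finite-dimensional algebras in the exhaustion) and $V_*=\varinjlim V_n^*$ is the conatural representation. For $\mathfrak g=sl(\infty)$: $T^{p,q}:=V^{\otimes p}\otimes(V_* )^{\otimes q}$ and $T^{\leq r}:=\bigoplus_{p+q\leq r}T^{p,q}$. For $\mathfrak g=o(\infty),sp(\infty)$: $T^p:=V^{\otimes p}$ and $T^{\leq r}:=\bigoplus_{p\leq r}T^p$. It is known that $\operatorname{Hom}_{sl(\infty)}(T^{p,q},T^{s,t})=0$ unless $p-s=q-t\in\mathbb Z_{\ge0}$, and that for $\mathfrak g=o(\infty),sp(\infty)$, $\operatorname{Hom}_{\mathfrak g}(T^p,T^q)=0$ unless $p-q\in2\mathbb Z_{\ge0}$. The grading on $\mathcal A_{\mathfrak g}^r$ is $$(\mathcal A_{\mathfrak g}^r)_i=\bigoplus_{p+q\leq r}\operatorname{Hom}_{\mathfrak g}(T^{p,q},T^{p-i,q-i})\quad(\mathfrak g=sl(\infty)),\qquad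 (\mathcal A_{\mathfrak g}^r)_i=\bigoplus_{p\leq r}\operatorname{Hom}_{\mathfrak g}(T^p,T^{p-2i})\quad(\mathfrak g=o(\infty),sp(\infty)),$$ with the convention that the Hom space is zero if some exponent is negative. A $\mathbb Z_{\ge0}$-graded ring $A$ is Koszul if $A_0$ is a semisimple ring and for any two graded $A$-modules $M,N$ of pure weight $m,n\in\mathbb Z$ respectively, $\operatorname{ext}^i_A(M,N)=0$ unless $i=m-n$. Here $\operatorname{ext}^i_A$ is the ext-group in the category of $\mathbb Z$-graded $A$-modules, and a graded module is pure of weight $m$ if it is concentrated in degree $-m$. *)

(* Defs.v *)
From HB Require Import structures.
From mathcomp Require Import all_boot all_order all_algebra.
From mathcomp Require Import finmap complex.
From mathcomp Require Import boolp classical_sets functions reals.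
From mathcomp Require Import monalg.

Set Implicit Arguments.
Unset Strict Implicit.
Unset Printing Implicit Defensive.

Import GRing.Theory.

Local Open Scope classical_set_scope.
Local Open Scope ring_scope.

Definition direct_sum (I : eqType) (M : zmodType) (M_ : I -> set M) : Prop :=
  [/\ forall i, M_ i 0 /\ (forall x y, M_ i x -> M_ i y -> M_ i (x - y)),
      forall x, exists s : seq I, exists y : I -> M,
        [/\ uniq s, forall i, M_ i (y i) & x = \sum_(i <- s) y i]
    & forall (s : seq I) (y : I -> M), uniq s -> (forall i, M_ i (y i)) ->
        \sum_(i <- s) y i = 0 -> forall i, i \in s -> y i = 0].

Definition graded_ring (A : pzRingType) (A_ : nat -> set A) : Prop :=
  [/\ direct_sum A_, A_ 0%N 1
    & forall i j a b, A_ i a -> A_ j b -> A_ (i + j)%N (a * b)].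

Record gmod (A : pzRingType) (A_ : nat -> set A) := Gmod {
  gmod_car :> lmodType A;
  gmod_deg : int -> set gmod_car;
  gmod_direct : direct_sum gmod_deg;
  gmod_scale : forall (i : nat) (j : int) (a : A) (x : gmod_car),
    A_ i a -> gmod_deg j x -> gmod_deg (i%:Z + j) (a *: x) }.

(* Semisimplicity of a subring S: the left regular S-module is the sum of   *)
(* its simple submodules.                                                   *)
Section Semisimple.
Variables (A : pzRingType) (S : set A).

Definition left_ideal (L : set A) : Prop :=
  [/\ L `<=` S, L 0, forall x y, L x -> L y -> L (x + y)
    & forall s x, S s -> L x -> L (s * x)].

Definition simple_left_ideal (L : set A) : Prop :=
  [/\ left_ideal L, L <> [set 0]
    & forall L' : set A, left_ideal L' -> L' `<=` L ->
        L' = [set 0] \/ L' = L].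

Definition semisimple_subring : Prop :=
  forall x, S x -> exists (n : nat) (L : 'I_n -> set A) (y : 'I_n -> A),
    (forall k, simple_left_ideal (L k) /\ L k (y k)) /\ x = \sum_k y k.
End Semisimple.

Section Ext.
Variables (A : pzRingType) (A_ : nat -> set A).
Local Notation gmod := (gmod A_).

Definition ghom (M N : gmod) : set {linear M -> N} :=
  [set f | forall j x, gmod_deg j x -> gmod_deg j (f x)].

Definition gprojective (P : gmod) : Prop :=
  forall (M N : gmod) (g : {linear M -> N}) (f : {linear P -> N}),
    ghom g -> (forall y, exists x, g x = y) -> ghom f ->
    exists2 h : {linear P -> M}, ghom h & forall x, g (h x) = f x.

Record gresolution (M : gmod) := Gresolution {
  res_mod : nat -> gmod;
  res_d : forall i, {linear res_mod i.+1 -> res_mod i};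
  res_aug : {linear res_mod 0%N -> M};
  res_proj : forall i, gprojective (res_mod i);
  res_d_ghom : forall i, ghom (res_d i);
  res_aug_ghom : ghom res_aug;
  res_aug_surj : forall y, exists x, res_aug x = y;
  res_exact0 : forall x, res_aug x = 0 <-> exists y, res_d 0%N y = x;
  res_exact : forall i x, res_d i x = 0 <-> exists y, res_d i.+1 y = x }.

Definition cocycle (M N : gmod) (P : gresolution M) (i : nat) :
    set {linear res_mod P i -> N} :=
  [set f | ghom f /\ forall x, f (res_d P i x) = 0].

Definition coboundary (M N : gmod) (P : gresolution M) (i : nat) :
    set {linear res_mod P i -> N} :=
  match i with
  | 0%N => [set f | forall x, f x = 0]
  | j.+1 => [set f | exists2 h : {linear res_mod P j -> N},
                       ghom h & forall x, f x = h (res_d P j x)]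
  end.

(* ext^i(M, N) = H^i(hom(P, N)) does not depend, up to isomorphism, on the  *)
(* projective resolution P of M in the category of graded modules; one      *)
(* always exists, since there are enough free graded modules.               *)
Definition ext_zero (i : nat) (M N : gmod) : Prop :=
  forall P : gresolution M, cocycle (N := N) (P := P) (i := i) `<=`
                            coboundary (N := N) (P := P) (i := i).

Definition pure_weight (m : int) (M : gmod) : Prop :=
  forall j (x : M), j != - m -> gmod_deg j x -> x = 0.

Definition koszul : Prop :=
  [/\ graded_ring A_, semisimple_subring (A_ 0%N)
    & forall (M N : gmod) (m n : int), pure_weight m M -> pure_weight n N ->
        forall i : nat, i%:Z != m - n -> ext_zero i M N].
End Ext.

Section EquivariantEnd.
Variables (K : comPzRingType) (L : Type) (T : lmodType K).
Variables (act : L -> {linear T -> T}) (G : set L).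

Definition equivariant : {pred T -> T} := fun f =>
  `[< linear f /\ forall x, G x -> forall v, f (act x v) = act x (f v) >].

Record equiv_end := EquivEnd {
  equiv_fun :> T -> T;
  equiv_funP : equiv_fun \in equivariant }.

Lemma equivariantP (f : T -> T) : reflect
  (linear f /\ forall x, G x -> forall v, f (act x v) = act x (f v))
  (f \in equivariant).
Proof. exact: asboolP. Qed.

Fact equivariant_zmod_closed : zmod_closed equivariant.
Proof.
split=> [|f g /equivariantP[lf ef] /equivariantP[lg eg]]; apply/equivariantP.
  by split=> [a u v|x _ v]; rewrite /= ?scaler0 ?addr0 ?linear0.
have fgE v : (f - g) v = f v - g v by [].
split=> [a u v|x Gx v]; rewrite !fgE.
  by rewrite lf lg scalerBr opprD addrACA.
by rewrite ef // eg // linearB.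
Qed.
HB.instance Definition _ :=
  GRing.isZmodClosed.Build _ equivariant equivariant_zmod_closed.

HB.instance Definition _ := [isSub for equiv_fun].
HB.instance Definition _ := [Choice of equiv_end by <:].
HB.instance Definition _ := [SubChoice_isSubZmodule of equiv_end by <:].

Fact equiv_one_subproof : id \in equivariant.
Proof. exact/equivariantP. Qed.

Fact equiv_mul_subproof (f g : equiv_end) : f \o g \in equivariant.
Proof.
case: f g => [f fP] [g gP]; have [lf ef] := equivariantP _ fP.
have [lg eg] := equivariantP _ gP.
apply/equivariantP; split=> [a u v|x Gx v] /=; first by rewrite lg lf.
by rewrite eg // ef.
Qed.

Definition equiv_one := EquivEnd equiv_one_subproof.
Definition equiv_mul f g := EquivEnd (equiv_mul_subproof f g).

Fact equiv_endP (f g : equiv_end) : (forall v, f v = g v) -> f = g.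
Proof. by move=> fg; apply/val_inj/funext. Qed.

Fact equiv_linear (f : equiv_end) : linear f.
Proof. by case: f => f fP; case: (equivariantP _ fP). Qed.
HB.instance Definition _ (f : equiv_end) :=
  GRing.isLinear.Build K T T *:%R (equiv_fun f) (equiv_linear f).

Fact equiv_mulA : associative equiv_mul.
Proof. by move=> f g h; apply: equiv_endP. Qed.
Fact equiv_mul1l : left_id equiv_one equiv_mul.
Proof. by move=> f; apply: equiv_endP. Qed.
Fact equiv_mul1r : right_id equiv_one equiv_mul.
Proof. by move=> f; apply: equiv_endP. Qed.
Fact equiv_mulDl : left_distributive equiv_mul +%R.
Proof. by move=> f g h; apply: equiv_endP. Qed.
Fact equiv_mulDr : right_distributive equiv_mul +%R.
Proof. by move=> f g h; apply: equiv_endP => v; exact: (linearD f). Qed.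

HB.instance Definition _ := GRing.Zmodule_isPzRing.Build equiv_end
  equiv_mulA equiv_mul1l equiv_mul1r equiv_mulDl equiv_mulDr.
End EquivariantEnd.

Section LinearExtension.
Variables (K : fieldType) (I : choiceType) (W : lmodType K).

Definition lext (h : I -> W) (t : {malg K[I]}) : W :=
  \sum_(k <- msupp t) t@_k *: h k.

Fact lext_linear h : linear (lext h).
Proof.
move=> a u v; pose D : {fset I} :=
  (msupp (a *: u + v) `|` (msupp u `|` msupp v))%fset.
have lextE (t : {malg K[I]}) : (msupp t `<=` D)%fset ->
    lext h t = \sum_(k <- D) t@_k *: h k.
  move=> tD; rewrite /lext (big_fset_incl _ tD) // => k _.
  by rewrite -mcoeff_eq0 => /eqP ->; rewrite scale0r.
rewrite !lextE ?fsubsetUl //; last first.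
- by rewrite fsubsetU // fsubsetUl orbT.
- by rewrite fsubsetU // fsubsetUr orbT.
rewrite scaler_sumr -big_split; apply: eq_bigr => k _ /=.
by rewrite mcoeffD mcoeffZ scalerDl scalerA.
Qed.
HB.instance Definition _ h :=
  GRing.isLinear.Build K {malg K[I]} W *:%R (lext h) (lext_linear h).
End LinearExtension.

Inductive lie_kind := LieSL | LieO | LieSP.

Definition is_SL (X : lie_kind) : bool := if X is LieSL then true else false.

Section LieAlgebras.
Variable K : fieldType.

(* gl(oo), the matrices (a_ij), i, j : nat, with finitely many nonzero      *)
(* entries: the basis element << (i, j) >> is the elementary matrix E_ij.   *)
Definition gl_inf := {malg K[(nat * nat)%type]}.

Definition corner (n : nat) (B : 'M[K]_n) : gl_inf :=
  \sum_i \sum_j B i j *: << (val i, val j) >>.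

(* The symplectic form on K^2n pairs the basis vectors e_2k and e_2k+1, so  *)
(* that the corner inclusions map sp(2n) into sp(2n + 2).                   *)
Definition symp_form (m : nat) : 'M[K]_m :=
  \matrix_(i, j) (if ~~ odd i && (j == i.+1 :> nat) then 1
                  else if odd i && (i == j.+1 :> nat) then -1 else 0).

Definition sl_fin (n : nat) : set 'M[K]_n := [set B | \tr B = 0].
Definition o_fin (n : nat) : set 'M[K]_n := [set B | B^T = - B].
Definition sp_fin (n : nat) : set 'M[K]_(n.*2) :=
  [set B | B^T *m symp_form n.*2 + symp_form n.*2 *m B = 0].

Definition lie_inf (X : lie_kind) : set gl_inf :=
  match X with
  | LieSL => [set A | exists n, exists2 B, sl_fin (n := n) B & A = corner B]
  | LieO => [set A | exists n, exists2 B, o_fin (n := n) B & A = corner B]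
  | LieSP => [set A | exists n, exists2 B, sp_fin (n := n) B & A = corner B]
  end.

(* V = lim K^n has basis e_0, e_1, ..., V_* = lim (K^n)^* has the dual      *)
(* basis e*_0, e*_1, ..., and T^(p,q) is the free module on the pairs       *)
(* (a, b) of a p-tuple and a q-tuple, (a, b) standing for                   *)
(*   e_a1 (x) ... (x) e_ap (x) e*_b1 (x) ... (x) e*_bq.                     *)
(* T^{<=r} is the free module on the disjoint union of these bases over the *)
(* occurring exponents (p, q); for o and sp only T^p = T^(p,0) occurs.      *)
Definition expo (X : lie_kind) (r : nat) :=
  {pq : 'I_r.+1 * 'I_r.+1 |
    (pq.1 + pq.2 <= r)%N && (is_SL X || (pq.2 == 0%N :> nat))}.

Definition tbasis (X : lie_kind) (r : nat) :=
  {e : expo X r & ((val e).1.-tuple nat * (val e).2.-tuple nat)%type}.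

Definition Tle (X : lie_kind) (r : nat) := {malg K[tbasis X r]}.

Definition tset (n : nat) (a : n.-tuple nat) (k : 'I_n) (i : nat) :
    n.-tuple nat :=
  [tuple if l == k then i else tnth a l | l < n].

(* E_ij acts as a derivation, with E_ij e_a = delta_ja e_i on V and         *)
(* E_ij e*_b = - delta_ib e*_j on V_*.                                      *)
Definition E_act (X : lie_kind) (r : nat) (ij : nat * nat) (x : tbasis X r) :
    Tle X r :=
  let: existT e (a, b) := x in
  \sum_(k | tnth a k == ij.2)
     << (existT _ e (tset a k ij.1, b) : tbasis X r) >>
  - \sum_(l | tnth b l == ij.1)
     << (existT _ e (a, tset b l ij.2) : tbasis X r) >>.

Definition gl_act (X : lie_kind) (r : nat) (A : gl_inf) :
    {linear Tle X r -> Tle X r} :=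
  lext (fun x => lext (fun ij => E_act ij x) A).

Definition Tpq (X : lie_kind) (r p q : nat) : set (Tle X r) :=
  [set t | forall x : tbasis X r, x \in msupp t ->
             (val (tag x)).1 = p :> nat /\ (val (tag x)).2 = q :> nat].

Definition Ag (X : lie_kind) (r : nat) : pzRingType :=
  equiv_end (@gl_act X r) (lie_inf X).

Definition Ag_deg (X : lie_kind) (r i : nat) : set (Ag X r) :=
  [set f : Ag X r |
    if is_SL X then
      forall p q t, Tpq p q t ->
        if (i <= p)%N && (i <= q)%N then Tpq (p - i)%N (q - i)%N (f t)
        else f t = 0
    else
      forall p t, Tpq p 0%N t ->
        if (i.*2 <= p)%N then Tpq (p - i.*2)%N 0%N (f t) else f t = 0].
End LieAlgebras.

(* Main.v *)
Require Import Defs.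
From mathcomp Require Import all_boot all_algebra complex reals.
From HB Require Import structures.
From mathcomp Require Import all_order fingroup perm finmap.
From mathcomp Require Import boolp classical_sets functions.
From mathcomp Require Import monalg zify.

Set Implicit Arguments.
Unset Strict Implicit.
Unset Printing Implicit Defensive.

Import GRing.Theory Num.Theory.

Local Open Scope classical_set_scope.
Local Open Scope ring_scope.

(* Words in the basis letters of V and V_* model the tensor space.  A letter-by- *)
(* letter induction shows that every equivariant operator is a combination of  *)
(* permutations followed by contractions, so A_i = c^i A_0 for the contraction *)
(* c of the first pair of factors, with A_0 semisimple.  Symmetrizers over the *)
(* contracted pairs then give an explicit linear projective resolution of each *)
(* pure module; its exactness is a Jones-Wenzl type recursion, and the only    *)
(* input about the kernel of c^i is that the contraction diagrams are linearly *)
(* independent modulo the symmetries of the pairs.                             *)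

(** By the first fundamental theorem ([fft]) every equivariant operator between tensor powers is a
    combination of diagrams: permute the factors, then contract some pairs of them, called edges. If
    the factors of V and of its dual are interleaved ([canon]), the contractible pairs stand in
    front, so the contraction [c] of the first pair, of degree 1, generates the ring together with
    the permutations: $A_i = c^i A_0$ ([deg_comp]). Here $A_0$ is spanned by the permutations that
    preserve the types of the factors. It has a Casimir element ([sum_uv], [sep]), and averaging
    against it makes $A_0$ semisimple ([semisimple_degree0]) and turns K-linear choices into
    $A_0$-linear ones.

    Let [th] make an operator act behind the first edge, so that $x c = c\, th(x)$. The power $c^i$
    distinguishes neither the two ends of an edge, up to the sign of the form, nor the order of the
    i edges, and by [faithful] this is all that it forgets. Hence $A_i$ is $sy_i A_0$, where [sy i]
    symmetrizes i edges, and A behaves over $A_0$ like a symmetric algebra on the edges. A module M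
    of pure weight m therefore has a Koszul resolution: its j-th term is induced from the
    $A_0$-module $an_j M$, where [an j] antisymmetrizes the first j edges, and the identity $dh + hd
    = i + j$ ([koszul_homotopy]) makes it exact in characteristic zero ([kdiff_exact]). The j-th
    term is generated in degree j - m, so it has no nonzero graded map to a module of pure weight n
    unless j = m - n. Comparison of resolutions ([ext_zero_of_resolution]) carries the vanishing to
    every projective resolution. [koszul_criterion] isolates the relations that this argument uses,
    and they are then checked for the operators on words.

    The fundamental theorem is proved with letters. An equivariant operator creates no letter that
    is absent from its input ([equivariant_letters]). Feeding a fresh letter as the last factor
    shows that this factor is either carried to the output or contracted with another one
    ([equivariant_expand]), and each case leaves an equivariant operator on fewer factors. *)

(** Serves the symmetrizers (sign +) and the antisymmetrizers (sign -) alike: [e] is the one on [k]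
    edges, [b] the one on [k.-1] edges, [x] and [x'] are adjacent swaps, and [h], [G] are the
    projections that replace the unit in $x^2 = 1$. Expanding the left factor of $e x e$ leaves
    multiples of $G e$, $x e$ and $b x' x e$; up to the sign, [x] exchanges the first two and, by
    the braid relation, fixes the third. *)
Lemma jones_wenzl (R : pzRingType) (s : bool) (k : nat) (e b x x' G h : R) :
  e *+ k = b * h + (-1) ^+ s * (b * x' * b) *+ k.-1 ->
  b * e = e -> h * e = e -> x * b = b * x -> x * h * x = h * G ->
  G * b = b * G -> G * h = h * G -> x * G = x -> h * x = x ->
  ((1 < k)%N -> x * x' * x = x' * x * x' /\ x' * e = (-1) ^+ s * e) ->
  x * (G * e + (-1) ^+ s * (e * x * e) *+ k) =
  (-1) ^+ s * (G * e + (-1) ^+ s * (e * x * e) *+ k).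
Proof.
move=> def_e be he xb xhx Gb Gh xG hx rel.
set eta := (-1) ^+ s in def_e rel *; have etaC y : eta * y = y * eta by apply/esym; apply: commr_sign.
have etaCA y z : y * (eta * z) = eta * (y * z) by rewrite mulrA -etaC mulrA.
have eta2 y : eta * (eta * y) = y by rewrite mulrA -expr2 sqrr_sign mul1r.
have exe : e * x * e *+ k = x * e + eta * (b * x' * x * e) *+ k.-1.
  rewrite -mulrA -mulrnAl def_e mulrDl; congr (_ + _).
    by rewrite -mulrA [h * _]mulrA hx mulrA -xb -mulrA be.
  rewrite mulrnAl; congr (_ *+ _).
  by rewrite -!mulrA; do 3![congr (_ * _)]; rewrite mulrA -xb -mulrA be.
have xexe : x * (e * x * e *+ k) = G * e + (b * x' * x * e) *+ k.-1.
  rewrite -mulrnAl -mulrnAl def_e !mulrDl mulrDr; congr (_ + _).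
    rewrite !mulrA xb -[b * x * h]mulrA -[b * (x * h) * x]mulrA xhx.
    by rewrite -Gh mulrA -Gb -!mulrA he be.
  rewrite !mulrnAl mulrnAr; case: k rel {def_e exe} => [|[|k]] rel; rewrite ?mulr0n //=.
  have [//|braid x'e] := rel; congr (_ *+ _).
  have -> : x * (eta * (b * x' * b) * x * e) = eta * (x * b * x' * (b * x) * e).
    by rewrite etaC !mulrA -etaC !mulrA.
  have -> : x * b * x' * (b * x) * e = b * (x * x' * x) * e.
    by rewrite -!mulrA [b * (x * e)]mulrA -xb -[x * b * e]mulrA be [x * (b * _)]mulrA xb !mulrA.
  by rewrite braid -!mulrA x'e // !etaCA eta2.
rewrite mulrDr mulrA xG.
have -> : x * (eta * (e * x * e) *+ k) = eta * (x * (e * x * e *+ k)).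
  by rewrite !mulrnAr !mulrA etaC.
rewrite xexe -(mulrnAr eta) exe !mulrDr -(mulrnAr eta) !eta2.
by rewrite addrCA.
Qed.

(** * Homogeneous components of an internal direct sum *)

Section DirectSum.
Variables (I : eqType) (M : zmodType) (M_ : I -> set M).
Hypothesis dM : direct_sum M_.

Fact dcomp_subproof (x : M) : {sy : seq I * (I -> M) |
  [/\ uniq sy.1, forall i, M_ i (sy.2 i) & x = \sum_(i <- sy.1) sy.2 i]}.
Proof.
apply: cid; case: dM => _ /(_ x)[s [y sy]] _.
by exists (s, y).
Qed.

(** The decomposition of [x] comes from choice, separately for each [x]; it is canonical, hence
    additive, only through [dcomp_unique]. *)
Definition dcomp (i : I) (x : M) : M :=
  let: (s, y) := sval (dcomp_subproof x) in if i \in s then y i else 0.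

Lemma direct0 i : M_ i 0. Proof. by case: dM => /(_ i)[]. Qed.
Lemma directB i x y : M_ i x -> M_ i y -> M_ i (x - y).
Proof. by case: dM => /(_ i)[_ MB] _ _; apply: MB. Qed.
Lemma directN i x : M_ i x -> M_ i (- x).
Proof. by move=> Mx; rewrite -sub0r; apply: directB => //; apply: direct0. Qed.
Lemma directD i x y : M_ i x -> M_ i y -> M_ i (x + y).
Proof. by move=> Mx My; rewrite -[y]opprK; apply: directB => //; apply: directN. Qed.
Lemma direct_sumr i (J : Type) (s : seq J) (P : pred J) (F : J -> M) :
  (forall k, P k -> M_ i (F k)) -> M_ i (\sum_(k <- s | P k) F k).
Proof. by move=> MF; apply: big_ind => //; [apply: direct0 | apply: directD]. Qed.

Lemma dcomp_in i x : M_ i (dcomp i x).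
Proof.
rewrite /dcomp; case: dcomp_subproof => -[s y] [/= _ My _].
by case: ifP => // _; apply: direct0.
Qed.

Lemma dcomp_sum x : exists s, [/\ uniq s, forall i, i \notin s -> dcomp i x = 0
  & x = \sum_(i <- s) dcomp i x].
Proof.
rewrite /dcomp; case: dcomp_subproof => -[s y] [/= us My xE].
exists s; split=> // [i /negPf-> //|].
by rewrite [LHS]xE; apply: eq_big_seq => i ->.
Qed.

Lemma big_uniq_widen (s r : seq I) (y : I -> M) : uniq s -> uniq r ->
  {subset s <= r} -> (forall i, i \notin s -> y i = 0) ->
  \sum_(i <- s) y i = \sum_(i <- r) y i.
Proof.
move=> us ur sr y0; rewrite [RHS](bigID [in s]) /= [X in _ + X]big1 ?addr0 //.
  rewrite -[RHS]big_filter; apply: perm_big; apply: uniq_perm => //.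
    by rewrite filter_uniq.
  by move=> i; rewrite mem_filter; case: (boolP (i \in s)) => // /sr ->.
Qed.

Lemma dcomp_unique x s (y : I -> M) : uniq s -> (forall i, M_ i (y i)) ->
  (forall i, i \notin s -> y i = 0) -> x = \sum_(i <- s) y i ->
  forall i, dcomp i x = y i.
Proof.
move=> us My y0 xE i; have [r [ur r0 xE']] := dcomp_sum x.
pose q := undup (s ++ r); have uq : uniq q := undup_uniq _.
have sq : {subset s <= q} by move=> k ks; rewrite mem_undup mem_cat ks.
have rq : {subset r <= q} by move=> k kr; rewrite mem_undup mem_cat kr orbT.
have [iq|] := boolP (i \in q); last first.
  by rewrite mem_undup mem_cat negb_or => /andP[/y0-> /r0->].
apply/eqP; rewrite -subr_eq0; apply/eqP.
have [_ _ /(_ q (fun k => dcomp k x - y k) uq)] := dM; apply=> // [k|].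
  by apply: directB => //; apply: dcomp_in.
rewrite big_split sumrN /= -(big_uniq_widen ur uq rq r0).
by rewrite -(big_uniq_widen us uq sq y0) -xE -xE' subrr.
Qed.

Lemma dcompB i : {morph dcomp i : x y / x - y}.
Proof.
move=> x y; have [r [ur r0 xE]] := dcomp_sum x; have [s [us s0 yE]] := dcomp_sum y.
pose q := undup (s ++ r); have uq : uniq q := undup_uniq _.
have sq : {subset s <= q} by move=> k ks; rewrite mem_undup mem_cat ks.
have rq : {subset r <= q} by move=> k kr; rewrite mem_undup mem_cat kr orbT.
apply: (@dcomp_unique _ q (fun k => dcomp k x - dcomp k y)) => // [k|k|].
- by apply: directB; apply: dcomp_in.
- by rewrite mem_undup mem_cat negb_or => /andP[/s0-> /r0->]; rewrite subrr.
rewrite big_split sumrN /= -(big_uniq_widen ur uq rq r0).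
by rewrite -(big_uniq_widen us uq sq s0) -xE -yE.
Qed.

HB.instance Definition _ i := GRing.isZmodMorphism.Build M M (dcomp i) (dcompB i).

Lemma dcomp_id i x : M_ i x -> dcomp i x = x.
Proof.
move=> Mx; rewrite (@dcomp_unique x [:: i] (fun k => if k == i then x else 0)) ?eqxx //.
- by move=> k; case: eqP => [->|_] //; apply: direct0.
- by move=> k; rewrite inE => /negPf->.
- by rewrite big_seq1 eqxx.
Qed.

Lemma dcomp_neq i j x : M_ i x -> j != i -> dcomp j x = 0.
Proof.
move=> Mx ji; rewrite (@dcomp_unique x [:: i] (fun k => if k == i then x else 0)) ?(negPf ji) //.
- by move=> k; case: eqP => [->|_] //; apply: direct0.
- by move=> k; rewrite inE => /negPf->.
- by rewrite big_seq1 eqxx.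
Qed.

End DirectSum.

(** * Linear functions inside a linear relation *)

Section LinearSelection.
Variables (K : fieldType) (A : pzRingType) (kap : {rmorphism K -> A}).
Variables (V W : lmodType A).

Definition linear_graph (G : set (V * W)) : Prop :=
  G 0 /\ forall a p q, G p -> G q ->
    G (p.1 + kap a *: q.1, p.2 + kap a *: q.2).

Definition functional_graph (G : set (V * W)) : Prop :=
  forall w, G (0, w) -> w = 0.

(** Zorn's lemma: a maximal functional linear subgraph of [R] that contains [G0] is total, since the
    line through any (v, w) in [R] over a missing v could be adjoined. It provides K-linear lifts
    and K-linear projections for modules over A, which are then averaged. *)
Lemma linear_selection (R G0 : set (V * W)) :
  linear_graph R -> (forall v, exists w, R (v, w)) ->
  G0 `<=` R -> linear_graph G0 -> functional_graph G0 ->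
  exists f : V -> W, [/\ forall v, R (v, f v), forall v w, G0 (v, w) -> f v = w
    & forall a x y, f (x + kap a *: y) = f x + kap a *: f y].
Proof.
move=> linR totR G0R linG0 funG0.
pose good G := [/\ G `<=` R, linear_graph G & functional_graph G].
(* Adding [G0] inside [P] makes the union of the empty chain admissible. *)
pose P G := good (G `|` G0).
have [F FP totF|G [GP maxG]] := @Zorn_bigcup _ P.
  have [->|/set0P[X0 FX0]] := eqVneq F set0; first by rewrite /P bigcup_set0 set0U.
  have memF p : (\bigcup_(X in F) X `|` G0) p <-> exists2 X, F X & (X `|` G0) p.
    split=> [[[X FX Xp]|G0p]|[X FX [Xp|G0p]]].
    - by exists X => //; left.
    - by exists X0 => //; right.
    - by left; exists X.
    - by right.
  split=> [p /memF[X /FP[+ _ _]]|| w /memF[X /FP[_ _ +]]]; [exact | | exact].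
  split; first by right; case: linG0.
  move=> a p q /memF[X FX Xp] /memF[Y FY Yq]; apply/memF.
  have [XY|YX] := totF _ _ FX FY.
    exists Y => //; have [_ [_ linY] _] := FP _ FY; apply: linY => //.
    by case: Xp => [/XY|]; [left | right].
  exists X => //; have [_ [_ linX] _] := FP _ FX; apply: linX => //.
  by case: Yq => [/YX|]; [left | right].
set H := G `|` G0 in GP; have [HR [H0 linH] funH] := GP.
have GH : G `<=` H by move=> p; left.
have G0H : G0 `<=` H by move=> p; right.
have totH v : exists w, H (v, w).
  apply: contrapT => vH; have [w Rvw] := totR v.
  (* The line through (v, w) is adjoined. The result stays functional: a relation with nonzero [a]
     would put v into the domain of [H]. *)
  pose G' : set (V * W) := [set p | exists2 q, H q & exists a,
    p = (q.1 + kap a *: v, q.2 + kap a *: w)].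
  have HG' : H `<=` G'.
    move=> p Hp; exists p => //; exists 0.
    by rewrite rmorph0 !scale0r !addr0; case: p {Hp}.
  have G'v : G' (v, w) by exists 0 => //; exists 1; rewrite rmorph1 !scale1r !add0r.
  apply: (maxG G').
    split=> [p /GH /HG' //|G'G]; apply: vH; exists w; exact/GH/G'G.
  have -> : P G' = good G'.
    by rewrite /P; congr good; apply/setUidPl => p /G0H/HG'.
  split.
  - move=> _ [q Hq [a ->]]; have [_ linR'] := linR.
    by apply: (linR' a q (v, w)) => //; apply: HR.
  - split; first by apply/HG'.
    move=> a _ _ [p Hp [b ->]] [q Hq [d ->]] /=.
    exists (p.1 + kap a *: q.1, p.2 + kap a *: q.2); first exact: linH.
    exists (b + a * d); rewrite rmorphD rmorphM /=.
    by rewrite !scalerDr !scalerDl !scalerA !addrA; congr (_, _); rewrite -!addrA; congr (_ + _); rewrite addrCA.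
  - move=> u [[x y] Hxy [a [xE ->]]] /=.
    have [a0|a0] := eqVneq a 0.
      move: xE Hxy; rewrite a0 rmorph0 !scale0r !addr0 => <-; exact: funH.
    case: vH; exists (kap (- a^-1) *: y).
    have -> : v = kap (- a^-1) *: x.
      move/eqP: xE; rewrite eq_sym addr_eq0 => /eqP->.
      by rewrite scalerN rmorphN scaleNr opprK scalerA -rmorphM mulVf // rmorph1 scale1r.
    by have := linH (- a^-1) 0 (x, y) H0 Hxy; rewrite !add0r.
pose f v := xget 0 [set w | H (v, w)].
have fH v : H (v, f v) by rewrite /f; case: xgetP => // /(_ _)/= nH; case: (totH v) => w /nH.
have fE v w : H (v, w) -> f v = w.
  move=> Hvw; apply/eqP; rewrite -subr_eq0; apply/eqP/funH.
  have := linH (- 1) _ _ (fH v) Hvw; rewrite /= rmorphN rmorph1 !scaleN1r.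
  by rewrite subrr.
exists f; split=> [v|v w /G0H/fE//|a x y]; first exact/HR/fH.
by apply/fE; apply: (linH a (x, f x) (y, f y)); apply: fH.
Qed.

End LinearSelection.

(** * Computing ext with a resolution by liftable modules *)

Section Comparison.
Variables (A : pzRingType) (A_ : nat -> set A).

Section Image.
Variables (Y Z : gmod A_) (p : {linear Y -> Z}).
Hypothesis homp : ghom p.

Definition im_pred : {pred Z} := fun z => `[< exists y, p y = z >].

Fact im_submod_closed : submod_closed im_pred.
Proof.
split=> [|a _ _ /asboolP[y <-] /asboolP[y' <-]]; apply/asboolP.
  by exists 0; rewrite linear0.
by exists (a *: y + y'); rewrite linearP.
Qed.
HB.instance Definition _ := GRing.isSubmodClosed.Build A Z im_pred im_submod_closed.

Record image := Image { im_val :> Z; im_valP : im_val \in im_pred }.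
HB.instance Definition _ := [isSub for im_val].
HB.instance Definition _ := [Choice of image by <:].
HB.instance Definition _ := [SubChoice_isSubLmodule of image by <:].

Definition im_deg (d : int) : set image := [set z | gmod_deg d (z : Z)].

Lemma im_val_sum (I : Type) (s : seq I) (F : I -> image) :
  (\sum_(k <- s) F k : image) = \sum_(k <- s) (F k : Z) :> Z.
Proof. by elim/big_rec2: _ => // k f h _ <-. Qed.

Fact im_direct : direct_sum im_deg.
Proof.
split=> [d|z|s y us yd y0 d ds].
- split; first exact: direct0 (gmod_direct Z) _.
  by move=> z z' dz dz'; apply: (directB (gmod_direct Z)).
- have /asboolP[y yz] := im_valP z.
  have yd d : p (dcomp (gmod_direct Y) d y) \in im_pred by apply/asboolP; exists (dcomp (gmod_direct Y) d y).
  have [s [us _ yE]] := dcomp_sum (gmod_direct Y) y.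
  exists s, (fun d => Image (yd d)); split=> // [d|].
    by apply: homp; apply: dcomp_in.
  by apply: val_inj; rewrite /= im_val_sum /= -linear_sum -yE.
- apply: val_inj; have [_ _ /(_ s (fun d => y d : Z) us yd)] := gmod_direct Z; apply=> //.
  by rewrite -im_val_sum y0.
Qed.

Fact im_scale (i : nat) (d : int) (a : A) (z : image) :
  A_ i a -> im_deg d z -> im_deg (i%:Z + d) (a *: z).
Proof. by move=> Aa dz; apply: gmod_scale Aa dz. Qed.

Definition gimage : gmod A_ := Gmod im_direct im_scale.
End Image.

(** Projectivity with surjectivity of [p] relaxed to [f] landing in the image of [p]: exactness of a
    complex provides just this. *)
Definition gliftable (P : gmod A_) : Prop :=
  forall (Y Z : gmod A_) (p : {linear Y -> Z}) (f : {linear P -> Z}),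
    ghom p -> ghom f -> (forall x, exists y, p y = f x) ->
    exists2 h : {linear P -> Y}, ghom h & forall x, p (h x) = f x.

(** The codomain is cut down to the image of [p], which is a graded submodule because [p] preserves
    degrees. *)
Lemma gprojective_liftable P : gprojective P -> gliftable P.
Proof.
move=> projP Y Z p f homp homf surj.
have fim x : f x \in im_pred p by apply/asboolP.
have pim y : p y \in im_pred p by apply/asboolP; exists y.
pose f1 x : gimage homp := Image (fim x).
pose p1 y : gimage homp := Image (pim y).
have f1lin : linear f1 by move=> a x y; apply: val_inj; rewrite /= linearP.
have p1lin : linear p1 by move=> a x y; apply: val_inj; rewrite /= linearP.
pose F := HB.pack_for {linear P -> gimage homp} f1 (GRing.isLinear.Build _ _ _ _ f1 f1lin).
pose G := HB.pack_for {linear Y -> gimage homp} p1 (GRing.isLinear.Build _ _ _ _ p1 p1lin).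
have [|z|x dx|h homh hE] := projP Y (gimage homp) G F.
- by move=> d y dy; have := homp _ _ dy.
- by have /asboolP[y yz] := im_valP z; exists y; apply: val_inj.
- by apply: homf.
by exists h => // x; exact: (congr1 (fun z : image p => im_val z) (hE x)).
Qed.

Section Homotopy.
Variables (M N : gmod A_) (P : gresolution M).
Variables (Q : nat -> gmod A_) (dQ : forall i, {linear Q i.+1 -> Q i}).
Variable aQ : {linear Q 0%N -> M}.
Hypotheses (liftQ : forall i, gliftable (Q i)) (homd : forall i, ghom (dQ i)).
Hypotheses (homa : ghom aQ) (aQ_surj : forall y, exists x, aQ x = y).
Hypothesis (exactQ0 : forall x, aQ x = 0 <-> exists y, dQ 0%N y = x).
Hypothesis exactQ : forall i x, dQ i x = 0 <-> exists y, dQ i.+1 y = x.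

Let liftP i : gliftable (res_mod P i). Proof. exact/gprojective_liftable/res_proj. Qed.

(** In degree 0 the augmentation takes the place of the differential, so that exactness reads the
    same at every [k]. *)
Definition cycleQ k : Q k -> Prop :=
  if k is k'.+1 return Q k -> Prop then fun x => dQ k' x = 0
  else fun x => aQ x = 0.
Definition cycleP k : res_mod P k -> Prop :=
  if k is k'.+1 return res_mod P k -> Prop then fun x => res_d P k' x = 0
  else fun x => res_aug P x = 0.

Lemma cycleQP k x : cycleQ (k := k) x <-> exists y, dQ k y = x.
Proof. by case: k x. Qed.
Lemma cyclePP k x : cycleP (k := k) x <-> exists y, res_d P k y = x.
Proof. by case: k x => [|k] x; [apply: res_exact0 | apply: res_exact]. Qed.

(** Of the homotopy in the preceding degree only the existence of some [h'] is kept; the cocycle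
    argument asks for no more. *)
Definition homotopic k : (res_mod P k -> res_mod P k) ->
    (res_mod P k -> res_mod P k.+1) -> Prop :=
  if k is k'.+1 return (res_mod P k -> res_mod P k) ->
    (res_mod P k -> res_mod P k.+1) -> Prop
  then fun chi h => exists2 h' : {linear res_mod P k' -> res_mod P k'.+1},
    ghom h' & forall x, chi x - x = res_d P k'.+1 (h x) + h' (res_d P k' x)
  else fun chi h => forall x, chi x - x = res_d P 0 (h x).

(** The usual comparison of resolutions, stated at a single [k] so that the induction carries only
    the current maps and no infinite sequence has to be chosen. *)
Lemma comparison k : exists (psi : {linear Q k -> res_mod P k})
    (phi : {linear res_mod P k -> Q k}) (h : {linear res_mod P k -> res_mod P k.+1}),
  [/\ [/\ ghom psi, ghom phi & ghom h],
      forall x, cycleQ x -> cycleP (psi x), forall x, cycleP x -> cycleQ (phi x)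
    & homotopic (psi \o phi) h].
Proof.
elim: k => [|k [psi [phi [h [[hompsi homphi homh] cpsi cphi htp]]]]].
  have [psi hompsi psiE] : exists2 psi : {linear Q 0%N -> res_mod P 0%N}, ghom psi &
      forall x, res_aug P (psi x) = aQ x.
    by apply: liftQ => // [|x]; [apply: res_aug_ghom | apply: res_aug_surj].
  have [phi homphi phiE] : exists2 phi : {linear res_mod P 0%N -> Q 0%N}, ghom phi &
      forall x, aQ (phi x) = res_aug P x.
    by apply: liftP => //; apply: res_aug_ghom.
  have [h homh hE] : exists2 h : {linear res_mod P 0%N -> res_mod P 1%N}, ghom h &
      forall x, res_d P 0%N (h x) = ((psi \o phi) \- idfun) x.
    apply: liftP => [|d x dx|x]; first exact: res_d_ghom.
      apply: (directB (gmod_direct _)) => //.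
      exact: (hompsi _ _ (homphi _ _ dx)).
    by apply/res_exact0; rewrite linearB /= psiE phiE subrr.
  exists psi, phi, h; split=> //= x; first by rewrite psiE.
  by rewrite phiE.
(* For positive [k] the term with [h'] disappears because two consecutive differentials compose to
   zero. *)
have dhtp x : res_d P k (h (res_d P k x)) = psi (phi (res_d P k x)) - res_d P k x.
  case: k psi phi h {hompsi homphi homh cpsi cphi} htp x => [|k] psi phi h /=.
    by move=> htp x; rewrite htp.
  move=> [h' _ htp] x; rewrite htp.
  suff -> : res_d P k (res_d P k.+1 x) = 0 by rewrite linear0 addr0.
  by apply/res_exact; exists x.
have [psi1 hompsi1 psi1E] : exists2 f : {linear Q k.+1 -> res_mod P k.+1}, ghom f &
    forall x, res_d P k (f x) = (psi \o dQ k) x.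
  apply: liftQ => [|d x dx|x]; first exact: res_d_ghom.
    exact: (hompsi _ _ (homd dx)).
  by apply/cyclePP/cpsi/cycleQP; exists x.
have [phi1 homphi1 phi1E] : exists2 f : {linear res_mod P k.+1 -> Q k.+1}, ghom f &
    forall x, dQ k (f x) = (phi \o res_d P k) x.
  apply: liftP => [|d x dx|x]; first exact: homd.
    exact: (homphi _ _ (res_d_ghom dx)).
  by apply/cycleQP/cphi/cyclePP; exists x.
have [h1 homh1 h1E] : exists2 f : {linear res_mod P k.+1 -> res_mod P k.+2}, ghom f &
    forall x, res_d P k.+1 (f x) = (((psi1 \o phi1) \- idfun) \- (h \o res_d P k)) x.
  apply: liftP => [|d x dx|x]; first exact: res_d_ghom.
    apply: (directB (gmod_direct _)).
      apply: (directB (gmod_direct _)) => //.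
      exact: (hompsi1 _ _ (homphi1 _ _ dx)).
    exact: (homh _ _ (res_d_ghom dx)).
  apply/res_exact; rewrite !linearB /= psi1E /= phi1E /= dhtp.
  by rewrite subrr.
exists psi1, phi1, h1; split=> //= [x x0|x x0|].
- by rewrite psi1E /= x0 linear0.
- by rewrite phi1E /= x0 linear0.
by exists h => // x; rewrite h1E /= subrK.
Qed.

(** For a cocycle f the map f psi starts at [Q i] and vanishes, so applying f to the homotopy
    relation leaves $-f = f h' d$, which is a coboundary. *)
Lemma ext_zero_of_resolution i :
  (forall f : {linear Q i -> N}, ghom f -> forall x, f x = 0) ->
  cocycle (N := N) (P := P) (i := i) `<=` coboundary (N := N) (P := P) (i := i).
Proof.
move=> vanish f [homf f0].
have [psi [phi [h [[hompsi homphi homh] _ _]]]] := comparison i.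
have fpsi x : f (psi x) = 0.
  apply: (vanish (f \o psi : {linear Q i -> N})) => d y dy.
  exact: (homf _ _ (hompsi _ _ dy)).
case: i psi phi h f hompsi homphi homh homf f0 fpsi {vanish} => [|i] psi phi h f.
  move=> hompsi homphi homh homf f0 fpsi /= htp x.
  by have := f0 (h x); rewrite -htp linearB /= fpsi sub0r => /eqP; rewrite oppr_eq0 => /eqP.
move=> hompsi homphi homh homf f0 fpsi /= [h' homh' htp].
exists (- (f \o h')) => [d x dx|x].
  by apply: (directN (gmod_direct _)); apply: (homf _ _ (homh' _ _ dx)).
have := congr1 f (htp x); rewrite linearB linearD /= fpsi f0 add0r sub0r => fE.
by rewrite -fE opprK.
Qed.
End Homotopy.
End Comparison.

(** * A Koszulity criterion: symmetrizers and antisymmetrizers of edges *)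

Section KoszulCriterion.
Variables (K : numFieldType) (A : pzRingType) (A_ : nat -> set A).
(** In the application [kap] gives the scalars, [c] contracts the first edge and [th] lets an
    operator act behind the first edge; [g] symmetrizes the two ends of the first edge and [t] swaps
    the first two edges, cut down by the two projections [g] and [th g]. So $t^2 = g\, th(g)$
    replaces $t^2 = 1$. *)
Variables (kap : {rmorphism K -> A}) (th : {additive A -> A}) (c g t : A).
Variable n : nat.

Hypothesis grA : graded_ring A_.
Hypothesis kapC : forall a x, kap a * x = x * kap a.
Hypothesis kap0 : forall a, A_ 0%N (kap a).
Hypothesis th0 : forall x, A_ 0%N x -> A_ 0%N (th x).
Hypothesis thM : forall x y, A_ 0%N x -> A_ 0%N y -> th (x * y) = th x * th y.
Hypothesis thZ : forall a x, A_ 0%N x -> th (kap a * x) = kap a * th x.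
Hypothesis c1 : A_ 1%N c.
Hypothesis cth : forall x, A_ 0%N x -> x * c = c * th x.
Hypothesis Ac : forall i x, A_ i x -> exists2 y, A_ 0%N y & x = c ^+ i * y.
Hypothesis cn : c ^+ n.+1 = 0.
Hypotheses (g0 : A_ 0%N g) (t0 : A_ 0%N t).
Hypotheses (gg : g * g = g) (cg : c * g = c) (th1g : th 1 * g = g).
Hypothesis gth : forall x, A_ 0%N x -> g * th x = th x * g.
Hypotheses (tt : t * t = g * th g) (gt : g * t = t) (tg : t * g = t).
Hypotheses (thgt : th g * t = t) (tthg : t * th g = t) (cct : c * c * t = c * c).
Hypothesis tth : forall x, A_ 0%N x -> t * th (th x) = th (th x) * t.
Hypothesis braid : t * th t * t = th t * t * th t.
(** Multiplication by $c^i$ forgets nothing but the symmetries of the i contracted edges. *)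
Hypothesis faithful : forall i y, A_ 0%N y -> c ^+ i * y = 0 ->
  (forall l, (l < i)%N -> iter l th g * y = y) ->
  (forall l, (l.+1 < i)%N -> iter l th t * y = y) -> y = 0.

(** The tensor $\sum_q u_q \otimes v_q$ is a Casimir element: one matrix [w] describes both left
    multiplication on the [u] and right multiplication on the [v], so an element of $A_0$ can cross
    it. *)
Variables (Q : finType) (u v : Q -> A).
Hypotheses (u0 : forall q, A_ 0%N (u q)) (v0 : forall q, A_ 0%N (v q)).
Hypothesis sep1 : \sum_q u q * v q = 1.
Hypothesis sepC : forall a, A_ 0%N a -> exists w : Q -> Q -> K,
  (forall q, a * u q = \sum_k kap (w q k) * u k) /\
  (forall k, v k * a = \sum_q kap (w q k) * v q).

Lemma A01 : A_ 0%N 1. Proof. by case: grA. Qed.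
Lemma A0z : A_ 0%N 0. Proof. by case: grA => [[/(_ 0%N)[]]]. Qed.
Lemma A_B i x y : A_ i x -> A_ i y -> A_ i (x - y).
Proof. by case: grA => [[/(_ i)[_ AB]] _ _ _ _]; apply: AB. Qed.
Lemma A_0 i : A_ i 0. Proof. by case: grA => [[/(_ i)[]]]. Qed.
Lemma A_N i x : A_ i x -> A_ i (- x).
Proof. by move=> Ax; rewrite -sub0r; apply: A_B => //; apply: A_0. Qed.
Lemma A_D i x y : A_ i x -> A_ i y -> A_ i (x + y).
Proof. by move=> Ax Ay; rewrite -[y]opprK; apply: A_B => //; apply: A_N. Qed.
Lemma A_M i j x y : A_ i x -> A_ j y -> A_ (i + j)%N (x * y).
Proof. by case: grA => _ _ AM; apply: AM. Qed.
Lemma A0M x y : A_ 0%N x -> A_ 0%N y -> A_ 0%N (x * y).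
Proof. exact: A_M. Qed.
Lemma A_Mn i x k : A_ i x -> A_ i (x *+ k).
Proof.
move=> Ax; elim: k => [|k IHk]; first by rewrite mulr0n; apply: A_0.
by rewrite mulrS; apply: A_D.
Qed.
Lemma A_sum i (J : Type) (s : seq J) (P : pred J) (F : J -> A) :
  (forall k, P k -> A_ i (F k)) -> A_ i (\sum_(k <- s | P k) F k).
Proof. by move=> AF; apply: big_ind => //; [apply: A_0 | apply: A_D]. Qed.
Lemma A_X i : A_ i (c ^+ i).
Proof.
elim: i => [|i IHi]; first by rewrite expr0; apply: A01.
by rewrite exprS -add1n; apply: A_M.
Qed.

Local Notation T := (fun k => iter k th).

Lemma iter0 k x : A_ 0%N x -> A_ 0%N (T k x).
Proof. by move=> Ax; elim: k => //= k; apply: th0. Qed.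
Lemma iter_mul k x y : A_ 0%N x -> A_ 0%N y -> T k (x * y) = T k x * T k y.
Proof.
by move=> Ax Ay; elim: k => //= k ->; rewrite thM //; apply: iter0.
Qed.
Lemma iter_sub k x y : T k (x - y) = T k x - T k y.
Proof. by elim: k => //= k ->; rewrite raddfB. Qed.
Lemma iter_add k x y : T k (x + y) = T k x + T k y.
Proof. by elim: k => //= k ->; rewrite raddfD. Qed.
Lemma iter_zero k : T k 0 = 0.
Proof. by elim: k => //= k ->; rewrite raddf0. Qed.
Lemma iter_muln k x m : T k (x *+ m) = T k x *+ m.
Proof. by elim: k => //= k ->; rewrite raddfMn. Qed.
Lemma iter_kap k a x : A_ 0%N x -> T k (kap a * x) = kap a * T k x.
Proof. by move=> Ax; elim: k => //= k ->; rewrite thZ //; apply: iter0. Qed.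
Lemma iter_sum k (J : Type) (s : seq J) (F : J -> A) :
  T k (\sum_(i <- s) F i) = \sum_(i <- s) T k (F i).
Proof. by elim: k => //= k ->; rewrite raddf_sum. Qed.

Lemma expc_th i x : A_ 0%N x -> x * c ^+ i = c ^+ i * T i x.
Proof.
move=> Ax; elim: i => [|i IHi]; first by rewrite mulr1 mul1r.
by rewrite exprSr mulrA IHi -mulrA cth ?mulrA //; apply: iter0.
Qed.

(** The two operators act on disjoint parts of a word: one on edge [l], the other behind the first
    [k] edges. *)
Lemma comm_g l k x : (l < k)%N -> A_ 0%N x -> T l g * T k x = T k x * T l g.
Proof.
move=> lk Ax; rewrite -(subnKC lk) addSnnS iterD /= -!iter_mul ?gth //.
all: by do ?apply: th0; apply: iter0.
Qed.

Lemma comm_t l k x : (l.+1 < k)%N -> A_ 0%N x -> T l t * T k x = T k x * T l t.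
Proof.
move=> lk Ax; rewrite -(subnKC lk) 2!addSnnS iterD /= -!iter_mul ?tth //.
all: by do ?apply: th0; apply: iter0.
Qed.

Definition inv (k : nat) : A := kap (k.+1%:R^-1).

Lemma mulr_kapn k x : kap k%:R * x = x *+ k.
Proof. by rewrite rmorph_nat mulr_natl. Qed.

Lemma inv_mulrn k x : inv k * (x *+ k.+1) = x.
Proof.
rewrite -mulr_kapn mulrA -rmorphM mulVf ?pnatr_eq0 //.
by rewrite rmorph1 mul1r.
Qed.

Lemma mulrn_inv k x : (inv k * x) *+ k.+1 = x.
Proof. by rewrite -mulrnAr inv_mulrn. Qed.

Lemma mulrSn_inj k : injective (fun x : A => x *+ k.+1).
Proof. by move=> x y /(congr1 ( *%R (inv k))); rewrite !inv_mulrn. Qed.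

(** The Jones-Wenzl form of averaging over the place of one more edge. For [sy] the new edge comes
    in front, since [c] contracts from the front; for [an] it comes behind, so that [an j] commutes
    with everything behind the first [j] edges ([comm_an]). *)
Fact sy_subproof : {s : nat -> A | s 0%N = 1 /\ forall i, A_ 0%N (s i) /\
  s i.+1 *+ i.+1 = g * th (s i) + (th (s i) * t * th (s i)) *+ i}.
Proof.
pose s := fix s i := if i is i'.+1 then
  inv i' * (g * th (s i') + (th (s i') * t * th (s i')) *+ i') else 1.
exists s; split=> // i; split; last by rewrite mulrn_inv.
elim: i => [|i IHi]; first exact: A01.
have Ath := th0 IHi; apply: A0M; first exact: kap0.
by apply: A_D; [apply: A0M | apply: A_Mn; do ?apply: A0M].
Qed.

Fact an_subproof : {a : nat -> A | a 0%N = 1 /\ forall j, A_ 0%N (a j) /\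
  a j.+1 *+ j.+1 = a j * T j g - (a j * T j.-1 t * a j) *+ j}.
Proof.
pose a := fix a j := if j is j'.+1 then
  inv j' * (a j' * T j' g - (a j' * T j'.-1 t * a j') *+ j') else 1.
exists a; split=> // j; split; last by rewrite mulrn_inv.
elim: j => [|j IHj]; first exact: A01.
apply: A0M; first exact: kap0.
apply: A_B; first by apply: A0M => //; apply: iter0.
by apply: A_Mn; do ?apply: A0M => //; apply: iter0.
Qed.

(* The symmetrizer of the first [i] edges and the antisymmetrizer of the     *)
(* first [j] edges, where [g] projects onto the words whose first edge is    *)
(* symmetric and [t] swaps the first two edges.                              *)
Definition sy : nat -> A := sval sy_subproof.
Definition an : nat -> A := sval an_subproof.

Lemma sy_0 : sy 0 = 1. Proof. by rewrite /sy; case: sy_subproof => ? []. Qed.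
Lemma an_0 : an 0 = 1. Proof. by rewrite /an; case: an_subproof => ? []. Qed.
Lemma sy0 i : A_ 0%N (sy i).
Proof. by rewrite /sy; case: sy_subproof => ? [/= _ /(_ i)[]]. Qed.
Lemma an0 j : A_ 0%N (an j).
Proof. by rewrite /an; case: an_subproof => ? [/= _ /(_ j)[]]. Qed.
Lemma syS i :
  sy i.+1 *+ i.+1 = g * th (sy i) + (th (sy i) * t * th (sy i)) *+ i.
Proof. by rewrite /sy; case: sy_subproof => ? [/= _ /(_ i)[]]. Qed.
Lemma anS j : an j.+1 *+ j.+1 = an j * T j g - (an j * T j.-1 t * an j) *+ j.
Proof. by rewrite /an; case: an_subproof => ? [/= _ /(_ j)[]]. Qed.

(** A power of [c] absorbs [g] and [t] on its right by [cg] and [cct], and it absorbs [th (sy i)]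
    after one [c] has been moved past it. *)
Lemma expc_sy i : c ^+ i * sy i = c ^+ i.
Proof.
elim: i => [|i IHi]; first by rewrite sy_0 mulr1.
apply: (@mulrSn_inj i); rewrite /= -mulrnAr syS.
have cs : c ^+ i.+1 * th (sy i) = c ^+ i.+1.
  by rewrite exprSr -mulrA -cth ?mulrA ?IHi //; apply: sy0.
rewrite mulrDr mulrA exprSr -[_ * c * g]mulrA cg -exprSr cs mulrS.
congr (_ + _); rewrite mulrnAr; case: i cs {IHi} => // i cs.
congr (_ *+ _); rewrite !mulrA cs.
suff -> : c ^+ i.+2 * t = c ^+ i.+2 by [].
by rewrite !exprSr -!mulrA [c * (c * t)]mulrA cct.
Qed.

Lemma sy_g i l : (l < i)%N -> T l g * sy i = sy i.
Proof.
elim: i l => // i IHi l li; apply: (@mulrSn_inj i); rewrite /= -mulrnAr syS.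
have Ath := th0 (sy0 i).
rewrite mulrDr mulrA mulrnAr !mulrA; case: l li => [_|l li] /=.
  by rewrite gg (gth (sy0 i)) -!mulrA [g * (t * _)]mulrA gt.
rewrite -gth; last exact: iter0.
by rewrite -[g * _ * _]mulrA -thM ?IHi //; [apply: iter0 | apply: sy0].
Qed.


(** The product [sy i * x] meets the conditions of [faithful]. Invariance under swaps is a
    hypothesis here because the induction in [sy_t] already uses this lemma at smaller indices. *)
Lemma sy_tP i : (forall l, (l.+1 < i)%N -> T l t * sy i = sy i) ->
  forall x, A_ 0%N x -> c ^+ i * x = 0 -> sy i * x = 0.
Proof.
move=> st x Ax cx; apply: (@faithful i) => [||l li|l li].
- by apply: A0M => //; apply: sy0.
- by rewrite mulrA expc_sy.
- by rewrite mulrA sy_g.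
- by rewrite mulrA st.
Qed.

(** Swaps not involving the first edge are absorbed by the shifted factor of the recursion; the swap
    of the first two edges is [jones_wenzl] with sign +. *)
Lemma sy_t i l : (l.+1 < i)%N -> T l t * sy i = sy i.
Proof.
elim/ltn_ind: i l => -[//|i] IHi l li.
apply: (@mulrSn_inj i); rewrite /= -mulrnAr syS.
have Ath := th0 (sy0 i); case: l li => [|l] li /=; last first.
  rewrite mulrDr mulrnAr !mulrA -gth; last exact: iter0.
  by rewrite -[g * _ * _]mulrA -thM ?IHi //; [apply: iter0 | apply: sy0].
case: i li IHi Ath => // i _ IHi Ath.
have [Asi Ati] := (sy0 i, th0 (th0 (sy0 i))).
(* Idempotence of the smaller symmetrizer comes from faithfulness, as $c^i$ kills [sy i - 1]. *)
have idem : sy i * sy i = sy i.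
  apply/eqP; rewrite -subr_eq0 -[X in _ - X]mulr1 -mulrBr; apply/eqP.
  apply: sy_tP; first by move=> l li; apply: IHi => //; lia.
    by apply: A_B => //; apply: A01.
  by rewrite mulrBr expc_sy mulr1 subrr.
have := @jones_wenzl _ false i.+1 (th (sy i.+1)) (th (th (sy i))) t (th t) g (th g).
rewrite !expr0 !mul1r; apply => //=.
- have A1 := th0 Asi; rewrite -(raddfMn th) syS raddfD raddfMn (thM g0 A1).
  rewrite (thM (A0M A1 t0) A1) (thM A1 t0); congr (_ + _).
  by rewrite -(thM g0 A1) gth // thM.
- rewrite -(thM (th0 Asi) (sy0 _)); congr (th _).
  apply: (@mulrSn_inj i); rewrite /= -mulrnAr syS mulrDr mulrnAr !mulrA.
  by rewrite -(gth Asi) -[g * _ * _]mulrA -!thM // idem.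
- by rewrite -(thM g0 (sy0 _)) (@sy_g i.+1 0).
- exact: tth.
- by rewrite -mulrA thgt tt gth.
- by rewrite gth //; apply: th0.
- by rewrite gth.
- by move=> i1; split=> //; rewrite -(thM t0 (sy0 _)) (IHi i.+1 _ 0).
Qed.

Lemma sy_eq0 i x : A_ 0%N x -> c ^+ i * x = 0 -> sy i * x = 0.
Proof. by apply: sy_tP => l; apply: sy_t. Qed.

(** Rules for multiplying [sy] on the right are read off from [c], whereas the rules on the left
    came from the recursion. *)
Lemma sy_absorb i z : A_ 0%N z -> c ^+ i * z = c ^+ i -> sy i * z = sy i.
Proof.
move=> Az cz; apply/eqP; rewrite -subr_eq0 -[X in _ - X]mulr1 -mulrBr.
apply/eqP/sy_eq0; first by apply: A_B => //; apply: A01.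
by rewrite mulrBr mulr1 cz subrr.
Qed.

Lemma sy_idem i : sy i * sy i = sy i.
Proof. by rewrite sy_absorb ?expc_sy //; apply: sy0. Qed.

Lemma sy_tr i : sy i.+2 * t = sy i.+2.
Proof. by rewrite sy_absorb // !exprSr -!mulrA [c * (c * t)]mulrA cct. Qed.

Lemma sy_th i : sy i.+1 * th (sy i) = sy i.+1.
Proof.
rewrite sy_absorb //; first by apply/th0/sy0.
by rewrite exprSr -mulrA -cth ?mulrA ?expc_sy //; apply: sy0.
Qed.

Lemma comm_an j k x : (j <= k)%N -> A_ 0%N x -> T k x * an j = an j * T k x.
Proof.
move=> jk Ax; elim: j jk => [|j IHj] jk; first by rewrite an_0 mulr1 mul1r.
apply: (@mulrSn_inj j); rewrite /= -(mulrnAr (T k x)) -(mulrnAl _ (T k x)) anS.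
have {}IHj := IHj (ltnW jk).
rewrite mulrBr mulrBl !mulrA IHj; congr (_ - _).
  by rewrite -!mulrA comm_g.
case: j jk IHj => [|j] jk IHj; first by rewrite !mulr0n mulr0 mul0r.
rewrite mulrnAr mulrnAl !mulrA IHj -[_ * T k x * _]mulrA -comm_t //.
by rewrite -!mulrA IHj.
Qed.

Lemma an_g j l : (l < j)%N -> T l g * an j = an j.
Proof.
elim: j l => // j IHj l lj; apply: (@mulrSn_inj j); rewrite /= -mulrnAr anS.
rewrite mulrBr mulrnAr !mulrA; move: lj; rewrite ltnS leq_eqVlt => /predU1P[->|lj].
  rewrite comm_an // -[_ * T j g * T j g]mulrA -iter_mul // gg; congr (_ - _).
  case: j {IHj} => [|j]; rewrite ?mulr0n //=; congr (_ *+ _).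
  congr (_ * _); rewrite -mulrA; congr (_ * _).
  by rewrite -iterS iterSr -iter_mul ?thgt //; apply: th0.
by rewrite IHj.
Qed.

(** The three properties are proved together, because the Jones-Wenzl step with sign - at one index
    uses all of them at the preceding one. *)
Lemma an_spec j : [/\ forall l, (l.+1 < j)%N -> T l t * an j = - an j,
  an j * an j = an j & an j.-1 * an j = an j].
Proof.
elim: j => [|j [IHt IHi IHp]]; first by rewrite !an_0 mulr1.
have absorb_pred : an j * an j.+1 = an j.+1.
  apply: (@mulrSn_inj j); rewrite /= -(mulrnAr (an j)) anS.
  by rewrite mulrBr mulrnAr !mulrA IHi.
have absorb_t l : (l.+1 < j.+1)%N -> T l t * an j.+1 = - an j.+1.
  move=> lj; apply: (@mulrSn_inj j); rewrite /= mulNrn -(mulrnAr (T l t)) anS.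
  move: lj; rewrite ltnS leq_eqVlt => /predU1P[jE|lj]; last first.
    by rewrite mulrBr mulrnAr !mulrA IHt // !mulNr mulNrn opprK opprB addrC.
  case: j jE {IHi absorb_pred} IHt IHp => // j [->] IHt IHp /=.
  have := @jones_wenzl _ true j.+1 (an j.+1) (an j) (T j t) (T j.-1 t) (T j.+1 g) (T j g).
  rewrite expr1 !mulN1r => H; rewrite -(comm_an (leqnn j.+1) g0) -mulNrn H //.
  - by rewrite mulNrn; apply: anS.
  - exact: an_g.
  - exact: comm_an.
  - rewrite iterSr -(iter_mul j t0 g0) tg -(iter_mul j t0 t0) tt.
    by rewrite (iter_mul j g0) //; apply: th0.
  - exact: comm_an.
  - by apply/esym/comm_g.
  - by rewrite iterSr -iter_mul ?tthg //; apply: th0.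
  - by rewrite -(iter_mul j g0 t0) gt.
  - case: j IHt {IHp H} => // j IHt _; rewrite IHt //=; split=> //.
    have At := th0 t0; rewrite -iterS !iterSr -!(iter_mul, iter_mul _ At t0) ?braid //.
      by apply: A0M.
    by apply: A0M.
split=> //; apply: (@mulrSn_inj j); rewrite /= -(mulrnAl _ (an j.+1)) [X in X * _]anS.
rewrite mulrBl -mulrA an_g // absorb_pred mulrnAl -!mulrA absorb_pred.
case: j {IHt IHi IHp} absorb_pred absorb_t => [|j] absorb_pred absorb_t.
  by rewrite mulr0n subr0.
by rewrite absorb_t // mulrN absorb_pred mulNrn opprK -mulrS.
Qed.

Lemma an_idem j : an j * an j = an j. Proof. by case: (an_spec j). Qed.
Lemma an_t j l : (l.+1 < j)%N -> T l t * an j = - an j.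
Proof. by case: (an_spec j) => absorb_t _ _; apply: absorb_t. Qed.
Lemma an_pred j : an j * an j.+1 = an j.+1.
Proof. by case: (an_spec j.+1). Qed.

Lemma an_th1 j : T j 1 * an j = an j.
Proof.
case: j => [|j]; first by rewrite an_0 mulr1.
rewrite -(an_g (ltnSn j)) mulrA iterSr -iter_mul ?th1g //.
by apply/th0/A01.
Qed.

(* The homotopy d h + h d = i + j of the Koszul complex of a symmetric      *)
(* algebra, with d given by [sy] and h by [an].                             *)
Lemma koszul_homotopy i j x :
  T j (sy i) * x = x -> an j * x = x ->
  (an j * (T j.-1 (sy i.+1) * x)) *+ (i.+1 * j) +
  (T j (sy i) * (an j.+1 * x)) *+ (i * j.+1) = x *+ (i + j).
Proof.
move=> sx ax; have T0 := iter0 j (sy0 i); have a0 := an0 j.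
have gx : (0 < i)%N -> T j g * x = x.
  by case: i sx {T0} => // i sx _; rewrite -sx mulrA -(iter_mul j g0 (sy0 _)) (@sy_g _ 0).
have -> : (T j (sy i) * (an j.+1 * x)) *+ (i * j.+1) =
    (x - (T j (sy i) * (an j * (T j.-1 t * x))) *+ j) *+ i.
  rewrite mulnC mulrnA -(mulrnAr (T j (sy i)) (an j.+1 * x)) -(mulrnAl (an j.+1)) anS; case: i {T0} sx gx => // i sx gx.
  by rewrite mulrBl mulrBr mulrnAl mulrnAr -!mulrA ax gx // ax sx.
case: j sx ax gx T0 a0 => [|j] sx ax gx T0 a0.
  by rewrite muln0 !mulr0n subr0 add0r addn0.
have T0' : A_ 0%N (T j.+1 (sy i)) by [].
have -> : (an j.+1 * (T j.+1.-1 (sy i.+1) * x)) *+ (i.+1 * j.+1) =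
    (x + (T j.+1 (sy i) * (an j.+1 * (T j t * x))) *+ i) *+ j.+1.
  rewrite mulrnA -(mulrnAr (an j.+1) (T j (sy i.+1) * x)) -(mulrnAl (T j (sy i.+1))) -iter_muln syS iter_add iter_muln.
  have A1 := th0 (sy0 i).
  rewrite (iter_mul j g0 A1) (iter_mul j (A0M A1 t0) A1) (iter_mul j A1 t0).
  rewrite -iterSr mulrDl mulrnAl -!mulrA sx mulrDr; congr ((_ + _) *+ _).
    by rewrite -{1}ax [T j g * _]mulrA an_g // ax.
  by rewrite mulrnAr !mulrA comm_an //; apply: sy0.
rewrite mulrnDl mulrnBl -!mulrnA [(j.+1 * i)%N]mulnC addrCA addrK.
by rewrite -mulrnDr.
Qed.

Lemma dA : direct_sum A_. Proof. by case: grA. Qed.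
Local Notation pr := (dcomp dA).

Fact gam_subproof l x : {y | A_ 0%N y & pr l x = c ^+ l * y}.
Proof. by apply/cid2/Ac; apply: dcomp_in. Qed.

(* The coordinates of [x] in [A = \bigoplus_l c ^+ l * A_0], where           *)
(* [c ^+ l * A_0] is isomorphic to [sy l * A_0].                             *)
Definition gam l x : A := sy l * s2val (gam_subproof l x).

Lemma gam0 l x : A_ 0%N (gam l x).
Proof. by rewrite /gam; case: gam_subproof => y Ay _ /=; apply: A0M => //; apply: sy0. Qed.

Lemma expc_gam l x : c ^+ l * gam l x = pr l x.
Proof. by rewrite /gam; case: gam_subproof => y Ay /= ->; rewrite mulrA expc_sy. Qed.

Lemma gam_unique l x y : A_ 0%N y -> sy l * y = y -> c ^+ l * y = pr l x ->
  gam l x = y.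
Proof.
move=> Ay sy_y yE; rewrite -sy_y; apply/eqP; rewrite -subr_eq0; apply/eqP.
rewrite /gam; case: gam_subproof => z Az /= zE.
by rewrite -mulrBr sy_eq0 ?mulrBr -?zE ?yE ?subrr //; apply: A_B.
Qed.

Lemma sy_gam l x : sy l * gam l x = gam l x.
Proof. by rewrite /gam mulrA sy_idem. Qed.

Lemma gamB l : {morph gam l : x y / x - y}.
Proof.
move=> x y; apply: gam_unique; first by apply: A_B; apply: gam0.
  by rewrite mulrBr !sy_gam.
by rewrite mulrBr !expc_gam raddfB.
Qed.
HB.instance Definition _ l := GRing.isZmodMorphism.Build A A (gam l) (gamB l).

Lemma prM0 l x y : A_ 0%N y -> pr l (x * y) = pr l x * y.
Proof.
move=> Ay; have [s [us s0 xE]] := dcomp_sum dA x.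
apply: (@dcomp_unique _ _ _ dA _ s (fun k => pr k x * y)) => // [k|k /s0->|].
- by rewrite -[k]addn0; apply: A_M => //; rewrite addn0; apply: dcomp_in.
- by rewrite mul0r.
- by rewrite {1}xE mulr_suml.
Qed.

Lemma prMr (l i : nat) x : pr (l + i)%N (x * c ^+ i) = pr l x * c ^+ i.
Proof.
have [s [us s0 xE]] := dcomp_sum dA x.
pose y k := if (i <= k)%N then pr (k - i)%N x * c ^+ i else 0.
have us' : uniq [seq (k + i)%N | k <- s] by rewrite map_inj_uniq //; apply: addIn.
rewrite (@dcomp_unique _ _ _ dA _ _ y us') /y ?leq_addl ?addnK // => [k|k|].
- case: leqP => [ik|_]; last exact: A_0.
  by rewrite -{1}(subnK ik); apply: A_M; [apply: dcomp_in | apply: A_X].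
- case: leqP => // ik ks; rewrite s0 ?mul0r //.
  by apply: contra ks => ks; apply/mapP; exists (k - i)%N; rewrite ?subnK.
- rewrite big_map {1}xE mulr_suml; apply: eq_bigr => k _.
  by rewrite leq_addl addnK.
Qed.

Lemma prMr0 l i x : (l < i)%N -> pr l (x * c ^+ i) = 0.
Proof.
move=> li; have [s [us s0 xE]] := dcomp_sum dA x.
rewrite xE mulr_suml raddf_sum big1 // => k _.
apply: (@dcomp_neq _ _ _ dA (k + i)%N); last lia.
by apply: A_M; [apply: dcomp_in | apply: A_X].
Qed.

Lemma gamM0 l x y : A_ 0%N y -> gam l (x * y) = gam l x * y.
Proof.
move=> Ay; apply: gam_unique.
- by apply: A0M => //; apply: gam0.
- by rewrite mulrA sy_gam.
- by rewrite mulrA expc_gam prM0.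
Qed.

(** Moving [c] to the left gives $c^l y c = c^{l+1} th(y)$, and [sy l.+1] restores the normal form
    of the coordinate. *)
Lemma gam_mulc l x : gam l.+1 (x * c) = sy l.+1 * th (gam l x).
Proof.
have Ag := gam0 l x; apply: gam_unique.
- by apply: A0M; [apply: sy0 | apply: th0].
- by rewrite mulrA sy_idem.
rewrite mulrA expc_sy exprSr -mulrA -cth // mulrA expc_gam.
by rewrite -[in RHS](expr1 c) -addn1 prMr.
Qed.

Lemma gam_lt l i x : (l < i)%N -> gam l (x * c ^+ i) = 0.
Proof.
move=> li; apply: gam_unique; rewrite ?mulr0 ?prMr0 //; exact: A_0.
Qed.

Lemma gam_deg k l i x : A_ k x -> l != (k + i)%N -> gam l (x * c ^+ i) = 0.
Proof.
move=> Ax li; apply: gam_unique; rewrite ?mulr0 //; first exact: A_0.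
by rewrite (@dcomp_neq _ _ _ dA (k + i)%N) //; apply: A_M => //; apply: A_X.
Qed.

Lemma gam_exp l i : gam l (c ^+ i) = if l == i then sy i else 0.
Proof.
case: (eqVneq l i) => [->|li]; apply: gam_unique.
- exact: sy0.
- exact: sy_idem.
- by rewrite expc_sy dcomp_id //; apply: A_X.
- exact: A_0.
- by rewrite mulr0.
- by rewrite mulr0 (@dcomp_neq _ _ _ dA i) //; apply: A_X.
Qed.

Lemma gam_A0 x l : A_ 0%N x -> gam l x = if l == 0%N then x else 0.
Proof.
move=> Ax; case: (eqVneq l 0%N) => [->|l0]; apply: gam_unique => //.
- by rewrite sy_0 mul1r.
- by rewrite mul1r dcomp_id.
- exact: A_0.
- by rewrite mulr0.
- by rewrite mulr0 (@dcomp_neq _ _ _ dA 0%N).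
Qed.

Lemma A_ge i x : (n < i)%N -> A_ i x -> x = 0.
Proof. by move=> ni /Ac[y _ ->]; rewrite -(subnK ni) exprD cn mulr0 mul0r. Qed.

Lemma sy_ge i : (n < i)%N -> sy i = 0.
Proof.
move=> ni; rewrite -[sy i]mulr1 sy_eq0 //; first exact: A01.
by rewrite mulr1 -(subnK ni) exprD cn mulr0.
Qed.

Lemma sum_expc_gam x : x = \sum_(l < n.+1) c ^+ l * gam l x.
Proof.
have [s [us s0 xE]] := dcomp_sum dA x.
transitivity (\sum_(l <- iota 0 n.+1) pr l x); last first.
  have -> : iota 0 n.+1 = index_iota 0 n.+1 by rewrite /index_iota subn0.
  rewrite big_mkord.
  by apply: eq_bigr => l _; rewrite expc_gam.
pose q := undup (s ++ iota 0 n.+1); have uq : uniq q := undup_uniq _.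
rewrite {1}xE (@big_uniq_widen _ _ s q) //; last first.
  by move=> k ks; rewrite mem_undup mem_cat ks.
apply/esym/big_uniq_widen => //; first exact: iota_uniq.
  by move=> k ks; rewrite mem_undup mem_cat ks orbT.
by move=> k; rewrite mem_iota /= add0n ltnS -ltnNge => /A_ge; apply; apply: dcomp_in.
Qed.


(** * Averaging against the Casimir element *)

Section Averaging.
Variables (V W : lmodType A) (j : nat) (f : V -> W).
Hypothesis lin_f : forall a x y, f (x + kap a *: y) = f x + kap a *: f y.

(** Maschke averaging of a K-linear map. The shift [T j] appears on the source because $A_0$ acts
    through it on the generators of the j-th Koszul term. *)
Definition average x : W := \sum_q u q *: f (T j (v q) *: x).

Lemma lin_fD x y : f (x + y) = f x + f y.
Proof. by have := lin_f 1 x y; rewrite rmorph1 !scale1r. Qed.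
Lemma lin_f0 : f 0 = 0.
Proof. by apply: (addrI (f 0)); rewrite -lin_fD !addr0. Qed.
Lemma lin_fZ a x : f (kap a *: x) = kap a *: f x.
Proof. by have := lin_f a 0 x; rewrite !add0r lin_f0 add0r. Qed.
Lemma lin_f_sum (s : seq Q) (F : Q -> V) :
  f (\sum_(k <- s) F k) = \sum_(k <- s) f (F k).
Proof. exact: (big_morph _ lin_fD lin_f0). Qed.

Lemma averageA0 a x : A_ 0%N a -> average (T j a *: x) = a *: average x.
Proof.
move=> Aa; have [w [wu wv]] := sepC Aa; rewrite /average scaler_sumr.
transitivity (\sum_q \sum_k (kap (w k q) * u q) *: f (T j (v k) *: x)).
  apply: eq_bigr => q _; rewrite scalerA -(iter_mul j (v0 q) Aa) wv iter_sum.
  rewrite scaler_suml lin_f_sum scaler_sumr; apply: eq_bigr => k _.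
  by rewrite (iter_kap _ _ (v0 k)) -scalerA lin_fZ scalerA kapC.
rewrite exchange_big /=; apply: eq_bigr => k _.
by rewrite scalerA wu scaler_suml.
Qed.

Lemma averageD x y : average (x + y) = average x + average y.
Proof.
rewrite -big_split; apply: eq_bigr => q _ /=.
by rewrite scalerDr lin_fD scalerDr.
Qed.

Lemma average0 : average 0 = 0.
Proof. by apply: big1 => q _; rewrite scaler0 lin_f0 scaler0. Qed.

Lemma average_sum (I : Type) (s : seq I) (F : I -> V) :
  average (\sum_(k <- s) F k) = \sum_(k <- s) average (F k).
Proof. exact: (big_morph _ averageD average0). Qed.
End Averaging.

(** * The Koszul resolution of a pure module *)

Section KoszulComplex.
Variables (M : gmod A_) (m : int).
Hypothesis pureM : pure_weight m M.

Lemma pure_deg (x : M) : gmod_deg (- m) x.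
Proof.
have [_ /(_ x)[s [y [_ My ->]]] _] := gmod_direct M.
apply: (direct_sumr (gmod_direct M)) => i _.
by have [<-//|im] := eqVneq i (- m); rewrite (pureM im (My i)); apply: direct0 (gmod_direct M) _.
Qed.

(** Elements of positive degree push M out of its only degree, so they act by zero. *)
Lemma act_gam0 a (x : M) : a *: x = gam 0 a *: x.
Proof.
rewrite {1}[a]sum_expc_gam big_ord_recl mul1r scalerDl scaler_suml.
rewrite big1 ?addr0 // => i _; rewrite -scalerA.
apply: (@pureM ((lift ord0 i)%:Z - m)) ; first by rewrite lift0; lia.
by apply: gmod_scale (A_X _) (pure_deg _).
Qed.

Section Term.
Variable j : nat.

(** The function [f] stands for $\sum_i c^i \otimes f(i)$ in the A-module induced from $an_j M$, on
    which $A_0$ acts through [T j]. As $c^i A_0$ is $sy_i A_0$, the i-th coordinate is fixed by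
    [T j (sy i)]: the first j edges are antisymmetrized, the next i symmetrized, as in $\Lambda^j
    \otimes S^i$. *)
Definition kos : {pred nat -> M} := fun f =>
  `[< forall i, T j (sy i) *: f i = f i /\ an j *: f i = f i >].

Lemma kosP (f : nat -> M) :
  reflect (forall i, T j (sy i) *: f i = f i /\ an j *: f i = f i) (f \in kos).
Proof. exact: asboolP. Qed.

Fact kos_zmod_closed : zmod_closed kos.
Proof.
split=> [|f h /kosP fP /kosP hP]; apply/kosP => i; first by rewrite !scaler0.
have [sf af] := fP i; have [sh ah] := hP i.
have -> : (f - h) i = f i - h i by [].
by rewrite !scalerBr sf af sh ah.
Qed.
HB.instance Definition _ := GRing.isZmodClosed.Build _ kos kos_zmod_closed.

Record koszul_term := KoszulTerm { kfun :> nat -> M; kfunP : kfun \in kos }.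
HB.instance Definition _ := [isSub for kfun].
HB.instance Definition _ := [Choice of koszul_term by <:].
HB.instance Definition _ := [SubChoice_isSubZmodule of koszul_term by <:].

Lemma kfun_inj (f h : koszul_term) : (forall i, f i = h i) -> f = h.
Proof. by move=> fh; apply/val_inj/funext. Qed.

Lemma kfun_sy (f : koszul_term) i : T j (sy i) *: f i = f i.
Proof. by case: f => f fP; case: (kosP _ fP i). Qed.

Lemma kfun_an (f : koszul_term) i : an j *: f i = f i.
Proof. by case: f => f fP; case: (kosP _ fP i). Qed.

Lemma kfun_ge (f : koszul_term) i : (n < i)%N -> f i = 0.
Proof. by move=> ni; rewrite -kfun_sy sy_ge // iter_zero scale0r. Qed.

Lemma kfunD (f h : koszul_term) i : (f + h) i = f i + h i. Proof. by []. Qed.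
Lemma kfunB (f h : koszul_term) i : (f - h) i = f i - h i. Proof. by []. Qed.
Lemma kfun_sum (J : Type) (s : seq J) (F : J -> koszul_term) i :
  (\sum_(k <- s) F k) i = \sum_(k <- s) F k i.
Proof. by elim/big_rec2: _ => // k f h _ <-. Qed.

(** Writing $b c^i = \sum_l c^l\, gam_l(b c^i)$, the coefficient in $A_0$ crosses the tensor sign
    and acts through [T j]. *)
Fact kact_subproof b (f : koszul_term) :
  (fun l => \sum_(i < n.+1) T j (gam l (b * c ^+ i)) *: f i) \in kos.
Proof.
apply/kosP => l; rewrite !scaler_sumr; split; apply: eq_bigr => i _.
  by rewrite scalerA -(iter_mul j (sy0 _) (gam0 _ _)) sy_gam.
by rewrite scalerA -(comm_an (leqnn j) (gam0 _ _)) -scalerA kfun_an.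
Qed.
Definition kact b f := KoszulTerm (kact_subproof b f).

Fact kactA b b' f : kact b (kact b' f) = kact (b * b') f.
Proof.
apply: kfun_inj => l /=.
under eq_bigr do rewrite scaler_sumr; rewrite exchange_big /=.
apply: eq_bigr => i _.
under eq_bigr do rewrite scalerA -(iter_mul j (gam0 _ _) (gam0 _ _)).
rewrite -scaler_suml -iter_sum; congr (T j _ *: _).
under eq_bigr do rewrite -(gamM0 _ _ (gam0 _ _)) -mulrA.
by rewrite -raddf_sum -mulr_sumr -sum_expc_gam mulrA.
Qed.

Fact kact1 f : kact 1 f = f.
Proof.
apply: kfun_inj => l /=; have [nl|nl] := ltnP n l.
  by rewrite kfun_ge // big1 // => i _; rewrite mul1r gam_exp gtn_eqF ?iter_zero ?scale0r //; apply: leq_trans nl.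
rewrite (bigD1 (Ordinal (nl : (l < n.+1)%N))) //= mul1r gam_exp eqxx kfun_sy.
rewrite big1 ?addr0 // => i il; rewrite mul1r gam_exp ifN ?iter_zero ?scale0r //.
by apply: contra il => /eqP il; apply/eqP/val_inj.
Qed.
Fact kactDr b : {morph kact b : f h / f + h}.
Proof.
move=> f h; apply: kfun_inj => l; rewrite kfunD /= -big_split; apply: eq_bigr => i _.
by rewrite /= -scalerDr.
Qed.
Fact kactDl f : {morph kact^~ f : b b' / b + b'}.
Proof.
move=> b b'; apply: kfun_inj => l; rewrite kfunD /= -big_split; apply: eq_bigr => i _.
by rewrite /= mulrDl raddfD /= iter_add scalerDl.
Qed.
HB.instance Definition _ := GRing.Zmodule_isLmodule.Build A koszul_term
  kactA kact1 kactDr kactDl.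


(** The power $c^i$ has degree i and the generators sit in degree j - m; this placement is the
    linearity of the resolution. *)
Definition kdeg (d : int) : set koszul_term :=
  [set f | forall i, i%:Z + j%:Z - m != d -> f i = 0].

Fact krestr_subproof d (f : koszul_term) :
  (fun i => if i%:Z + j%:Z - m == d then f i else 0) \in kos.
Proof.
by apply/kosP => i; case: ifP => _; rewrite ?scaler0 // kfun_sy kfun_an.
Qed.
Definition krestr d f := KoszulTerm (krestr_subproof d f).

Fact kdeg_direct : direct_sum kdeg.
Proof.
split=> [d|f|s y us yd /[swap] d].
- by split=> // f h fd hd i di; rewrite kfunB fd // hd // subr0.
- exists [seq i%:Z + j%:Z - m | i <- iota 0 n.+1], (krestr^~ f); split.
  + by rewrite map_inj_uniq ?iota_uniq // => i i' /(congr1 (fun x => x + m)); lia.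
  + by move=> d i di; rewrite /= (negPf di).
  apply: kfun_inj => i; rewrite kfun_sum big_map /=.
  have [ni|ni] := ltnP n i.
    by rewrite kfun_ge // big1 // => k _; rewrite if_same.
  have iin : i \in iota 0 n.+1 by rewrite mem_iota.
  rewrite (bigD1_seq i iin (iota_uniq _ _)) eqxx big1 /= ?addr0 // => k ki.
  by rewrite ifN //; apply: contra ki => /eqP ki; apply/eqP; lia.
- move=> y0 ds; apply: kfun_inj => i; have [di|di] := eqVneq (i%:Z + j%:Z - m) d; last exact: yd.
  have yi : \sum_(k <- s) y k i = 0 by rewrite -kfun_sum y0.
  rewrite -[RHS]yi (bigD1_seq _ ds us) big1 /= ?addr0 // => k kd.
  by apply: yd; rewrite di eq_sym.
Qed.

Fact kdeg_scale (i : nat) (d : int) a (f : koszul_term) :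
  A_ i a -> kdeg d f -> kdeg (i%:Z + d) (a *: f).
Proof.
move=> Aa fd l ld; apply: big1 => k _.
have [kd|kd] := eqVneq (k%:Z + j%:Z - m) d; last by rewrite fd ?scaler0.
by rewrite (gam_deg Aa) ?iter_zero ?scale0r //; apply: contra ld => /eqP->; lia.
Qed.

Definition kmod : gmod A_ := Gmod kdeg_direct kdeg_scale.

Lemma kactE b (f : kmod) l :
  (b *: f : koszul_term) l = \sum_(i < n.+1) T j (gam l (b * c ^+ i)) *: f i.
Proof. by []. Qed.


Lemma kact_A0 y (f : kmod) i : A_ 0%N y ->
  (y *: f : koszul_term) i = T j (sy i * T i y) *: f i.
Proof.
move=> Ay; have [ni|ni] := ltnP n i.
  by rewrite (kfun_ge f ni) scaler0 (kfun_ge (y *: f : koszul_term) ni).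
have Ti := iter0 _ Ay.
rewrite kactE (bigD1 (Ordinal (ni : (i < n.+1)%N))) //= expc_th // gamM0 //.
rewrite gam_exp eqxx big1 ?addr0 // => k ki; rewrite expc_th // gamM0 // gam_exp.
rewrite ifN ?mul0r ?iter_zero ?scale0r //.
by apply: contra ki => /eqP ki; apply/eqP/val_inj.
Qed.

Lemma kact_kap a (f : kmod) i : (kap a *: f : koszul_term) i = kap a *: f i.
Proof.
rewrite kact_A0 // -[kap a]mulr1 (iter_kap _ _ A01) mulrA -kapC -mulrA.
have -> : sy i * T i 1 = sy i.
  rewrite sy_absorb //; first exact/iter0/A01.
  by rewrite -expc_th ?mul1r //; apply: A01.
by rewrite (iter_kap _ _ (sy0 i)) mulr1 -scalerA kfun_sy.
Qed.

(** The generator $1 \otimes an_j x$, of degree j - m; by [kgenP] such elements generate the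
    term. *)
Fact kgen_subproof (x : M) : (fun i => if i == 0%N then an j *: x else 0) \in kos.
Proof.
apply/kosP => i; case: eqP => [->|_]; last by rewrite !scaler0.
by rewrite sy_0 !scalerA an_th1 an_idem.
Qed.
Definition kgen x : kmod := KoszulTerm (kgen_subproof x).

Lemma kgenE x i : (kgen x : koszul_term) i = if i == 0%N then an j *: x else 0.
Proof. by []. Qed.

Lemma kgen_deg x : gmod_deg (j%:Z - m) (kgen x).
Proof. by move=> [|i] //; rewrite add0r eqxx. Qed.

Lemma kgenA0 y x : A_ 0%N y -> y *: kgen x = kgen (T j y *: x).
Proof.
move=> Ay; apply: kfun_inj => i; rewrite kact_A0 // !kgenE.
case: eqP => [->|_]; rewrite ?scaler0 //= sy_0 mul1r !scalerA.
by rewrite (comm_an (leqnn j)).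
Qed.

Lemma kgen_lin a x y : kgen (x + kap a *: y) = kgen x + kap a *: kgen y.
Proof.
apply: kfun_inj => i; rewrite kfunD kact_kap !kgenE.
case: eqP => _; last by rewrite scaler0 addr0.
by rewrite scalerDr !scalerA kapC.
Qed.

Lemma kgenP (f : kmod) : f = \sum_(i < n.+1) c ^+ i *: kgen (f i).
Proof.
apply: kfun_inj => l; rewrite kfun_sum.
have cE i (x : M) : (c ^+ i *: kgen x : koszul_term) l =
    if l == i then T j (sy i) *: (an j *: x) else 0.
  rewrite kactE big_ord_recl mulr1 kgenE /= gam_exp big1 => [|k _].
    by rewrite addr0; case: eqP => // _; rewrite iter_zero scale0r.
  by rewrite scaler0.
rewrite (eq_bigr (fun i : 'I_n.+1 =>
  if l == i then T j (sy i) *: (an j *: f i) else 0)); last by move=> i _; apply: cE.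
have [nl|nl] := ltnP n l.
  rewrite kfun_ge // big1 // => i _; rewrite gtn_eqF //.
  exact: leq_trans nl.
rewrite (bigD1 (Ordinal (nl : (l < n.+1)%N))) //= eqxx kfun_an kfun_sy.
rewrite big1 ?addr0 // => i il; rewrite ifN //.
by apply: contra il => /eqP il; apply/eqP/val_inj.
Qed.

Lemma ghom_dcomp (X Y : gmod A_) (f : {linear X -> Y}) d x : ghom f ->
  f (dcomp (gmod_direct X) d x) = dcomp (gmod_direct Y) d (f x).
Proof.
move=> homf; have [s [us s0 xE]] := dcomp_sum (gmod_direct X) x.
apply/esym; apply: (@dcomp_unique _ _ _ _ _ s (fun d => f (dcomp (gmod_direct X) d x))) => //.
- by move=> e; apply: homf; apply: dcomp_in.
- by move=> e /s0->; rewrite linear0.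
- by rewrite {1}xE linear_sum.
Qed.

(** The term is induced from a module over the separable ring $A_0$. Generators are lifted
    K-linearly into degree j - m, the lift is averaged to commute with $A_0$, and it is extended to
    the whole term by powers of [c]. *)
Lemma kmod_lift (Y Z : gmod A_) (p : {linear Y -> Z}) (f : {linear kmod -> Z}) :
  ghom p -> ghom f -> (forall x, exists y, p y = f x) ->
  exists2 h : {linear kmod -> Y}, ghom h & forall x, p (h x) = f x.
Proof.
move=> homp homf surj; pose d := j%:Z - m.
pose R : set (M * Y) := [set q | gmod_deg d q.2 /\ p q.2 = f (kgen q.1)].
have YZ a (y : Y) : A_ 0%N a -> gmod_deg d y -> gmod_deg d (a *: y).
  by move=> Aa dy; have := gmod_scale Aa dy; rewrite add0r.
have f0 : f (kgen 0) = 0.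
  suff -> : kgen 0 = 0 by rewrite linear0.
  by apply: kfun_inj => i; rewrite kgenE scaler0 if_same.
have [h0 [h0R _ h0lin]] : exists h : M -> Y, [/\ forall v, R (v, h v),
    forall v w, [set 0] (v, w) -> h v = w
  & forall a x y, h (x + kap a *: y) = h x + kap a *: h y].
  apply: (@linear_selection K) => //.
  - split=> [|a [x y] [x' y'] [/= dy py] [/= dy' py']].
      by split; rewrite ?linear0 ?f0 //; apply: (direct0 (gmod_direct Y)).
    split=> /=; first by apply: (directD (gmod_direct Y)) => //; apply: YZ.
    by rewrite linearD linearZ py py' kgen_lin linearD linearZ.
  - move=> x; have [y yE] := surj (kgen x); exists (dcomp (gmod_direct Y) d y).
    split=> /=; first exact: dcomp_in.
    by rewrite ghom_dcomp // yE dcomp_id //; apply: homf; apply: kgen_deg.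
  - by move=> _ ->; split=> /=; rewrite ?linear0 ?f0 //; apply: (direct0 (gmod_direct Y)).
  - by split=> // a _ _ -> -> /=; rewrite !scaler0 !addr0.
  - by move=> w [].
(* Averaging keeps the lifting property because f is already compatible with $A_0$ and $\sum_q u_q
   v_q = 1$. *)
pose h1 := average j h0.
have h1A a x : A_ 0%N a -> h1 (T j a *: x) = a *: h1 x by apply: averageA0.
have h1d x : gmod_deg d (h1 x).
  by apply: (direct_sumr (gmod_direct Y)) => q _; apply: YZ => //; case: (h0R (T j (v q) *: x)).
have ph1 x : p (h1 x) = f (kgen x).
  rewrite linear_sum -[RHS]scale1r -sep1 scaler_suml; apply: eq_bigr => q _.
  rewrite linearZ /=; have [_ /= ->] := h0R (T j (v q) *: x).
  by rewrite -kgenA0 // linearZ scalerA.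
pose h (x : kmod) : Y := \sum_(i < n.+1) c ^+ i *: h1 ((x : koszul_term) i).
have hlin : linear h.
  have hD x y : h (x + y) = h x + h y.
    rewrite -big_split; apply: eq_bigr => i _ /=.
    by rewrite -scalerDr -averageD.
  move=> b x y; rewrite hD; congr (_ + _).
  rewrite [LHS](eq_bigr (fun l : 'I_n.+1 => \sum_(i < n.+1)
      (c ^+ l * gam l (b * c ^+ i)) *: h1 ((x : koszul_term) i))).
    rewrite exchange_big scaler_sumr; apply: eq_bigr => i _.
    by rewrite -scaler_suml -sum_expc_gam scalerA.
  move=> l _; rewrite kactE /h1 average_sum // scaler_sumr.
  apply: eq_bigr => i _; rewrite -scalerA; congr (_ *: _).
  by apply: h1A; apply: gam0.
pose H : {linear kmod -> Y} := HB.pack_for {linear kmod -> Y} h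
  (GRing.isLinear.Build A kmod Y *:%R h hlin).
exists H.
  move=> e x xe; apply: (direct_sumr (gmod_direct Y)) => i _.
  have [ie|ie] := eqVneq (i%:Z + j%:Z - m) e; last first.
    by rewrite xe // /h1 average0 // scaler0; apply: (direct0 (gmod_direct Y)).
  by rewrite -ie -addrA; apply: gmod_scale (A_X _) (h1d _).
move=> x; rewrite /= /h linear_sum {2}[x]kgenP linear_sum.
by apply: eq_bigr => i _; rewrite !linearZ /= ph1.
Qed.

End Term.
Lemma scale_invMn k (x : M) : inv k *: (x *+ k.+1) = x.
Proof. by rewrite -scaler_nat scalerA inv_mulrn scale1r. Qed.

Lemma mulrSn_eq0 (x : M) k : x *+ k.+1 = 0 -> x = 0.
Proof. by rewrite -{2}(scale_invMn k x) => ->; rewrite scaler0. Qed.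

(** The Koszul differential passes the last antisymmetrized edge to the symmetrized ones. *)
Fact kdiff_subproof j (f : koszul_term j.+1) :
  (fun i => if i is i'.+1 then T j (sy i) *: f i' else 0) \in kos j.
Proof.
apply/kosP => -[|i]; first by rewrite !scaler0.
rewrite !scalerA -(iter_mul j (sy0 _) (sy0 _)) sy_idem; split=> //.
rewrite -(comm_an (leqnn j) (sy0 _)) -scalerA -(kfun_an f i) [an j *: _]scalerA.
by rewrite an_pred.
Qed.
Definition kdiff j (f : kmod j.+1) : kmod j :=
  KoszulTerm (kdiff_subproof f).

Lemma kdiffE j (f : kmod j.+1) i : (kdiff f : koszul_term j) i =
  if i is i'.+1 then T j (sy i) *: (f : koszul_term j.+1) i' else 0.
Proof. by []. Qed.

Fact kdiff_linear j : linear (@kdiff j).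
Proof.
have kdiffD (f h : kmod j.+1) : kdiff (f + h) = kdiff f + kdiff h.
  apply: kfun_inj => i; rewrite kfunD !kdiffE; case: i => [|i]; first by rewrite addr0.
  by rewrite -scalerDr.
move=> b f h; rewrite kdiffD; congr (_ + _); apply: kfun_inj => -[|l].
  rewrite kdiffE kactE big1 // => -[[|i] ilt] _; first by rewrite scaler0.
  by rewrite gam_lt // iter_zero scale0r.
rewrite kdiffE !kactE [RHS]big_ord_recl scaler0 add0r scaler_sumr.
transitivity (\sum_(i < n.+1) T j (gam l.+1 (b * c ^+ i.+1)) *: (f : koszul_term j.+1) i).
  apply: eq_bigr => i _; rewrite scalerA iterSr -iter_mul; last 2 first.
  - exact: sy0.
  - exact/th0/gam0.
  by rewrite -gam_mulc -mulrA -exprSr.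
rewrite big_ord_recr /= cn mulr0 raddf0 iter_zero scale0r addr0.
apply: eq_bigr => i _; rewrite scalerA -(iter_mul j (gam0 _ _) (sy0 _)).
by rewrite -gamM0 ?lift0; [rewrite -mulrA expc_sy | apply: sy0].
Qed.
HB.instance Definition _ j :=
  GRing.isLinear.Build A (kmod j.+1) (kmod j) *:%R (@kdiff j) (@kdiff_linear j).

Lemma kdiff_ghom j : ghom (@kdiff j : {linear kmod j.+1 -> kmod j}).
Proof.
move=> d f fd [|i] id; rewrite kdiffE // (fd i) ?scaler0 //.
by apply: contra id => /eqP<-; apply/eqP; lia.
Qed.

Definition kaug (f : kmod 0) : M := (f : koszul_term 0) 0%N.

Fact kaug_linear : linear kaug.
Proof.
move=> b f h; have -> : kaug (b *: f + h) = kaug (b *: f) + kaug h by [].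
congr (_ + _); rewrite [RHS]act_gam0 /kaug kactE big_ord_recl mulr1.
by rewrite big1 ?addr0 // => i _; rewrite gam_lt ?lift0 // iter_zero scale0r.
Qed.
HB.instance Definition _ :=
  GRing.isLinear.Build A (kmod 0) M *:%R kaug kaug_linear.

Lemma kaug_ghom : ghom (kaug : {linear kmod 0 -> M}).
Proof.
move=> d f fd; have [->|dm] := eqVneq d (- m); first exact: pure_deg.
have f0 : kaug f = 0 by apply: fd; apply: contra dm => /eqP<-; apply/eqP; lia.
by rewrite /= f0; apply: direct0 (gmod_direct M) _.
Qed.

Lemma kaug_surj (x : M) : exists f, kaug f = x.
Proof. by exists (kgen 0 x); rewrite /kaug kgenE an_0 scale1r. Qed.

(** Two steps symmetrize a pair of edges in which the argument is antisymmetric: the value equals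
    its own negative under the swap [T j t], so twice it is zero. *)
Lemma kdiff_sq j (f : kmod j.+2) : kdiff (kdiff f) = 0.
Proof.
apply: kfun_inj => -[|[|i]]; rewrite !kdiffE ?scaler0 //.
set x := (f : koszul_term j.+2) i.
have xE : T j t *: x = - x.
  by rewrite -{1}[x](kfun_an f i) -/x scalerA an_t // scaleNr (kfun_an f i).
rewrite scalerA iterSr -(iter_mul j (sy0 _) (th0 (sy0 _))) sy_th.
have yE : T j (sy i.+2) *: x = - (T j (sy i.+2) *: x).
  by rewrite -{1}sy_tr (iter_mul j (sy0 _) t0) -scalerA xE scalerN.
apply: (@mulrSn_eq0 _ 1); apply/eqP; rewrite mulr2n addr_eq0; exact/eqP.
Qed.

Lemma kaug_kdiff (f : kmod 1) : kaug (kdiff f) = 0. Proof. by []. Qed.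

(** On a cycle one of the two summands of [koszul_homotopy] vanishes, so i + j times the cycle is a
    boundary and one may divide. *)
Lemma kdiff_exact j (f : kmod j) :
  (if j is j'.+1 return kmod j -> Prop then fun f => kdiff f = 0
   else fun f => kaug f = 0) f -> exists h, kdiff h = f.
Proof.
move=> df; pose x i := (f : koszul_term j) i.
have hom i : (T j (sy i) *: (an j.+1 *: x i)) *+ (i * j.+1) = x i *+ (i + j).
  have [e [se ae ex]] : exists e,
      [/\ T j (sy i) * e = e, an j * e = e & e *: x i = x i].
    exists (T j (sy i) * an j); split.
    - by rewrite mulrA -(iter_mul j (sy0 _) (sy0 _)) sy_idem.
    - by rewrite (comm_an (leqnn j) (sy0 _)) mulrA an_idem.
    - by rewrite -scalerA kfun_an kfun_sy.
  have := congr1 (fun a => a *: x i) (koszul_homotopy se ae).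
  rewrite scalerDl -!scalerMnl -!scalerA ex => <-.
  (* This summand contains component i+1 of the boundary of [f]; for j = 0 its multiplicity is
     zero. *)
  suff -> : (an j *: (T j.-1 (sy i.+1) *: x i)) *+ (i.+1 * j) = 0 by rewrite add0r.
  case: j f df @x {e se ae ex} => [|j] f df x; first by rewrite muln0.
  have := congr1 (fun h : kmod j => (h : koszul_term j) i.+1) df.
  by rewrite kdiffE => ->; rewrite scaler0 mul0rn.
(* Component i of the preimage comes from component i+1 of [f], so the numbers of [hom] are taken at
   i+1: the multiplicity (i+1)(j+1) and the divisor i+1+j. *)
pose y i : M := kap ((i.+1 * j.+1)%:R / (i.+1 + j)%:R) *:
  (T j.+1 (sy i) *: (an j.+1 *: x i.+1)).
have yP : y \in kos j.+1.
  have kapS a b (z : M) : b *: (kap a *: z) = kap a *: (b *: z).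
    by rewrite !scalerA kapC.
  apply/kosP => i; rewrite !kapS; split; congr (_ *: _).
    by rewrite scalerA -(iter_mul _ (sy0 _) (sy0 _)) sy_idem.
  rewrite scalerA -(comm_an (leqnn _) (sy0 _)) -scalerA.
  by rewrite [an _ *: (an _ *: _)]scalerA an_idem.
exists (KoszulTerm yP : kmod j.+1); apply: kfun_inj => -[|i]; rewrite kdiffE.
  (* Boundaries have no component at index 0. For j = 0 that component of [f] is its augmentation;
     otherwise [hom] at 0 says that j times it is zero. *)
  case: j f df @x hom {y yP} => [|j] f df x hom; first exact/esym.
  by apply/esym; have /esym/mulrSn_eq0 := hom 0%N.
rewrite /y scalerA -kapC -scalerA iterSr [T j (sy i.+1) *: (_ *: _)]scalerA.
rewrite -(iter_mul j (sy0 _) (th0 (sy0 _))) sy_th rmorphM kapC -scalerA.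
by rewrite rmorph_nat scaler_nat hom; apply: scale_invMn.
Qed.

End KoszulComplex.

(** * Semisimplicity of the degree zero part *)

Section SemisimpleDegreeZero.

(** A K-linear projection onto [L], averaged and evaluated at 1, gives a right identity of [L]. *)
Lemma left_ideal_idem L : left_ideal (A_ 0%N) L ->
  exists2 e, L e & forall x, L x -> x * e = x.
Proof.
move=> [LA L0 LD LM].
have Lk a x : L x -> L (kap a * x) by apply: LM.
have [f [Lf fid flin]] : exists f : A^o -> A^o, [/\ forall z, [set p : A^o * A^o | L p.2] (z, f z),
    forall z w, [set p : A^o * A^o | L p.1 /\ p.2 = p.1] (z, w) -> f z = w
  & forall a x y, f (x + kap a *: y) = f x + kap a *: f y].
  apply: (@linear_selection K).
  - by split=> //= a p q Lp Lq; apply: LD => //; apply: Lk.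
  - by move=> z; exists 0.
  - by move=> [p q] /= [Lp ->].
  - by split=> //= a [p p'] [q q'] /= [Lp ->] [Lq ->]; split=> //; apply: LD => //; apply: Lk.
  - by move=> w [].
have f_id x : L x -> f x = x by move=> Lx; apply: fid.
exists (average 0 f (1 : A^o)).
  rewrite /average; apply: big_ind => // q _.
  by apply: LM => //; apply: Lf.
move=> x Lx; have Ax := LA _ Lx.
rewrite -[LHS](@averageA0 A^o A^o 0 f flin x 1 Ax) /average.
rewrite -[RHS]mul1r -[X in _ = X * _]sep1 mulr_suml; apply: eq_bigr => q _.
rewrite -mulrA; congr (_ * _).
have -> : T 0 (v q) *: (T 0 x *: (1 : A^o)) = v q * x.
  by rewrite /GRing.scale /= mulr1.
by rewrite f_id //; apply: LM.
Qed.

Local Notation N := #|{: Q * Q}|.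
Let b (i : 'I_N) : A := u (enum_val i).1 * v (enum_val i).2.
Let phi (r : 'rV[K]_N) : A := \sum_i kap (r 0 i) * b i.

Lemma phi_linear a r r' : phi (a *: r + r') = kap a * phi r + phi r'.
Proof.
rewrite /phi mulr_sumr -big_split; apply: eq_bigr => i _ /=.
by rewrite !mxE rmorphD rmorphM mulrDl mulrA.
Qed.

(** Since $x = \sum_q x u_q v_q$ and each $x u_q$ is a combination of the [u], the products of the
    [u] and the [v] span $A_0$, which is thus finite-dimensional over K. *)
Lemma phi_surj x : A_ 0%N x -> exists r, phi r = x.
Proof.
move=> Ax; have [w [wu _]] := sepC Ax.
exists (\row_i w (enum_val i).2 (enum_val i).1); rewrite /phi.
transitivity (\sum_(p : Q * Q) kap (w p.2 p.1) * (u p.1 * v p.2)).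
  rewrite (reindex (@enum_val (Q * Q)%type predT)) /=; last exact: onW_bij (enum_val_bij _).
  by apply: eq_bigr => i _; rewrite mxE.
rewrite -(pair_bigA _ (fun k q => kap (w q k) * (u k * v q))) /= exchange_big.
rewrite -[RHS]mulr1 -sep1 mulr_sumr; apply: eq_bigr => q _ /=.
by rewrite mulrA wu mulr_suml; apply: eq_bigr => k _; rewrite mulrA.
Qed.

(** For a left ideal the largest rank of such a [U] is the dimension of the preimage of [L] under
    [phi], the measure of the induction below. *)
Definition spans_in (L : set A) (U : 'M[K]_N) :=
  forall r : 'rV[K]_N, (r <= U)%MS -> L (phi r).

Lemma phi0 : phi 0 = 0.
Proof. by rewrite /phi big1 // => i _; rewrite mxE rmorph0 mul0r. Qed.

Definition simple_sum (x : A) : Prop :=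
  exists (k : nat) (L : 'I_k -> set A) (y : 'I_k -> A),
    (forall i, simple_left_ideal (A_ 0%N) (L i) /\ L i (y i)) /\ x = \sum_i y i.

Lemma simple_sum0 : simple_sum 0.
Proof. by exists 0%N, (fun=> set0), (fun=> 0); split; [case | rewrite big_ord0]. Qed.

Lemma simple_sumD x y : simple_sum x -> simple_sum y -> simple_sum (x + y).
Proof.
move=> [k [L [a [La ->]]]] [k' [L' [a' [La' ->]]]].
exists (k + k')%N, (fun i : 'I_(k + k') => match fintype.split i with inl i => L i | inr i => L' i end).
exists (fun i : 'I_(k + k') => match fintype.split i with inl i => a i | inr i => a' i end).
split=> [i|]; first by case: fintype.split.
rewrite big_split_ord; congr (_ + _); apply: eq_bigr => i _.
  by rewrite (fintype.unsplitK (inl i)).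
by rewrite (fintype.unsplitK (inr i)).
Qed.

Lemma spans_in_step (L L' : set A) U y : left_ideal (A_ 0%N) L -> L' `<=` L ->
  spans_in L' U -> L y -> ~ L' y ->
  exists2 U', spans_in L U' & (\rank U < \rank U')%N.
Proof.
move=> [LA L0 LD LM] L'L UL' Ly L'y; have [r ry] := phi_surj (LA _ Ly).
exists (U + r)%MS.
  move=> s /sub_addsmxP[[u1 u2] ->]; rewrite -[u1 *m U]scale1r phi_linear.
  rewrite rmorph1 mul1r; apply: LD; first by apply/L'L/UL'; rewrite submxMl.
  rewrite [u2]mx11_scalar mul_scalar_mx -[_ *: r]addr0 phi_linear phi0 addr0 ry.
  by apply: LM.
apply: rank_ltmx; rewrite ltmxE addsmxSl /=; apply/negP => sub; apply: L'y.
by rewrite -ry; apply: UL'; apply: submx_trans sub; apply: addsmxSr.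
Qed.

(** A nonzero left ideal that is not simple contains a proper nonzero one with a right identity e,
    and $x = (x - x e) + x e$ splits it into two proper left ideals, both of smaller measure. *)
Lemma bounded_simple_sum k L : left_ideal (A_ 0%N) L ->
  (forall U, spans_in L U -> (\rank U <= k)%N) -> forall x, L x -> simple_sum x.
Proof.
elim: k L => [|k IHk] L idL rkL x Lx; have [LA L0 LD LM] := idL.
  have [->|x0] := eqVneq x 0; first exact: simple_sum0.
  have [| | | |U' UL' r0] := @spans_in_step L [set 0] 0 x idL => //.
  - by move=> _ ->.
  - by move=> r; rewrite submx0 => /eqP->; exact: phi0.
  - by move=> x00; case/eqP: x0.
  - by have := leq_trans r0 (rkL _ UL').
have LB y z : L y -> L z -> L (y - z).
  by move=> Ly Lz; rewrite -mulN1r; apply: LD => //; apply: LM => //; apply/A_N/A01.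
have [simL|nsimL] := pselect (simple_left_ideal (A_ 0%N) L).
  exists 1%N, (fun=> L), (fun=> x); split=> //; by rewrite big_ord1.
have proper L' : left_ideal (A_ 0%N) L' -> L' `<=` L -> L' <> L ->
    forall y, L' y -> simple_sum y.
  move=> idL' L'L neqL; apply: IHk => // U UL'.
  have [y Ly L'y] : exists2 y, L y & ~ L' y.
    apply: contrapT => no; apply: neqL; apply/seteqP; split=> // y Ly.
    by apply: contrapT => L'y; apply: no; exists y.
  have [U' U'L ltU] := spans_in_step idL L'L UL' Ly L'y.
  by rewrite -ltnS; apply: leq_trans ltU (rkL _ U'L).
have [L'0|L'n0] := pselect (L = [set 0]).
  by move: Lx; rewrite L'0 => ->; exact: simple_sum0.
have [L' [idL' L'L L'neq0 L'neq]] : exists L', [/\ left_ideal (A_ 0%N) L',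
    L' `<=` L, L' <> [set 0] & L' <> L].
  apply: contrapT => no; apply: nsimL; split=> // L' idL' L'L.
  have [|L'0] := pselect (L' = [set 0]); first by left.
  have [|L'neq] := pselect (L' = L); first by right.
  by case: no; exists L'.
have [e L'e eid] := left_ideal_idem idL'; have Ae := LA _ (L'L _ L'e).
have [_ L'z L'D L'M] := idL'.
pose L2 : set A := [set y | L y /\ y * e = 0].
rewrite -[x](subrK (x * e)); apply: simple_sumD; last first.
  by apply: (proper L') => //; apply: L'M => //; apply: LA.
have Ax := LA _ Lx.
apply: (proper L2); first split.
- by move=> y [/LA].
- by split; rewrite ?mul0r.
- by move=> y z [Ly ye] [Lz ze]; split; [apply: LD | rewrite mulrDl ye ze addr0].
- by move=> s y As [Ly ye]; split; [apply: LM | rewrite -mulrA ye mulr0].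
- by move=> y [].
- move=> L2L; have : L2 e by rewrite L2L; apply: L'L.
  case=> _; rewrite eid // => e0; apply: L'neq0; apply/seteqP; split=> y /=.
    by move=> /eid <-; rewrite e0 mulr0.
  by move=> ->.
- split; first by apply: LB => //; apply/L'L/L'M.
  by rewrite mulrBl -mulrA (eid e L'e) subrr.
Qed.

Lemma semisimple_degree0 : semisimple_subring (A_ 0%N).
Proof.
move=> x Ax; apply: (@bounded_simple_sum N (A_ 0%N)) => //.
  by split=> //; [apply: A_0 | apply: A_D | apply: A0M].
by move=> U _; apply: rank_leq_row.
Qed.

End SemisimpleDegreeZero.

(** The i-th term is generated in degree i - m while N lives in degree -n', so a graded map between
    them kills the generators unless i = m - n'. *)
Lemma koszul_criterion : koszul A_.
Proof.
split=> //; first exact: semisimple_degree0.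
move=> M N m n' pureM pureN i imn P.
apply: (@ext_zero_of_resolution A A_ M N P (kmod M m)
  (fun j => @kdiff M m j) (@kaug M m)) => //.
- by move=> j; apply: kmod_lift.
- by move=> j; apply: kdiff_ghom.
- exact: kaug_ghom.
- exact: kaug_surj.
- move=> f; split=> [f0|[h <-]]; last exact: kaug_kdiff.
  by apply: (@kdiff_exact M m 0).
- move=> j f; split=> [f0|[h <-]]; last exact: kdiff_sq.
  by apply: (@kdiff_exact M m j.+1).
move=> f homf x; rewrite [x]kgenP linear_sum big1 // => k _.
rewrite linearZ /=; suff -> : f (kgen m i ((x : koszul_term M i) k)) = 0.
  by rewrite scaler0.
apply: (pureN (i%:Z - m)); first by apply: contra imn => /eqP; lia.
by apply: homf; apply: kgen_deg.
Qed.

End KoszulCriterion.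

(** * Free modules, coefficients and supports *)

Section FreeModules.
Variable K : fieldType.

(* The free module on [I] is taken up to an opaque isomorphism: conversion  *)
(* would otherwise keep unfolding finite supports.                          *)
Fact free_subproof (I : choiceType) : {F : lmodType K &
  {to : {linear F -> {malg K[I]}} & {from : {linear {malg K[I]} -> F} |
    cancel to from /\ cancel from to}}}.
Proof.
pose F : lmodType K := {malg K[I]}.
by exists F, (@idfun F : {linear F -> F}), (@idfun F : {linear F -> F}).
Qed.

Definition fm (I : choiceType) : lmodType K := projT1 (free_subproof I).
Definition fm_malg (I : choiceType) : {linear fm I -> {malg K[I]}} :=
  projT1 (projT2 (free_subproof I)).
Definition malg_fm (I : choiceType) : {linear {malg K[I]} -> fm I} :=
  sval (projT2 (projT2 (free_subproof I))).
Lemma fm_malgK (I : choiceType) : cancel (@fm_malg I) (@malg_fm I).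
Proof. by case: (svalP (projT2 (projT2 (free_subproof I)))). Qed.
Lemma malg_fmK (I : choiceType) : cancel (@malg_fm I) (@fm_malg I).
Proof. by case: (svalP (projT2 (projT2 (free_subproof I)))). Qed.

Fact bas_key : unit. Proof. exact: tt. Qed.
Definition bas := locked_with bas_key
  (fun (I : choiceType) (k : I) => malg_fm I << k >>).
Definition coef := locked_with bas_key
  (fun (I : choiceType) (u : fm I) (k : I) => (fm_malg I u)@_k).
Definition fsup := locked_with bas_key
  (fun (I : choiceType) (u : fm I) => msupp (fm_malg I u) : seq I).
Definition ext (I : choiceType) (V : lmodType K) (h : I -> V) :
    {linear fm I -> V} :=
  locked_with bas_key (lext h \o fm_malg I : {linear fm I -> V}).

Section Basis.
Variable I : choiceType.
Implicit Types (u v : fm I) (k : I).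

Lemma mem_fsup u k : (k \in fsup u) = (coef u k != 0).
Proof. by rewrite /fsup /coef !locked_withE mcoeff_neq0. Qed.
Lemma fsup_uniq u : uniq (fsup u).
Proof. by rewrite /fsup locked_withE; apply: fset_uniq. Qed.
Lemma coefD u v k : coef (u + v) k = coef u k + coef v k.
Proof. by rewrite /coef locked_withE linearD mcoeffD. Qed.
Lemma coefZ a u k : coef (a *: u) k = a * coef u k.
Proof. by rewrite /coef locked_withE linearZ mcoeffZ. Qed.
Lemma coef0 k : coef (0 : fm I) k = 0.
Proof. by rewrite /coef locked_withE linear0 mcoeff0. Qed.
Lemma coef_bas k k' : coef (bas k) k' = (k == k')%:R.
Proof. by rewrite /coef /bas !locked_withE /= malg_fmK mcoeffU. Qed.
Lemma coef_inj u v : (forall k, coef u k = coef v k) -> u = v.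
Proof.
move=> uv; rewrite -[u]fm_malgK -[v]fm_malgK; congr (malg_fm I _).
by apply/malgP => k; have := uv k; rewrite /coef locked_withE.
Qed.
Lemma coef_sum (J : Type) (s : seq J) (F : J -> fm I) k :
  coef (\sum_(j <- s) F j) k = \sum_(j <- s) coef (F j) k.
Proof. by elim/big_rec2: _ => [|j a b _ <-]; rewrite ?coef0 ?coefD. Qed.
Lemma fsup_bas k k' : (k' \in fsup (bas k)) = (k' == k).
Proof.
by rewrite [k' == k]eq_sym mem_fsup coef_bas; case: (k == k'); rewrite ?oner_eq0 ?eqxx.
Qed.
Lemma coefN u k : coef (- u) k = - coef u k.
Proof. by rewrite -scaleN1r coefZ mulN1r. Qed.
Lemma coef_out u k : k \notin fsup u -> coef u k = 0.
Proof. by rewrite mem_fsup negbK => /eqP. Qed.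
End Basis.

Section Ext.
Variables (I : choiceType) (V : lmodType K).
Implicit Types (h : I -> V) (u : fm I).

Lemma extE h u : ext h u = \sum_(k <- fsup u) coef u k *: h k.
Proof. by rewrite /ext /fsup /coef !locked_withE. Qed.
Lemma extU h k : ext h (bas k) = h k.
Proof.
rewrite /ext /bas !locked_withE /= malg_fmK.
by rewrite /lext msuppU oner_eq0 big_seq_fset1 mcoeffUU scale1r.
Qed.

Lemma eq_ext_in h h' u : (forall k, k \in fsup u -> h k = h' k) ->
  ext h u = ext h' u.
Proof. by move=> hh'; rewrite !extE; apply: eq_big_seq => k /hh' ->. Qed.

Lemma eq_ext h h' u : h =1 h' -> ext h u = ext h' u.
Proof. by move=> hh'; apply: eq_ext_in => k _. Qed.

Lemma extB h h' u : ext (fun k => h k - h' k) u = ext h u - ext h' u.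
Proof. by rewrite !extE -sumrB; apply: eq_bigr => k _; rewrite scalerBr. Qed.

Lemma extD h h' u : ext (fun k => h k + h' k) u = ext h u + ext h' u.
Proof. by rewrite !extE -big_split; apply: eq_bigr => k _; rewrite scalerDr. Qed.

Lemma ext_scale a h u : ext (fun k => a *: h k) u = a *: ext h u.
Proof. by rewrite !extE scaler_sumr; apply: eq_bigr => k _; rewrite !scalerA mulrC. Qed.

Lemma ext_cst0 u : ext (fun=> 0 : V) u = 0.
Proof. by rewrite extE big1 // => k _; rewrite scaler0. Qed.

Lemma ext_sumr (J : Type) (s : seq J) (F : J -> I -> V) u :
  ext (fun k => \sum_(j <- s) F j k) u = \sum_(j <- s) ext (F j) u.
Proof.
elim: s => [|j s IHs].
  by under eq_ext do rewrite big_nil; rewrite ext_cst0 big_nil.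
by under eq_ext do rewrite big_cons; rewrite extD IHs big_cons.
Qed.
End Ext.

Lemma linear_ext (I : choiceType) (V V' : lmodType K) (L : {linear V -> V'})
    (h : I -> V) u : L (ext h u) = ext (fun k => L (h k)) u.
Proof. by rewrite !extE linear_sum; apply: eq_bigr => k _; rewrite linearZ. Qed.

Section Supp.
Variable I : choiceType.
Implicit Types (u v : fm I) (Q : I -> Prop).

Lemma ext_id u : ext (fun k => bas k) u = u.
Proof.
apply: coef_inj => k; rewrite extE coef_sum; have [ku|ku] := boolP (k \in fsup u).
  rewrite (bigD1_seq k) ?fsup_uniq //= big1 ?addr0 => [|i ik].
    by rewrite coefZ coef_bas eqxx mulr1.
  by rewrite coefZ coef_bas (negPf ik) mulr0.
rewrite (coef_out ku) big_seq big1 // => i iu.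
by rewrite coefZ coef_bas (_ : (i == k) = false) ?mulr0 //; apply: contraNF ku => /eqP <-.
Qed.

Lemma ext_id_in (h : I -> fm I) u :
  (forall k, k \in fsup u -> h k = bas k) -> ext h u = u.
Proof. by move=> /eq_ext_in ->; apply: ext_id. Qed.

Lemma coef_ext_scale (a : I -> K) u k :
  coef (ext (fun i => a i *: bas i) u) k = a k * coef u k.
Proof.
rewrite -[in RHS](ext_id u) !extE !coef_sum mulr_sumr; apply: eq_bigr => i _.
rewrite !coefZ !coef_bas; case: eqP => [->|_]; last by rewrite !mulr0.
by rewrite !mulr1 mulrC.
Qed.

Record supp Q u : Prop := Supp { suppP :> forall k, k \in fsup u -> Q k }.

Lemma supp0 Q : supp Q 0. Proof. by split=> k; rewrite mem_fsup coef0 eqxx. Qed.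
Lemma suppD Q u v : supp Q u -> supp Q v -> supp Q (u + v).
Proof.
move=> [Qu] [Qv]; split=> k; have [/Qu//|ku] := boolP (k \in fsup u).
by rewrite mem_fsup coefD (coef_out ku) add0r -mem_fsup => /Qv.
Qed.
Lemma suppZ Q a u : supp Q u -> supp Q (a *: u).
Proof.
move=> [Qu]; split=> k; have [/Qu//|ku] := boolP (k \in fsup u).
by rewrite mem_fsup coefZ (coef_out ku) mulr0 eqxx.
Qed.
Lemma suppN Q u : supp Q u -> supp Q (- u).
Proof. by rewrite -scaleN1r; apply: suppZ. Qed.
Lemma suppU Q k : Q k -> supp Q (bas k).
Proof. by move=> Qk; split=> i; rewrite fsup_bas => /eqP ->. Qed.
Lemma supp_sum (J : Type) (s : seq J) (P : pred J) (F : J -> fm I) Q :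
  (forall j, P j -> supp Q (F j)) -> supp Q (\sum_(j <- s | P j) F j).
Proof. by move=> QF; apply: big_ind => //; [apply: supp0 | apply: suppD]. Qed.
Lemma sub_supp Q Q' u : (forall k, Q k -> Q' k) -> supp Q u -> supp Q' u.
Proof. by move=> QQ' [Qu]; split=> k /Qu/QQ'. Qed.

Lemma supp_ext (J : choiceType) (h : J -> fm I) (u : fm J) Q :
  (forall j, j \in fsup u -> supp Q (h j)) -> supp Q (ext h u).
Proof.
move=> Qh; rewrite extE big_seq; apply: supp_sum => j ju.
by apply: suppZ; apply: Qh.
Qed.

End Supp.
End FreeModules.


(** * Words of letters and the derivations acting on them *)

Section Words.
Variables (K : fieldType) (X : lie_kind).

(* A letter is a pair (type, index): type 0 for the basis vectors of [V],   *)
(* type 1 for those of [V_*], and type 2 for auxiliary letters on which the *)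
(* Lie algebra acts by 0.                                                   *)
Definition letter := (nat * nat)%type.
Definition word := seq letter.
Local Notation L1 := (fm K letter).
Local Notation U := (fm K word).
Local Notation W w := (bas K (w : word)).

Definition okt (tau : nat) := (tau == 0%N) || is_SL X && (tau == 1%N).
Definition tb (tau : nat) := if is_SL X then (1 - tau)%N else tau.
Definition flip (k : nat) := if odd k then k.-1 else k.+1.
(** The partner of [l] under the invariant form, [eps] being the sign of that pairing. For the
    symplectic form the partner exchanges the indices 2k and 2k+1, which is [flip]. *)
Definition bar (l : letter) : letter :=
  match X with
  | LieSL => ((1 - l.1)%N, l.2) | LieO => l | LieSP => (l.1, flip l.2)
  end.
Definition eps (l : letter) : K := if X is LieSP then (-1) ^+ odd l.2 else 1.
Definition okl (l : letter) := okt l.1 || (l.1 == 2%N).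
Definition ty (w : word) : seq nat := map fst w.

Lemma flipK : involutive flip.
Proof.
move=> k; rewrite /flip; case kk: (odd k) => /=; last by rewrite kk.
by case: k kk => //= k /negbTE ->.
Qed.

Lemma okt_tb tau : okt tau -> okt (tb tau).
Proof. by rewrite /okt /tb; case: X => //=; case: tau => [|[|]]. Qed.
Lemma tbK tau : okt tau -> tb (tb tau) = tau.
Proof. by rewrite /okt /tb; case: X => //=; case: tau => [|[|]]. Qed.
Lemma bar1 l : (bar l).1 = tb l.1.
Proof. by rewrite /bar /tb; case: X. Qed.
Lemma barK l : okt l.1 -> bar (bar l) = l.
Proof.
rewrite /okt /bar; case: l => tau k; case: X => //=; last by rewrite flipK.
by case: tau => [|[|]].
Qed.
Lemma bar_neq2 l k : okt l.1 -> bar l != (2%N, k).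
Proof.
move=> ol; apply/eqP => /(congr1 fst); rewrite bar1 => /= b2.
by have := okt_tb ol; rewrite b2 /okt; case: X.
Qed.
Lemma okt2 : okt 2 = false. Proof. by rewrite /okt; case: X. Qed.

Implicit Types (D : letter -> L1) (w v : word) (y a b l : letter) (u : U).

(** The derivation of the tensor algebra that extends [D]. *)
Fixpoint derw (D : letter -> L1) (w : word) : U :=
  if w is l :: w' then
    ext (fun l' => W (l' :: w')) (D l) + ext (fun v => W (l :: v)) (derw D w')
  else 0.

Lemma eq_derw D D' w : {in w, D =1 D'} -> derw D w = derw D' w.
Proof.
elim: w => //= l w IHw DD'; rewrite DD' ?mem_head // IHw // => k kw.
by apply: DD'; rewrite inE kw orbT.
Qed.

Lemma derw_ty D w : {in w, forall l, supp (fun l' => l'.1 = l.1) (D l)} ->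
  supp (fun v => ty v = ty w) (derw D w).
Proof.
elim: w => [|l w IHw] Dty /=; first exact: supp0.
apply: suppD; apply: supp_ext => v vw; apply: suppU => /=.
  by rewrite (Dty l _ v vw) ?mem_head.
by rewrite (IHw _ v vw) // => k kw; apply: Dty; rewrite inE kw orbT.
Qed.

Lemma derw_mem D y w : D y = 0 -> y \in w -> supp (fun v => y \in v) (derw D w).
Proof.
move=> Dy; elim: w => //= l w IHw; rewrite inE => yw.
apply: suppD; apply: supp_ext => v vw; apply: suppU; rewrite inE.
  case/predU1P: yw => [yl|->]; last by rewrite orbT.
  by move: vw; rewrite -yl Dy mem_fsup coef0 eqxx.
by case/predU1P: yw => [->|/IHw/(_ v vw) ->]; rewrite ?eqxx ?orbT.
Qed.

Lemma derw_notin D y w : y \notin w -> {in w, forall l, supp (fun l' => l' != y) (D l)} ->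
  supp (fun v => y \notin v) (derw D w).
Proof.
elim: w => [|l w IHw]; first by move=> _ _; exact: supp0.
rewrite inE negb_or => /andP[yl yw] Dy.
apply: suppD; apply: supp_ext => v vw; apply: suppU; rewrite inE negb_or.
  by rewrite eq_sym (Dy l _ v vw) ?mem_head.
rewrite yl (IHw yw _ v vw) // => k kw; apply: Dy.
by rewrite inE kw orbT.
Qed.

Lemma derw_map D (phi : letter -> letter) w :
  {in w, forall l, D (phi l) = ext (fun l' => bas K (phi l' : letter) : L1) (D l)} ->
  derw D (map phi w) = ext (fun v => W (map phi v)) (derw D w).
Proof.
elim: w => [|l w IHw] Dphi /=; first by rewrite linear0.
rewrite Dphi ?mem_head // IHw; last by move=> k kw; apply: Dphi; rewrite inE kw orbT.
rewrite linearD /= !linear_ext /=; congr (_ + _); apply: eq_ext => k.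
  by rewrite !extU.
by rewrite !extU.
Qed.

Lemma derw_rcons D w y : derw D (rcons w y) =
  ext (fun v => W (rcons v y)) (derw D w) + ext (fun l => W (rcons w l)) (D y).
Proof.
elim: w => [|l w IHw] /=; first by rewrite !linear0 addr0 add0r.
rewrite IHw !linearD /= !linear_ext -!addrA; congr (_ + (_ + _)).
- by apply: eq_ext => k; rewrite extU.
- by apply: eq_ext => v; rewrite !extU.
- by apply: eq_ext => k; rewrite extU.
Qed.

Definition ins (i : nat) (a : letter) (w : word) := take i w ++ a :: drop i w.
Definition del (i : nat) (w : word) : word := take i w ++ drop i.+1 w.

Lemma derw_ins D i a w : D a = 0 ->
  derw D (ins i a w) = ext (fun v => W (ins i a v)) (derw D w).
Proof.
move=> Da; elim: w i => [|l w IHw] i.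
  by case: i => [|i]; rewrite /ins /= Da !linear0 addr0.
case: i => [|i]; rewrite /ins /=.
  by rewrite Da linear0 add0r; apply: eq_ext => v; rewrite take0 drop0.
rewrite -[take i w ++ _]/(ins i a w) IHw linearD /= !linear_ext.
by congr (_ + _); apply: eq_ext => v; rewrite !extU.
Qed.

(* The letter map [b |-> a, bar a |-> -+ bar b]. *)
Definition Xd (a b : letter) (l : letter) : L1 :=
  (if l == b then bas K (a : letter) else 0) -
  (eps a * eps b) *: (if l == bar a then bas K (bar b : letter) else 0).

Definition subst (b a l : letter) := if l == b then a else l.

Lemma Xd_other a b l : l != b -> l != bar a -> Xd a b l = 0.
Proof. by move=> /negPf lb /negPf la; rewrite /Xd lb la scaler0 subr0. Qed.

Lemma Xd_src a b : b != bar a -> Xd a b b = bas K (a : letter).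
Proof. by move=> /negPf ba; rewrite /Xd eqxx ba scaler0 subr0. Qed.

Lemma derw_Xd0 a b w : b \notin w -> bar a \notin w -> derw (Xd a b) w = 0.
Proof.
elim: w => //= l w IHw; rewrite !inE !negb_or => /andP[bl bw] /andP[al aw].
by rewrite Xd_other 1?eq_sym // IHw // !linear0 addr0.
Qed.

Lemma derw_Xd1 a b w : b != bar a -> count_mem b w = 1%N -> bar a \notin w ->
  derw (Xd a b) w = W (map (subst b a) w).
Proof.
move=> ba; elim: w => //= l w IHw; rewrite inE negb_or /subst => cb /andP[al aw].
have [lb|lb] := eqVneq l b; last first.
  rewrite Xd_other 1?[l == bar a]eq_sym // linear0 add0r IHw ?extU //.
  by move: cb; rewrite (negPf lb).
have bw : b \notin w.
  by rewrite -has_pred1 has_count -leqNgt; move: cb; rewrite lb eqxx add1n => -[->].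
rewrite lb Xd_src // extU derw_Xd0 // linear0 addr0.
congr (W (a :: _)); rewrite -[LHS]map_id; apply/eq_in_map => k kw.
by rewrite ifN //; apply: contraNneq bw => <-.
Qed.

(** Each occurrence of [b] gives one term with [b] turned into the new letter [a]; turning [a] back
    restores [w] once per occurrence. *)
Lemma derw_Xd_count a b w : b != bar a -> a \notin w -> bar a \notin w ->
  ext (fun v => W (map (subst a b) v)) (derw (Xd a b) w) =
  (count_mem b w)%:R *: W w.
Proof.
move=> ba; elim: w => [|l w IHw]; first by rewrite /= linear0 scale0r.
rewrite !inE !negb_or => /andP[la aw] /andP[lba baw] /=.
have substw : map (subst a b) w = w.
  rewrite -[RHS]map_id; apply/eq_in_map => k kw; rewrite /subst ifN //.
  by apply: contraNneq aw => <-.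
have substl : subst a b l = l by rewrite /subst ifN // eq_sym.
rewrite linearD /= natrD scalerDl; congr (_ + _).
  have [lb|lb] := eqVneq l b; last by rewrite Xd_other 1?[l == bar a]eq_sym // !linear0 scale0r.
  by rewrite lb Xd_src // !extU /= substw /subst eqxx scale1r.
have := congr1 (ext (fun v => W (l :: v))) (IHw aw baw).
rewrite linearZ /= extU => <-; rewrite !linear_ext; apply: eq_ext => v.
by rewrite !extU /= substl.
Qed.

Lemma supp_Xd a b l : supp (fun l' => l' = a \/ l = bar a /\ l' = bar b) (Xd a b l).
Proof.
rewrite /Xd; apply: suppD.
  by case: (l == b); [apply: suppU; left | apply: supp0].
apply/suppN/suppZ; case la: (l == bar a); last exact: supp0.
by apply: suppU; right; rewrite (eqP la).
Qed.

Lemma derw_Xd_mem a b w :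
  supp (fun v => (a \in v) || (bar b \in v)) (derw (Xd a b) w).
Proof.
elim: w => [|l w IHw] /=; first exact: supp0.
apply: suppD; [apply: supp_ext => l' /supp_Xd l'E | apply: supp_ext => v /IHw vE]; apply: suppU.
  by case: l'E => [->|[_ ->]]; rewrite !inE eqxx ?orbT.
by rewrite !inE; case/orP: vE => ->; rewrite !orbT.
Qed.

Lemma derw_Xd_once a b w : a \notin w -> bar a \notin w ->
  supp (fun v => count_mem a v = 1%N /\ (bar a = a \/ bar a \notin v))
    (derw (Xd a b) w).
Proof.
elim: w => [|l w IHw] /=; first by move=> _ _; exact: supp0.
rewrite !inE !negb_or => /andP[al aw] /andP[bal baw].
have aw0 : count_mem a w = 0%N by apply/count_memPn.
apply: suppD; [apply: supp_ext => l' /supp_Xd l'E | apply: supp_ext => v /(IHw aw baw) [vE va]]; apply: suppU => /=.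
  case: l'E => [->|[lE _]]; last by rewrite lE eqxx in bal.
  rewrite eqxx aw0; split=> //; have [|ba] := eqVneq (bar a) a; [by left|right].
  by rewrite inE negb_or ba.
split; first by rewrite vE eq_sym (negPf al).
by case: va => [|va]; [left | right; rewrite inE negb_or bal].
Qed.

(** With a fresh [y] this projection isolates the terms that do not see the auxiliary letter. *)
Definition free (y : letter) : {linear U -> U} :=
  ext (fun w => if (y \in w) || (bar y \in w) then 0 else W w).

Lemma freeU y w : free y (W w) = if (y \in w) || (bar y \in w) then 0 else W w.
Proof. exact: extU. Qed.

Lemma supp_free y Q u : supp Q u ->
  supp (fun w => Q w /\ y \notin w /\ bar y \notin w) (free y u).
Proof.
move=> Qu; apply: supp_ext => w /Qu Qw.
by case: ifPn => [_|]; [exact: supp0 | rewrite negb_or => /andP[]; move=> *; apply: suppU].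
Qed.

Lemma free_id y u : supp (fun w => y \notin w) u ->
  supp (fun w => bar y \notin w) u -> free y u = u.
Proof.
move=> u1 u2; apply: ext_id_in => w wu.
by rewrite (negPf (u1 w wu)) (negPf (u2 w wu)).
Qed.

Lemma free_eq0 y u : supp (fun w => (y \in w) || (bar y \in w)) u -> free y u = 0.
Proof.
move=> yu; rewrite /free -[RHS](@ext_cst0 K _ U u).
by apply: eq_ext_in => w /yu ->.
Qed.

(** Only the term in which the derivation hits the single [y] loses that letter. *)
Lemma free_derw_Xd x y w : x != y -> x != bar y -> y != bar x ->
  count_mem y w = 1%N -> bar y = y \/ bar y \notin w ->
  free y (derw (Xd x y) w) = W (map (subst y x) w).
Proof.
move=> xy xby ybx; elim: w => //= l w IHw cy byw.
have [lb|lb] := eqVneq l y.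
  have yw : y \notin w.
    by rewrite -has_pred1 has_count -leqNgt; move: cy; rewrite lb eqxx add1n => -[->].
  have byw' : bar y \notin w.
    by case: byw => [->//|]; rewrite inE negb_or => /andP[].
  rewrite lb linearD /= Xd_src // extU freeU !inE ![_ == x]eq_sym.
  rewrite (negPf xy) (negPf xby) (negPf yw) (negPf byw') /=.
  rewrite free_eq0 ?addr0; last first.
    by apply: supp_ext => v _; apply: suppU; rewrite mem_head.
  rewrite /subst eqxx; congr (W (_ :: _)); rewrite -[LHS]map_id.
  by apply/eq_in_map => k kw; rewrite ifN //; apply: contraNneq yw => <-.
have cyw : count_mem y w = 1%N by move: cy; rewrite (negPf lb).
have yw : y \in w by rewrite -has_pred1 has_count cyw.
rewrite linearD /= [X in X + _]free_eq0 ?add0r; last first.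
  by apply: supp_ext => k _; apply: suppU; rewrite inE yw orbT.
have byl : bar y != l by case: byw => [->|]; [rewrite eq_sym | rewrite inE negb_or => /andP[]].
have /(_ cyw) {}IHw := IHw.
have freel v : free y (W (l :: v)) = ext (fun v => W (l :: v)) (free y (W v)).
  rewrite !freeU !inE eq_sym (negPf lb) (negPf byl) /=.
  by case: ifP; rewrite ?linear0 ?extU.
rewrite linear_ext (eq_ext _ freel) -linear_ext -linear_ext ext_id IHw; last first.
  by case: byw => [|]; [left | rewrite inE negb_or => /andP[_]; right].
by rewrite extU /subst (negPf lb).
Qed.

(** Without [y] in the word only the second half of [Xd] acts, turning one [bar x] at a time into
    [bar y]. *)
Lemma derw_Xd_expand x y w : y \notin w ->
  derw (Xd x y) w = - (eps x * eps y) *: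
    \sum_(0 <= i < size w) if nth (2%N, 0%N) w i == bar x
      then W (ins i (bar y) (del i w)) else 0.
Proof.
elim: w => [|l w IHw]; first by rewrite big_geq // scaler0.
rewrite inE negb_or => /andP[yl yw] /=; rewrite IHw // big_nat_recl //.
rewrite scalerDr /Xd eq_sym (negPf yl) sub0r -scaleNr !linearZ /=.
congr (_ *: _ + _ *: _).
  by case: ifP => _; rewrite ?linear0 // extU /ins /del /= take0 !drop0.
rewrite linear_sum; apply: eq_bigr => i _ /=.
by case: ifP => _; rewrite ?linear0 ?extU.
Qed.

Lemma bar_eq l l' : okt l.1 -> okt l'.1 -> (l == bar l') = (l' == bar l).
Proof. by move=> ol ol'; apply/eqP/eqP => ->; rewrite barK. Qed.

Lemma bar_lt N l : ((bar l).2 < N.*2)%N = (l.2 < N.*2)%N.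
Proof.
rewrite /bar /flip; case: X => //=; case: (boolP (odd l.2)) => ol; lia.
Qed.

(** The bound on the indices is even so that [flip], hence [bar], respects it. *)
Definition bd N w := all (fun l => (l.2 < N.*2)%N) w.

Lemma bdW N N' w : (N <= N')%N -> bd N w -> bd N' w.
Proof. by move=> NN'; apply: sub_all => l /=; lia. Qed.

Definition bound w := (\max_(l <- w) l.2).+1.
Lemma bound_bd w : bd (bound w) w.
Proof.
apply/allP => l lw; rewrite /bound.
have lm : (l.2 <= \max_(l <- w) l.2)%N by apply: leq_bigmax_seq.
by apply: leq_ltn_trans lm _; rewrite -addnn addSn ltnS leq_addr.
Qed.

Lemma bd_notin N w l : bd N w -> (N.*2 <= l.2)%N -> l \notin w /\ bar l \notin w.
Proof.
move=> /allP bw Nl; split; apply/negP => /bw; first by rewrite ltnNge Nl.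
by rewrite bar_lt ltnNge Nl.
Qed.

Lemma supp_bd u : exists N, supp (bd N) u.
Proof.
exists (\max_(v <- fsup u) bound v); split=> v vu.
by apply: bdW (bound_bd v); apply: leq_bigmax_seq.
Qed.

(** * The first fundamental theorem, by adding one letter at a time *)

Section FundamentalTheorem.
Hypothesis char0 : forall n, n.+1%:R != 0 :> K.
Variable LD : set (letter -> L1).
Hypothesis LD2 : forall D l, LD D -> l.1 = 2%N -> D l = 0.
Hypothesis LDty : forall D l, LD D -> supp (fun l' => l'.1 = l.1) (D l).
Hypothesis LDfin : forall D, LD D -> exists n, forall l,
  ((n <= l.2)%N -> D l = 0) /\ supp (fun l' => (l'.2 < n)%N) (D l).
Hypothesis LDX : forall a b, okt a.1 -> b.1 = a.1 -> a != b -> a != bar b ->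
  exists2 D, LD D & forall l, okl l -> D l = Xd a b l.

Definition equivariant_on (P : seq nat) (f : word -> U) := forall D, LD D ->
  forall w, ty w = P -> ext f (derw D w) = ext (derw D) (f w).

Lemma okw_ty w : all okt (ty w) -> all okl w.
Proof. by rewrite all_map; apply: sub_all => l /= ol; rewrite /okl ol. Qed.

Lemma equivariant_Xd P f a b w : equivariant_on P f -> ty w = P -> all okt P ->
  supp (all okl) (f w) -> okt a.1 -> b.1 = a.1 -> a != b -> a != bar b ->
  ext f (derw (Xd a b) w) = ext (derw (Xd a b)) (f w).
Proof.
move=> eqf wP okP okf oa ba ab abb; have [D LDD DE] := LDX oa ba ab abb.
rewrite -(eq_derw (D := D)); last first.
  by move=> l lw; apply: DE; apply: (allP (okw_ty _) l lw); rewrite wP.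
rewrite (eqf D LDD w wP); apply: eq_ext_in => v vf; apply: eq_derw => l lv.
by apply: DE; apply: (allP (okf v vf)).
Qed.

(** For a fresh y the derivation [Xd y x] kills [w], hence also [f w]. Replacing y by x again
    multiplies each output word by its number of letters x, which must be zero in characteristic
    zero. *)
Lemma equivariant_letters P f x w : equivariant_on P f -> ty w = P -> all okt P ->
  supp (all okl) (f w) -> okt x.1 -> x \notin w -> supp (fun v => x \notin v) (f w).
Proof.
move=> eqf wP okP okf ox xw; have [N fN] := supp_bd (f w).
pose M := maxn N (maxn (bound w) (bound [:: x])).
pose y : letter := (x.1, M.*2).
have Mx : (x.2 < M.*2)%N.
  have /bdW/(_ (bound_bd [:: x])) : (bound [:: x] <= M)%N by rewrite /M; lia.
  by rewrite /bd /= andbT.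
have yx : y != x by apply/eqP => yx; rewrite -yx /= ltnn in Mx.
have ybx : y != bar x.
  by apply/eqP => yx'; move: Mx; rewrite -bar_lt -yx' /= ltnn.
have My : (M.*2 <= y.2)%N by [].
have yf v : v \in fsup (f w) -> y \notin v /\ bar y \notin v.
  by move=> /(suppP fN) bv; apply: bd_notin My; apply: bdW bv; rewrite /M; lia.
have [yw byw] : y \notin w /\ bar y \notin w.
  by apply: bd_notin My; apply: bdW (bound_bd w); rewrite /M; lia.
have := equivariant_Xd eqf wP okP okf (a := y) (b := x) ox erefl yx ybx.
rewrite derw_Xd0 // linear0.
move=> /esym /(congr1 (ext (fun v => W (map (subst y x) v)))).
rewrite linear0 linear_ext.
rewrite (eq_ext_in (h' := fun v => (count_mem x v)%:R *: W v)); last first.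
  move=> v /yf[yv byv]; apply: derw_Xd_count => //.
  by rewrite -bar_eq.
move=> f0; split=> v vf; have := congr1 (fun u : U => coef u v) f0.
rewrite coef_ext_scale coef0 => /eqP; rewrite mulf_eq0 => /orP[|]; last first.
  by move: vf; rewrite mem_fsup => /negPf ->.
by case cv: (count_mem x v) => [|q]; [move/count_memPn: cv | rewrite (negPf (char0 q))].
Qed.

Definition fz (k : nat) : letter := (2%N, k).
Definition frozen (l : letter) := l.1 == 2%N.
(** Frozen letters mark inputs that have been set apart and must reappear in the output, once for
    each entry of [z]. *)
Definition okz (z : seq nat) w :=
  all okl w && perm_eq (filter frozen w) (map fz z).

Lemma derw_all (Q : pred letter) D w : all Q w ->
  {in w, forall l, supp Q (D l)} -> supp (all Q) (derw D w).
Proof.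
elim: w => [|l w IHw] /=; first by move=> _ _; exact: supp0.
move=> /andP[Ql Qw] QD; apply: suppD; apply: supp_ext => v vw; apply: suppU => /=.
  by rewrite (QD l _ v vw) ?mem_head.
by rewrite Ql (IHw Qw _ v vw) // => k kw; apply: QD; rewrite inE kw orbT.
Qed.

Lemma derw_ins0 D i a w : {in w, forall l, D l = 0} ->
  derw D (ins i a w) = ext (fun a' => W (ins i a' w)) (D a).
Proof.
have derw0 w' : {in w', forall l, D l = 0} -> derw D w' = 0.
  elim: w' => //= l w' IHw' D0; rewrite D0 ?mem_head // IHw' ?linear0 ?addr0 //.
  by move=> k kw; apply: D0; rewrite inE kw orbT.
elim: w i => [|l w IHw] i Dw.
  by case: i => [|i]; rewrite /ins /= linear0 addr0.
have Dl : D l = 0 by rewrite Dw ?mem_head.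
have {}Dw : {in w, forall l, D l = 0} by move=> k kw; apply: Dw; rewrite inE kw orbT.
case: i => [|i]; rewrite /ins /= Dl linear0 add0r.
  by rewrite derw0 // !linear0 addr0.
rewrite -[take i w ++ _]/(ins i a w) IHw //.
by rewrite linear_ext; apply: eq_ext => a'; rewrite extU.
Qed.

Lemma map_subst_id b a w : b \notin w -> map (subst b a) w = w.
Proof.
move=> bw; rewrite -[RHS]map_id; apply/eq_in_map => l lw.
by rewrite /subst ifN //; apply: contraNneq bw => <-.
Qed.

Lemma map_subst_subst b b' a w : b' \notin w ->
  map (subst b' a) (map (subst b b') w) = map (subst b a) w.
Proof.
move=> bw; rewrite -map_comp; apply/eq_in_map => l lw /=; rewrite /subst.
have [_|lb] := eqVneq l b; first by rewrite eqxx.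
by rewrite ifN //; apply: contraNneq bw => <-.
Qed.

Lemma filter_frozen_subst y k v : y.1 != 2%N -> count_mem y v = 1%N ->
  perm_eq (filter frozen (map (subst y (fz k)) v)) (fz k :: filter frozen v).
Proof.
move=> y2; elim: v => //= l v IHv cv; rewrite {1 2}/subst.
have [lb|lb] := eqVneq l y.
  have yv : y \notin v by rewrite -has_pred1 has_count -leqNgt; move: cv; rewrite lb eqxx add1n => -[->].
  by rewrite map_subst_id // lb /frozen /= (negPf y2).
have {}IHv := IHv (_ : count_mem y v = 1%N).
case: ifP => _; last by apply: IHv; move: cv; rewrite (negPf lb).
rewrite perm_sym -[_ :: _ :: _]/([:: fz k] ++ [:: l] ++ filter frozen v).
rewrite perm_catCA /= perm_cons perm_sym; apply: IHv.
by move: cv; rewrite (negPf lb).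
Qed.

Section Step.
Variables (P : seq nat) (tau : nat) (f : word -> U) (z : seq nat) (k : nat).
Hypotheses (okP : all okt P) (oktau : okt tau) (kz : k \notin z).
Hypothesis eqf : equivariant_on (rcons P tau) f.
Hypothesis supf : forall w, ty w = rcons P tau -> supp (okz z) (f w).
Let y N : letter := (tau, N.*2).
Let fy N w := f (rcons w (y N)).

Lemma ok_rcons : all okt (rcons P tau). Proof. by rewrite all_rcons oktau. Qed.

Lemma y_neq N N' : N != N' -> y N != y N'.
Proof. by move=> NN'; apply: contra NN' => /eqP [] /double_inj ->. Qed.

Lemma y_neq_bar N N' : N != N' -> y N != bar (y N').
Proof.
move=> NN'; apply: contra NN' => /eqP yE.
have := bar_lt N (y N'); have := bar_lt N.+1 (y N'); rewrite -yE /=.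
by rewrite ltnn => b1 b2; apply/eqP; lia.
Qed.

Lemma ty_rcons w x : ty w = P -> x.1 = tau -> ty (rcons w x) = rcons P tau.
Proof. by move=> <- <-; rewrite /ty map_rcons. Qed.

Lemma supf_ok w : ty w = rcons P tau -> supp (all okl) (f w).
Proof. by move=> /supf; apply: sub_supp => v /andP[]. Qed.

Lemma y_notin N w : bd N w -> y N \notin w /\ bar (y N) \notin w.
Proof. by move=> bw; apply: bd_notin bw _. Qed.

Lemma f_notin w x : ty w = rcons P tau -> okt x.1 -> x \notin w ->
  supp (fun v => x \notin v) (f w).
Proof.
move=> wP ox xw; by apply: (equivariant_letters eqf wP ok_rcons (supf_ok wP) ox xw).
Qed.

Lemma ok_bar l : okt l.1 -> okt (bar l).1.
Proof. by rewrite bar1; apply: okt_tb. Qed.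

Lemma fyX N N' w : ty w = P -> bd N w -> bd N' w -> N != N' ->
  fy N w = ext (derw (Xd (y N) (y N'))) (fy N' w) /\
  supp (fun v => y N \notin v /\ bar (y N) \notin v) (fy N' w).
Proof.
move=> wP bN bN' NN'; have wP' := ty_rcons wP (erefl (y N').1).
have [yN byN] := y_notin bN; have [yN' byN'] := y_notin bN'.
have yy := y_neq NN'; have yby := y_neq_bar NN'.
have yw : y N \notin rcons w (y N') by rewrite mem_rcons inE negb_or yy.
have byw : bar (y N) \notin rcons w (y N').
  rewrite mem_rcons inE negb_or byN andbT eq_sym.
  by apply: y_neq_bar; rewrite eq_sym.
split; last first.
  split=> v vf; split.
    exact: (suppP (@f_notin _ (y N) wP' oktau yw) vf).
  exact: (suppP (@f_notin _ (bar (y N)) wP' (@ok_bar (y N) oktau) byw) vf).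
rewrite -(equivariant_Xd eqf wP' ok_rcons (supf_ok wP')) //.
rewrite derw_Xd1 //; first by rewrite extU map_rcons map_subst_id // /subst eqxx.
  by apply: y_neq_bar; rewrite eq_sym.
by rewrite -cats1 count_cat /= eqxx (count_memPn yN').
Qed.

(** By [fyX] this output arises from one that avoids [y N] and its dual by a single application of
    the derivation that creates [y N]. *)
Lemma fy_once N w : ty w = P -> bd N w ->
  supp (fun v => count_mem (y N) v = 1%N /\
     (bar (y N) = y N \/ bar (y N) \notin v)) (fy N w).
Proof.
move=> wP bN; have bN' : bd N.+1 w by apply: bdW bN; lia.
have NN : N != N.+1 by rewrite neq_ltn ltnSn.
have [-> yf] := fyX wP bN bN' NN.
by apply: supp_ext => v /(suppP yf)[]; apply: derw_Xd_once.
Qed.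

(** The part of [f] in which the last input is carried to the output: a fresh letter is fed in and
    its single trace in the output is frozen. *)
Definition gbound w := ext (fun v => W (map (subst (y (bound w)) (fz k)) v)) (fy (bound w) w).

Lemma gbound_indep N w : ty w = P -> bd N w ->
  ext (fun v => W (map (subst (y N) (fz k)) v)) (fy N w) = gbound w.
Proof.
move=> wP bN; have bN' := bound_bd w; rewrite /gbound; set N' := bound w in bN' *.
have [->//|NN'] := eqVneq N N'.
have [-> yf] := fyX wP bN bN' NN'; rewrite linear_ext; apply: eq_ext_in => v vf.
have [yv byv] := suppP yf vf; have [cv _] := suppP (fy_once wP bN') vf.
rewrite derw_Xd1 // ?extU ?map_subst_subst //.
by apply: y_neq_bar; rewrite eq_sym.
Qed.

Lemma gbound_equivariant : equivariant_on P gbound.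
Proof.
move=> D LDD w wP; have [n nD] := LDfin LDD.
pose N := maxn (bound w) n.
have bN : bd N w by apply: bdW (bound_bd w); rewrite /N; lia.
have nN : (n <= N.*2)%N by rewrite /N; lia.
have Dy : D (y N) = 0 by case: (nD (y N)) => -> //.
rewrite -(gbound_indep wP bN).
pose phi v := W (map (subst (y N) (fz k)) v).
transitivity (ext phi (ext (fun v => fy N v) (derw D w))).
  rewrite linear_ext; apply: eq_ext_in => v vw; rewrite -(gbound_indep (N := N)) //.
    by rewrite -wP; refine (suppP (derw_ty _) vw) => l _; apply: LDty.
  refine (suppP (derw_all (Q := fun l => (l.2 < N.*2)%N) bN _) vw) => l _.
  by case: (nD l) => _; apply: sub_supp => l' /leq_trans; apply.
have eqfw := eqf LDD (ty_rcons wP (erefl (y N).1)).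
have -> : ext (fun v => fy N v) (derw D w) = ext (derw D) (fy N w).
  rewrite -eqfw derw_rcons Dy linear0 addr0 linear_ext.
  by apply: eq_ext => v; rewrite extU.
rewrite !linear_ext; apply: eq_ext => v; rewrite extU derw_map // => l lv.
rewrite {1}/subst; case: eqP => [->|_]; first by rewrite Dy linear0 LD2.
rewrite ext_id_in // => l' l'D; rewrite /subst ifN //.
have [_ /suppP/(_ l' l'D) l'n] := nD l; apply: contraTneq l'n => -> /=.
by rewrite -leqNgt.
Qed.

Lemma gbound_supp w : ty w = P -> supp (okz (k :: z)) (gbound w).
Proof.
move=> wP; apply: supp_ext => v vf; apply: suppU.
have [cv _] := suppP (fy_once wP (bound_bd w)) vf.
have /andP[okv pv] := suppP (supf (ty_rcons wP (erefl (y (bound w)).1))) vf.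
apply/andP; split.
  rewrite all_map; apply/allP => l lv /=; rewrite /subst.
  by case: eqP => // _; [rewrite /okl orbT | apply: (allP okv)].
apply: perm_trans (filter_frozen_subst _ _ cv) _; last by rewrite /= perm_cons.
by move=> /=; apply: contraTneq oktau => ->; rewrite okt2.
Qed.

Section Contraction.
Variable i : nat.
Hypotheses (iP : (i < size P)%N) (iPtau : nth 2%N P i = tb tau).

Let w2 N N' w := rcons (ins i (bar (y N)) w) (y N').

Lemma ty_ins w a : ty w = take i P ++ drop i.+1 P -> a.1 = tb tau ->
  ty (ins i a w) = P.
Proof.
move=> wP a1; have szw : size w = (size P).-1.
  by rewrite -(size_map fst) -/(ty w) wP size_cat size_take size_drop iP; lia.
rewrite /ty /ins map_cat /= map_take map_drop -/(ty w) wP a1 -iPtau.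
have si : size (take i P) = i by rewrite size_take iP.
rewrite take_size_cat // drop_size_cat // -drop_nth //.
exact: cat_take_drop.
Qed.

Lemma ty_w2 N N' w : ty w = take i P ++ drop i.+1 P ->
  ty (w2 N N' w) = rcons P tau.
Proof. by move=> wP; apply: ty_rcons => //; apply: ty_ins => //; rewrite bar1. Qed.

Lemma mem_ins a b w : (a \in ins i b w) = (a == b) || (a \in w).
Proof. by rewrite /ins mem_cat inE orbCA -mem_cat cat_take_drop. Qed.

Lemma mem_w2 N N' a w : (a \in w2 N N' w) =
  [|| a == y N', a == bar (y N) | a \in w].
Proof. by rewrite mem_rcons inE mem_ins. Qed.

Lemma barK_y N : bar (bar (y N)) = y N. Proof. exact: barK. Qed.

Lemma bar_inj_y N N' : (bar (y N) == bar (y N')) = (y N == y N').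
Proof. by apply/eqP/eqP => [/(congr1 bar)|->//]; rewrite !barK_y. Qed.

Lemma w2_notin N N' w : ty w = take i P ++ drop i.+1 P -> bd N w -> N != N' ->
  supp (fun v => y N \notin v) (f (w2 N' N' w)) /\
  supp (fun v => bar (y N) \notin v) (f (w2 N' N' w)).
Proof.
move=> wP bN NN'; have [yw byw] := y_notin bN; have wP2 := ty_w2 N' N' wP.
split; first apply: f_notin => //.
  by rewrite mem_w2 !negb_or yw y_neq // y_neq_bar.
apply: f_notin => //; first exact: ok_bar.
rewrite mem_w2 !negb_or byw bar_inj_y y_neq // andbT.
by rewrite eq_sym y_neq_bar // eq_sym.
Qed.

Lemma eps_y N : eps (y N) = 1.
Proof. by rewrite /eps /= odd_double; case: X. Qed.

Lemma derw_w2 N N' w : bd N w -> bd N' w -> N != N' ->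
  derw (Xd (y N') (y N)) (w2 N' N w) = W (w2 N' N' w) - W (w2 N N w).
Proof.
move=> bN bN' NN'; have [yN byN] := y_notin bN; have [yN' byN'] := y_notin bN'.
have yby : y N != bar (y N') by apply: y_neq_bar.
rewrite /w2 derw_rcons Xd_src // extU addrC derw_ins0; last first.
  move=> l lw; apply: Xd_other; first by apply: contraNneq yN => <-.
  by apply: contraNneq byN' => <-.
congr (_ + _); rewrite /Xd eqxx eq_sym (negPf yby) sub0r !eps_y mulr1 scale1r.
by rewrite !linearN /= !extU.
Qed.

(** The part of [f] in which the last input is contracted with the i-th one: a fresh dual pair is
    fed in and the terms where it has disappeared are kept. *)
Definition contr w := free (y (bound w)) (f (w2 (bound w) (bound w) w)).

(** By [derw_w2] the inputs for two fresh letters differ by a derivative of a third word. Every term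
    of the corresponding derivative of the output contains [y N'] or [bar (y N)], so the two [free]
    projections remove it. *)
Lemma contr_indep N w : ty w = take i P ++ drop i.+1 P -> bd N w ->
  free (y N) (f (w2 N N w)) = contr w.
Proof.
move=> wP bN; have bN' := bound_bd w; rewrite /contr; set N' := bound w in bN' *.
have [->//|NN'] := eqVneq N N'; have N'N : N' != N by rewrite eq_sym.
have eqX := equivariant_Xd eqf (ty_w2 N' N wP) ok_rcons (supf_ok (ty_w2 N' N wP))
  (a := y N') (b := y N) oktau erefl (y_neq N'N) (y_neq_bar N'N).
move: eqX; rewrite derw_w2 // linearB /= !extU.
move=> /(congr1 (fun u => free (y N) (free (y N') u))); rewrite !linearB /=.
have [s1 s2] := w2_notin wP bN NN'; have [s3 s4] := w2_notin wP bN' N'N.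
rewrite (free_id s3 s4) [free (y N) (free (y N') (f (w2 N' N' w)))]free_id.
- have -> : free (y N) (free (y N') (ext (derw (Xd (y N') (y N))) (f (w2 N' N w)))) = 0.
    rewrite !linear_ext -[RHS](@ext_cst0 K _ U (f (w2 N' N w))); apply: eq_ext => v.
    rewrite -[derw _ _]ext_id !linear_ext.
    rewrite -[RHS](@ext_cst0 K _ U (derw (Xd (y N') (y N)) v)).
    apply: eq_ext_in => v' /(suppP (derw_Xd_mem _ _ _)).
    rewrite extU => /orP[->|byv]; first by rewrite linear0.
    by case: (_ || _); rewrite ?linear0 // freeU byv orbT.
  by move/eqP; rewrite subr_eq0 => /eqP <-.
- by apply: sub_supp (supp_free _ s1) => v [].
- by apply: sub_supp (supp_free _ s2) => v [].
Qed.

Lemma contr_equivariant : equivariant_on (take i P ++ drop i.+1 P) contr.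
Proof.
move=> D LDD w wP; have [n nD] := LDfin LDD.
pose N := maxn (bound w) n.
have bN : bd N w by apply: bdW (bound_bd w); rewrite /N; lia.
have nN : (n <= N.*2)%N by rewrite /N; lia.
have Dy : D (y N) = 0 by case: (nD (y N)) => -> //.
have nb : (n <= (bar (y N)).2)%N.
  by apply: leq_trans nN _; rewrite leqNgt bar_lt ltnn.
have Dby : D (bar (y N)) = 0 by case: (nD (bar (y N))) => -> //.
rewrite -(contr_indep wP bN).
transitivity (free (y N) (ext (fun v => f (w2 N N v)) (derw D w))).
  rewrite linear_ext; apply: eq_ext_in => v vw; rewrite -(contr_indep (N := N)) //.
    by rewrite -wP; refine (suppP (derw_ty _) vw) => l _; apply: LDty.
  refine (suppP (derw_all (Q := fun l => (l.2 < N.*2)%N) bN _) vw) => l _.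
  by case: (nD l) => _; apply: sub_supp => l' /leq_trans; apply.
have -> : ext (fun v => f (w2 N N v)) (derw D w) = ext (derw D) (f (w2 N N w)).
  rewrite -(eqf LDD (ty_w2 N N wP)) /w2 derw_rcons Dy linear0 addr0 derw_ins //.
  by rewrite !linear_ext; apply: eq_ext => v; rewrite !extU.
rewrite !linear_ext; apply: eq_ext => v.
have neqD l (l' : letter) : l' \in fsup (D l) -> forall a : letter, (n <= a.2)%N -> l' != a.
  by have [_ lD] := nD l => /(suppP lD) l'n a na; apply: contraTneq l'n => ->; rewrite -leqNgt.
have [yv|yv] := boolP (y N \in v).
  rewrite linear0; apply: free_eq0; apply: sub_supp (derw_mem Dy yv) => v' ->.
  by [].
have [byv|byv] := boolP (bar (y N) \in v).
  rewrite linear0; apply: free_eq0; apply: sub_supp (derw_mem Dby byv) => v' ->.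
  by rewrite orbT.
rewrite extU; apply: free_id; apply: derw_notin => // l _; split=> l' /neqD; exact.
Qed.

Lemma contr_supp w : ty w = take i P ++ drop i.+1 P -> supp (okz z) (contr w).
Proof.
move=> wP; apply: sub_supp (supp_free _ (supf (ty_w2 _ _ wP))).
by move=> v [].
Qed.

End Contraction.

(** Apply [Xd x y], with y fresh, to the word w followed by y. On the input side this gives w
    followed by x and the words with some [bar x] of w turned into [bar y]; on the output side,
    among the terms free of y, only those remain where the single y became x. *)
Lemma equivariant_expand w x : ty w = P -> x.1 = tau -> f (rcons w x) =
  ext (fun v => W (map (subst (fz k) x) v)) (gbound w) +
  \sum_(0 <= i < size w) if nth (2%N, 0%N) w i == bar x
    then eps x *: contr i (del i w) else 0.
Proof.
move=> wP x1; pose N := bound (rcons w x).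
have := bound_bd (rcons w x); rewrite -/N /bd all_rcons => /andP[xN bN].
have [yw byw] := y_notin bN; have wxP := ty_rcons wP x1.
have okx : okt x.1 by rewrite x1.
have xy : x != y N by apply: contraTneq xN => -> /=; rewrite ltnn.
have xby : x != bar (y N).
  by apply: contraTneq xN => ->; rewrite bar_lt ltnn.
have wyP := ty_rcons wP (erefl (y N).1).
have eqX := equivariant_Xd eqf wyP ok_rcons (supf_ok wyP)
  (a := x) (b := y N) okx (esym x1) xy xby.
have ybx : y N != bar x by rewrite bar_eq.
move: eqX; rewrite derw_rcons Xd_src // extU derw_Xd_expand // eps_y mulr1.
rewrite !linearD /= extU => /(congr1 (free (y N))); rewrite linearD /=.
have [nyx nbyx] : y N \notin rcons w x /\ bar (y N) \notin rcons w x.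
  by rewrite !mem_rcons !inE !negb_or yw byw andbT eq_sym xy eq_sym xby.
rewrite [X in _ + X](@free_id (y N) (f (rcons w x))); last 2 first.
- exact: f_notin.
- by apply: f_notin => //; apply: ok_bar.
have -> : free (y N) (ext (derw (Xd x (y N))) (fy N w)) =
    ext (fun v => W (map (subst (fz k) x) v)) (gbound w).
  rewrite -(gbound_indep wP bN) !linear_ext; apply: eq_ext_in => v vf.
  have [cv bv] := suppP (fy_once wP bN) vf.
  rewrite free_derw_Xd // extU map_subst_subst //.
  have /andP[_ /perm_mem pv] := suppP (supf wyP) vf.
  apply: contra kz => kv; have := pv (fz k); rewrite mem_filter kv /= => /esym.
  by rewrite mem_map // => ? ? [].
move=> eqX; rewrite -eqX addrAC -[LHS]add0r; congr (_ + _).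
rewrite !linearZ /= !linear_sum /= -big_split /= big1_seq // => i /andP[_].
rewrite mem_index_iota => /andP[_ iw].
case wi: (nth _ w i == bar x); last by rewrite !linear0 ?scaler0 addr0.
have szw : size w = size P by rewrite -wP size_map.
have iPtau : nth 2%N P i = tb tau.
  by rewrite -wP (nth_map (2%N, 0%N)) // (eqP wi) bar1 x1.
rewrite !extU (contr_indep (i := i) _ iPtau).
- by rewrite scaleNr addNr.
- by rewrite -szw.
- by rewrite /ty /del map_cat map_take map_drop -/(ty w) wP.
- by apply/allP => l; rewrite mem_cat => /orP[/mem_take|/mem_drop] /(allP bN).
Qed.

End Step.

Definition form (u v : letter) : K :=
  if (u.1 == 0%N) && (v == bar u) then eps u else 0.

Fixpoint ciw (i : nat) (w : word) : U :=
  if i is i'.+1 then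
    if w is l :: l' :: w' then form l l' *: ciw i' w' else 0
  else W w.

Local Notation d0 := (2%N, 0%N).
Definition act (p : seq nat) (w : word) : word := [seq nth d0 w (j : nat) | j <- p].
Definition edges (i : nat) : seq nat := flatten (nseq i [:: 0%N; tb 0]).

(* [(i, p)] stands for the diagram that permutes the tensor factors by [p]   *)
(* and then contracts the first [i] edges.                                   *)
Definition good (P : seq nat) (s : nat) (ip : nat * seq nat) :=
  perm_eq ip.2 (iota 0 (size P + s)) &&
  ([seq nth 2%N P j | j <- take ip.1.*2 ip.2] == edges ip.1).

(** Frozen letters are treated as further inputs, placed after [w]. *)
Definition diag (z : seq nat) (J : seq (K * (nat * seq nat))) (w : word) : U :=
  \sum_(j <- J) j.1 *: ciw j.2.1 (act j.2.2 (w ++ map fz z)).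

Lemma size_edges i : size (edges i) = i.*2.
Proof. by rewrite /edges; elim: i => //= i ->. Qed.

Lemma edges_neq2 i : 2%N \notin edges i.
Proof.
rewrite /edges; elim: i => //= i IHi; rewrite !in_cons !negb_or IHi andbT.
by rewrite /tb; case: X.
Qed.

Lemma ciw_map (phi : letter -> letter) i w :
  {in take i.*2 w, forall l, phi l = l} ->
  ext (fun v => W (map phi v)) (ciw i w) = ciw i (map phi w).
Proof.
elim: i w => [|i IHi] w phiw /=; first by rewrite extU.
case: w phiw => [|l [|l' w]] phiw; rewrite ?linear0 //=.
rewrite linearZ /= IHi; last by move=> k kw; apply: phiw; rewrite /= !inE kw !orbT.
by rewrite !phiw //= !inE eqxx ?orbT.
Qed.

Lemma act_map (phi : letter -> letter) (p : seq nat) w :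
  all (fun a : nat => a < size w)%N p ->
  map phi (act p w) = act p (map phi w).
Proof.
move=> pw; rewrite /act -map_comp; apply/eq_in_map => a ap /=.
by rewrite (nth_map d0) //; apply: (allP pw).
Qed.

Lemma act_cat p q w : act (p ++ q) w = act p w ++ act q w.
Proof. exact: map_cat. Qed.

(** Renumbers positions when the two positions [i] and [n] are put back into a word from which they
    were deleted. *)
Definition bump2 (i n a : nat) : nat :=
  if (a < i)%N then a else if (a.+1 < n)%N then a.+1 else a.+2.

Lemma nth_bump2 (T : Type) (x0 x : T) i (w z : seq T) (a : nat) :
  (i < size w)%N -> nth x0 (rcons w x ++ z) (bump2 i (size w) a) =
  nth x0 (take i w ++ drop i.+1 w ++ z) a.
Proof.
move=> iw; rewrite -cats1 -catA /bump2 !nth_cat size_take iw size_drop.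
have [ai|ai] := ltnP a i; first by rewrite (leq_trans ai (ltnW iw)) nth_take.
have [aw|aw] := ltnP a.+1 (size w).
  rewrite aw ifT ?nth_drop; last by lia.
  by congr (nth _ _ _); lia.
rewrite ifF; last by lia.
rewrite ifF /=; last by lia.
rewrite ifF; last by lia.
by congr (nth _ _ _); lia.
Qed.

Lemma act_bump2 i w x z p : (i < size w)%N ->
  act (map (bump2 i (size w)) p) (rcons w x ++ z) = act p (del i w ++ z).
Proof.
move=> iw; rewrite /act -map_comp; apply: eq_map => a /=.
by rewrite nth_bump2 // /del catA.
Qed.

(** [form] wants a letter of type 0 first, so the order of the two ends of the new edge depends on
    the type of the last letter. *)
Definition ends (tau i n : nat) := if tau == 1%N then [:: i; n] else [:: n; i].

Lemma perm_bump2 tau i n s p : (i < n)%N -> perm_eq p (iota 0 (n.-1 + s)) ->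
  perm_eq (ends tau i n ++ map (bump2 i n) p) (iota 0 (n.+1 + s)).
Proof.
move=> ni pp; have up : uniq p by rewrite (perm_uniq pp) iota_uniq.
have szp : size p = (n.-1 + s)%N by rewrite (perm_size pp) size_iota.
have memp (a : nat) : (a \in p) = (a < n.-1 + s)%N.
  by rewrite (perm_mem pp) mem_iota.
have inj : injective (bump2 i n).
  move=> a b; rewrite /bump2.
  case: (ltnP a i); case: (ltnP a.+1 n); case: (ltnP b i); case: (ltnP b.+1 n); lia.
have avoid (a : nat) : (bump2 i n a != i) && (bump2 i n a != n).
  by rewrite /bump2; case: (ltnP a i); case: (ltnP a.+1 n); lia.
have u : uniq (ends tau i n ++ map (bump2 i n) p).
  rewrite cat_uniq (map_inj_uniq inj) up andbT /ends.
  have -> : has [in if tau == 1%N then [:: i; n] else [:: n; i]] (map (bump2 i n) p) = false.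
    apply/hasP => -[_ /mapP[a _ ->]]; have /andP[/negPf ai /negPf an] := avoid a.
    by case: (tau == _); rewrite !inE ai an.
  by case: (tau == _); rewrite /= inE andbT neq_ltn ni ?orbT.
have [||_ eqi] := @uniq_min_size _ _ (iota 0 (n.+1 + s)) u.
- move=> a; rewrite mem_cat mem_iota /= => /orP[|/mapP[b]].
    by rewrite /ends; case: (tau == _); rewrite !inE => /orP[]/eqP ->; lia.
  by rewrite memp => bp ->; rewrite /bump2; case: (ltnP b i); case: (ltnP b.+1 n); lia.
- by rewrite size_iota size_cat size_map szp /ends; case: (tau == _) => /=; lia.
by apply: uniq_perm => //; apply: iota_uniq.
Qed.

Lemma form_pair tau i w x : okt tau -> x.1 = tau -> (i < size w)%N ->
  (nth d0 w i).1 = tb tau -> forall z p j,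
  ciw j.+1 (act (ends tau i (size w) ++ p) (rcons w x ++ z)) =
  (if nth d0 w i == bar x then eps x else 0) *: ciw j (act p (rcons w x ++ z)).
Proof.
move=> ot x1 iw wi z p j.
have n1 : nth d0 (rcons w x ++ z) i = nth d0 w i.
  by rewrite nth_cat size_rcons ltnS (ltnW iw) nth_rcons iw.
have n2 : nth d0 (rcons w x ++ z) (size w) = x.
  by rewrite nth_cat size_rcons ltnSn nth_rcons ltnn eqxx.
have barx : (nth d0 w i == bar x) = (x == bar (nth d0 w i)).
  by rewrite bar_eq // ?x1 // wi okt_tb.
rewrite /ends; move: ot; rewrite /okt => /orP[/eqP t0|/andP[slX /eqP t1]].
  by rewrite t0 /= n1 n2 /form x1 t0 eqxx.
rewrite t1 /= n1 n2 /form wi t1 /tb slX eqxx barx.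
by case: (x == _) => //; congr (_ *: _); rewrite /eps; case: X slX.
Qed.

Lemma good_lt P s ip : all okt P -> good P s ip ->
  {in take ip.1.*2 ip.2, forall j : nat, (j < size P)%N}.
Proof.
move=> okP /andP[_ /eqP tP] j jp.
have := map_f (fun j : nat => nth 2%N P j) jp; rewrite tP => jE.
by rewrite ltnNge; apply: contraL jE => Pj; rewrite nth_default // edges_neq2.
Qed.

Lemma act_lt P s ip w : good P s ip -> size w = (size P + s)%N ->
  all (fun j : nat => j < size w)%N ip.2.
Proof.
move=> /andP[/perm_mem pP _] ->; apply/allP => j.
by rewrite pP mem_iota.
Qed.

Lemma diag_subst P (z : seq nat) k J w x : all okt P -> ty w = P -> k \notin z ->
  all (fun j => good P (size z).+1 j.2) J ->
  ext (fun v => W (map (subst (fz k) x) v)) (diag (k :: z) J w) =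
  diag z J (rcons w x).
Proof.
move=> okP wP kz gJ; rewrite /diag linear_sum /= !big_seq; apply: eq_bigr => j jJ.
have gj := allP gJ _ jJ; rewrite linearZ /= ciw_map ?act_map.
- congr (_ *: ciw _ (act _ _)); rewrite map_cat /= cat_rcons map_subst_id.
    rewrite {1}/subst eqxx; congr (_ ++ _ :: _); apply: map_subst_id.
    by apply: contra kz => /mapP[k' kz' [->]].
  apply/negP => /(map_f fst); rewrite -/(ty w) wP => /(allP okP).
  by rewrite okt2.
- by apply: act_lt gj _; rewrite size_cat /= size_map -wP size_map.
move=> l; rewrite /act -map_take => /mapP[m mj ->].
have mP := good_lt okP gj mj; have szw : size w = size P by rewrite -wP size_map.
rewrite /subst ifN // nth_cat szw mP; apply/eqP => wm.
have := allP okP (nth 2%N P m); rewrite mem_nth // => /(_ isT).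
by rewrite -wP /ty (nth_map d0) ?szw // wm okt2.
Qed.

Lemma good_rcons P s tau ip : all okt P -> good P s.+1 ip -> good (rcons P tau) s ip.
Proof.
move=> okP gp; have lt := good_lt okP gp; case/andP: gp => pp /eqP tp.
apply/andP; split; first by rewrite size_rcons addSnnS.
by rewrite -tp; apply/eqP/eq_in_map => j /lt jP; rewrite nth_rcons jP.
Qed.

Lemma good_pair P s tau i ip : okt tau -> (i < size P)%N -> nth 2%N P i = tb tau ->
  good (take i P ++ drop i.+1 P) s ip ->
  good (rcons P tau) s (ip.1.+1, ends tau i (size P) ++ map (bump2 i (size P)) ip.2).
Proof.
move=> ot iP Pi /andP[pp /eqP tp]; apply/andP; split => /=.
  rewrite size_rcons; apply: perm_bump2 => //.
  apply: perm_trans pp _; rewrite size_cat size_take iP size_drop.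
  by rewrite (_ : (i + _)%N = (size P).-1) //; lia.
have -> : take ip.1.+1.*2 (ends tau i (size P) ++ map (bump2 i (size P)) ip.2) =
    ends tau i (size P) ++ map (bump2 i (size P)) (take ip.1.*2 ip.2).
  by rewrite /ends map_take; case: (tau == _).
rewrite map_cat -map_comp [X in _ ++ X](eq_map (g := fun j => nth 2%N (take i P ++ drop i.+1 P) j)).
  rewrite tp; apply/eqP; transitivity ([:: 0%N; tb 0] ++ edges ip.1) => //.
  congr cat; rewrite /ends; case/orP: ot => [/eqP t0|/andP[slX /eqP t1]].
    by rewrite t0 /= !nth_rcons iP ltnn eqxx Pi t0.
  by rewrite t1 /= !nth_rcons iP ltnn eqxx Pi t1 /tb slX.
move=> j /=; have := nth_bump2 2%N tau [::] j iP; by rewrite !cats0.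
Qed.

(** Induction on the number of inputs through [equivariant_expand]: [gbound] has one input fewer and
    one frozen letter more, each [contr] has two inputs fewer. *)
Theorem fft P : all okt P -> forall f z, equivariant_on P f ->
  (forall w, ty w = P -> supp (okz z) (f w)) ->
  exists2 J, all (fun j => good P (size z) j.2) J &
    forall w, ty w = P -> f w = diag z J w.
Proof.
have [n] := ubnP (size P); elim: n P => // n IHn P; rewrite ltnS => Pn okP f z eqf supf.
case/lastP: P => [|P tau] in Pn okP eqf supf *.
  have [Is IsP] : {Is : word -> seq nat & forall v, v \in fsup (f [::]) ->
      perm_eq (Is v) (iota 0 (size z)) /\ v = act (Is v) (map fz z)}.
    apply: (choice (P := fun v Is => v \in fsup (f [::]) ->
      perm_eq Is (iota 0 (size z)) /\ v = act Is (map fz z))) => v.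
    case vf: (v \in fsup (f [::])); last by exists [::].
    have okf : supp (all okl) (f [::]).
      by have := supf [::] erefl; apply: sub_supp => w /andP[].
    have /andP[okv] := suppP (supf [::] erefl) vf.
    have -> : filter frozen v = v.
      apply/all_filterP/allP => l lv; have /orP[ol|//] := allP okv l lv.
      have := suppP (equivariant_letters (w := [::]) eqf erefl okP okf ol isT) vf.
      by rewrite lv.
    move=> /(perm_iotaP d0)[I]; rewrite size_map => pI vI.
    by exists I.
  exists [seq (coef (f [::]) v, (0%N, Is v)) | v <- fsup (f [::])].
    apply/allP => _ /mapP[v vf ->]; rewrite /good /= take0 /= eqxx andbT.
    by case: (IsP v vf).
  case=> // _; rewrite /diag big_map -{1}[f [::]]ext_id extE !big_seq.
  by apply: eq_bigr => v vf /=; rewrite {2}(IsP v vf).2.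
move: okP; rewrite all_rcons => /andP[ot okP].
have {}Pn : (size P < n)%N by rewrite size_rcons in Pn.
(* A label not yet used by a frozen letter. *)
pose k := (\max_(a <- z) a).+1.
have kz : k \notin z.
  apply/negP => kz; have : (k <= \max_(a <- z) a)%N by apply: leq_bigmax_seq.
  by rewrite ltnn.
have [J0 gJ0 J0E] := IHn P Pn okP _ _ (gbound_equivariant okP ot kz eqf supf)
  (gbound_supp okP ot kz eqf supf).
have [JJ JJP] : {JJ : nat -> seq (K * (nat * seq nat)) & forall i : nat,
    (i < size P)%N -> nth 2%N P i = tb tau ->
    all (fun j => good (take i P ++ drop i.+1 P) (size z) j.2) (JJ i) /\ forall w, ty w = take i P ++ drop i.+1 P -> contr tau f i w = diag z (JJ i) w}.
  apply: (choice (P := fun (i : nat) JJ => (i < size P)%N -> nth 2%N P i = tb tau ->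
    all (fun j => good (take i P ++ drop i.+1 P) (size z) j.2) JJ /\ forall w, ty w = take i P ++ drop i.+1 P -> contr tau f i w = diag z JJ w)) => i.
  case iP: (i < size P)%N; last by exists [::].
  case: (nth 2%N P i =P tb tau) => Pi; last by exists [::].
  have [||J gJ JE] := IHn (take i P ++ drop i.+1 P) _ _ _ _
    (contr_equivariant okP ot kz eqf supf iP Pi) (contr_supp okP ot kz supf iP Pi).
  - by apply: leq_ltn_trans Pn; rewrite size_cat size_take size_drop iP; lia.
  - apply/allP => a; rewrite mem_cat => /orP[/mem_take|/mem_drop];
      exact: (allP okP).
  by exists J.
(* A diagram for the i-th contraction becomes one for [f] by adding in front the edge from position
   [i] to the last position. *)
pose up i (j : K * (nat * seq nat)) :=
  (j.1, (j.2.1.+1, ends tau i (size P) ++ map (bump2 i (size P)) j.2.2)).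
pose idx := [seq i <- iota 0 (size P) | nth 2%N P i == tb tau].
exists (J0 ++ flatten [seq map (up i) (JJ i) | i <- idx]).
  rewrite all_cat; apply/andP; split.
    by apply: sub_all gJ0 => j; apply: good_rcons.
  apply/allP => j /flattenP[s /mapP[i ii ->] /mapP[j' jJ ->]].
  move: ii; rewrite mem_filter mem_iota add0n => /andP[/eqP Pi /andP[_ iP]].
  by apply: good_pair => //; have [/allP/(_ _ jJ)] := JJP i iP Pi.
move=> w wP; case/lastP: w => [|w x] in wP *; first by case: (P) wP.
move: wP; rewrite /ty map_rcons => /rcons_inj[wP x1].
have szw : size w = size P by rewrite -wP size_map.
rewrite (equivariant_expand okP ot kz eqf supf wP x1) J0E //.
rewrite (diag_subst _ okP wP kz gJ0) [RHS]/diag big_cat; congr (_ + _).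
rewrite big_flatten big_map big_filter /= szw.
rewrite [RHS]big_mkcond /index_iota subn0 !big_seq; apply: eq_bigr => i /=.
rewrite mem_iota /= add0n => iP; have iw : (i < size w)%N by rewrite szw.
case: (nth 2%N P i =P tb tau) => Pi; last first.
  rewrite ifN //; apply: contra_notN Pi => /eqP wi.
  by rewrite -wP (nth_map d0) // wi bar1 x1.
have [_ JE] := JJP i iP Pi; rewrite big_map.
transitivity ((if nth d0 w i == bar x then eps x else 0) *: contr tau f i (del i w)).
  by case: (nth d0 w i == bar x); rewrite ?scale0r.
rewrite JE; last by rewrite /ty /del map_cat map_take map_drop wP.
rewrite /diag scaler_sumr; apply: eq_bigr => j _.
change (ciw (up i j).2.1) with (ciw j.2.1.+1).
change (up i j).2.2 with (ends tau i (size P) ++ map (bump2 i (size P)) j.2.2).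
change (up i j).1 with j.1.
rewrite -szw form_pair //; last by rewrite -Pi -wP (nth_map d0).
by rewrite act_bump2 // !scalerA mulrC.
Qed.

End FundamentalTheorem.
End Words.

(** * The three Lie algebras as maps on letters, and invariance of diagrams *)

Section LetterMaps.
Variables (K : fieldType) (X : lie_kind).
Local Notation L1 := (fm K letter).
Local Notation U := (fm K word).
Local Notation W w := (bas K (w : word)).
Local Notation d0 := (2%N, 0%N).
Implicit Types (l m : letter) (w v : word) (ij : nat * nat).

Definition elt ij l : L1 :=
  if l.1 == 0%N then (l.2 == ij.2)%:R *: bas K ((0%N, ij.1) : letter)
  else if l.1 == 1%N then - (l.2 == ij.1)%:R *: bas K ((1%N, ij.2) : letter)
  else 0.

Definition letter_map (A : gl_inf K) l : L1 := lext (fun ij => elt ij l) A.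

Definition lie_maps : set (letter -> L1) :=
  [set D | exists2 A, lie_inf X A & D = letter_map A].

Lemma lextU (I : choiceType) (V : lmodType K) (h : I -> V) k :
  lext h << k >> = h k.
Proof. by rewrite /lext msuppU oner_eq0 big_seq_fset1 mcoeffUU scale1r. Qed.

Lemma letter_map2 A l : l.1 = 2%N -> letter_map A l = 0.
Proof.
by move=> l2; rewrite /letter_map /lext big1 // => ij _; rewrite /elt l2 /= scaler0.
Qed.

Lemma letter_map_ty A l : supp (fun l' => l'.1 = l.1) (letter_map A l).
Proof.
apply: supp_sum => ij _; apply: suppZ; rewrite /elt.
case: eqP => [->|_]; first by apply: suppZ; apply: suppU.
by case: eqP => [->|_]; [apply: suppZ; apply: suppU | apply: supp0].
Qed.

Lemma letter_map_fin A : exists n, forall l, ((n <= l.2)%N -> letter_map A l = 0) /\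
  supp (fun l' => (l'.2 < n)%N) (letter_map A l).
Proof.
pose n := (\max_(ij <- msupp A) (ij.1 + ij.2)).+1; exists n.
have nA ij : ij \in msupp A -> ((ij.1 < n) && (ij.2 < n))%N.
  move=> ijA; have : (ij.1 + ij.2 <= \max_(ij <- msupp A) (ij.1 + ij.2))%N.
    by apply: (leq_bigmax_seq (F := fun ij => (ij.1 + ij.2)%N)).
  by rewrite /n; lia.
move=> l; split=> [nl|]; rewrite /letter_map /lext big_seq.
  apply: big1 => ij /nA /andP[i1 i2]; rewrite /elt.
  rewrite (gtn_eqF (leq_trans i1 nl)) (gtn_eqF (leq_trans i2 nl)).
  by rewrite /= mulr0n oppr0 !scale0r; case: ifP => _; rewrite ?scaler0 //; case: ifP => _; rewrite scaler0.
apply: supp_sum => ij /nA /andP[i1 i2]; apply: suppZ; rewrite /elt.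
case: ifP => _; first by apply: suppZ; apply: suppU.
by case: ifP => _; [apply: suppZ; apply: suppU | apply: supp0].
Qed.

Fact corner_linear n : linear (@corner K n).
Proof.
move=> a B C; rewrite /corner scaler_sumr -big_split; apply: eq_bigr => i _ /=.
rewrite scaler_sumr -big_split; apply: eq_bigr => j _ /=.
by rewrite !mxE scalerDl scalerA.
Qed.
HB.instance Definition _ n := GRing.isLinear.Build K 'M[K]_n (gl_inf K) *:%R
  (@corner K n) (@corner_linear n).

Lemma corner_coef n (B : 'M[K]_n) (i j : 'I_n) : (corner B)@_(val i, val j) = B i j.
Proof.
rewrite /corner !raddf_sum (bigD1 i) //= raddf_sum (bigD1 j) //=.
rewrite mcoeffZ mcoeffUU mulr1 !big1 ?addr0 // => [i' ii|j' jj].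
  rewrite raddf_sum big1 // => j' _ /=; rewrite mcoeffZ mcoeffU xpair_eqE.
  by rewrite (inj_eq val_inj) (negPf ii) mulr0.
by rewrite mcoeffZ mcoeffU xpair_eqE !(inj_eq val_inj) (negPf jj) andbF mulr0.
Qed.

Lemma corner_coef0 n (B : 'M[K]_n) i j : ~~ ((i < n) && (j < n))%N ->
  (corner B)@_(i, j) = 0.
Proof.
move=> ijn; rewrite /corner !raddf_sum big1 // => i' _; rewrite raddf_sum big1 // => j' _ /=.
rewrite mcoeffZ mcoeffU xpair_eqE; case: eqP => /= [ii|_]; last by rewrite mulr0.
case: eqP => [jj|_]; last by rewrite mulr0.
by move: ijn; rewrite -ii -jj !ltn_ord.
Qed.

Lemma corner_delta n (i j : 'I_n) : corner (delta_mx i j) = << (val i, val j) >> :> gl_inf K.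
Proof.
rewrite /corner (bigD1 i) //= (bigD1 j) //= mxE !eqxx scale1r.
rewrite !big1 ?addr0 // => [i' ii|j' jj].
  by rewrite big1 // => j' _; rewrite mxE (negPf ii) scale0r.
by rewrite mxE (negPf jj) andbF scale0r.
Qed.

Lemma flip_lt n k : (flip k < n.*2)%N = (k < n.*2)%N.
Proof. by rewrite /flip; case: (boolP (odd k)) => ol; lia. Qed.

Lemma odd_flip k : odd (flip k) = ~~ odd k.
Proof. by rewrite /flip; case: (boolP (odd k)) => //=; lia. Qed.

Definition sgn (k : nat) : K := (-1) ^+ odd k.

Lemma sgn_flip k : sgn (flip k) = - sgn k.
Proof. by rewrite /sgn odd_flip; case: (odd k); rewrite ?opprK. Qed.

Lemma sgn_sqr k : sgn k * sgn k = 1.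
Proof. by rewrite /sgn; case: (odd k); rewrite ?mulrNN mulr1. Qed.

Lemma symp_formE n (i j : 'I_n) : symp_form K n i j = sgn i *+ (val j == flip i).
Proof.
rewrite mxE /sgn /flip; case: (boolP (odd i)) => oi /=.
  have -> : (val i == j.+1) = (val j == i.-1) by apply/eqP/eqP; move: oi => /=; lia.
  by case: eqP.
by case: eqP.
Qed.

Lemma sp_finP n (B : 'M[K]_(n.*2)) : sp_fin B <->
  forall i j i' j' : 'I_(n.*2), val i' = flip i -> val j' = flip j ->
    sgn i * B i' j = sgn j * B j' i.
Proof.
have flE (i : 'I_n.*2) : (flip i < n.*2)%N by rewrite flip_lt.
have E (i j i' j' : 'I_n.*2) : val i' = flip i -> val j' = flip j ->
  (B^T *m symp_form K n.*2 + symp_form K n.*2 *m B) i j =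
  - (sgn j * B j' i) + sgn i * B i' j.
  move=> ii jj; rewrite !mxE (bigD1 j') //= (bigD1 i' (P := predT)) //=.
  rewrite !big1 ?addr0 => [|k|k].
  - rewrite mxE !symp_formE ii jj flipK !eqxx sgn_flip !mulr1n mulrN.
    by rewrite mulrC.
  - by move=> ki; rewrite symp_formE -ii -val_eqE in ki *; rewrite (negPf ki) mul0r.
  - move=> kj; rewrite mxE symp_formE (_ : (val j == flip k) = false) ?mulr0 //.
    apply: contraNF kj => /eqP jk; rewrite -val_eqE jj jk flipK.
    exact: eqxx.
split=> [spB i j i' j' ii jj|H].
  have /matrixP/(_ i j) := spB; rewrite (E _ _ _ _ ii jj) mxE addrC => /eqP.
  by rewrite subr_eq0 => /eqP.
apply/matrixP => i j; rewrite (E i j (Ordinal (flE i)) (Ordinal (flE j))) // mxE.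
by rewrite (H i j (Ordinal (flE i)) (Ordinal (flE j))) // addNr.
Qed.

Lemma lie_SL a i j : i != j -> lie_inf LieSL (a *: << (i, j) >> : gl_inf K).
Proof.
move=> ij; pose n := (i + j).+1.
have [iN jN] : (i < n)%N /\ (j < n)%N by rewrite /n; split; lia.
exists n, (a *: delta_mx (Ordinal iN) (Ordinal jN)); last first.
  by rewrite linearZ /= corner_delta.
rewrite /sl_fin /= linearZ /= /mxtrace big1 ?mulr0 // => k _; rewrite mxE.
by case: eqP => //= ->; rewrite -val_eqE /= (negPf ij).
Qed.

Lemma lie_O i j : lie_inf LieO (<< (i, j) >> - << (j, i) >> : gl_inf K).
Proof.
pose n := (i + j).+1.
have [iN jN] : (i < n)%N /\ (j < n)%N by rewrite /n; split; lia.
exists n, (delta_mx (Ordinal iN) (Ordinal jN) - delta_mx (Ordinal jN) (Ordinal iN)).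
  by rewrite /o_fin /= linearB /= !trmx_delta opprB.
by rewrite linearB /= !corner_delta.
Qed.

Lemma lie_SP i j :
  lie_inf LieSP (<< (i, j) >> - (sgn i * sgn j) *: << (flip j, flip i) >> : gl_inf K).
Proof.
pose n := (i + j).+1.
have [iN jN] : (i < n.*2)%N /\ (j < n.*2)%N by rewrite /n; split; lia.
have [fiN fjN] : (flip i < n.*2)%N /\ (flip j < n.*2)%N by rewrite !flip_lt.
exists n, (delta_mx (Ordinal iN) (Ordinal jN) -
  (sgn i * sgn j) *: delta_mx (Ordinal fjN) (Ordinal fiN)); last first.
  by rewrite [RHS]linearB /= corner_delta [in RHS]linearZ /= corner_delta.
apply/sp_finP => a b a' b' aa bb; rewrite !mxE -!val_eqE /= aa bb.
rewrite !(can_eq flipK).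
have fE k k' : (flip k == k') = (k == flip k') by rewrite -(can_eq flipK) flipK.
rewrite !fE; set si := sgn i; set sj := sgn j.
have h1 : sgn a * ((a == flip i :> nat) && (b == j :> nat))%:R =
    - (sgn b * (si * sj * ((b == j :> nat) && (a == flip i :> nat))%:R)).
  rewrite andbC; case: eqP => [-> /=|_]; last by rewrite !mulr0 oppr0.
  case: eqP => [->|_]; last by rewrite !mulr0 oppr0.
  by rewrite sgn_flip !mulr1 mulrCA sgn_sqr mulr1.
have h2 : sgn b * ((b == flip i :> nat) && (a == j :> nat))%:R =
    - (sgn a * (si * sj * ((a == j :> nat) && (b == flip i :> nat))%:R)).
  rewrite andbC; case: eqP => [-> /=|_]; last by rewrite !mulr0 oppr0.
  case: eqP => [->|_]; last by rewrite !mulr0 oppr0.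
  by rewrite sgn_flip !mulr1 mulrCA sgn_sqr mulr1.
by rewrite !mulrBr h1 h2 addrC.
Qed.

(** The maps [Xd] come from $E_{xy}$ or $-E_{yx}$ for sl, from $E_{xy} - E_{yx}$ for o, and from
    $E_{xy}$ minus its signed symplectic partner for sp. This supplies [LDX]. *)
Lemma lie_mapsP a b : okt X a.1 -> b.1 = a.1 -> a != b -> a != bar X b ->
  exists2 D, lie_maps D & forall l, okl X l -> D l = Xd K X a b l.
Proof.
case: a b => [ta x] [tb y] /= oa ->; rewrite xpair_eqE eqxx /= => xy.
rewrite /Xd /lie_maps /okl /bar /eps; move: oa; rewrite /okt; case: X => /=.
- case/orP => /eqP -> _ /=.
    exists (letter_map << (x, y) >>).
      by exists << (x, y) >> => //; rewrite -[<< _ >>]scale1r; apply: lie_SL.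
    move=> [t z] /=; rewrite /letter_map lextU /elt /= !xpair_eqE.
    by case: t => [|[|t]] //= _; [case: (z == y) | case: (z == x) |]; rewrite /= ?(mulr1, mulr1n, mulr0n, scale1r, scale0r, scaler0, addr0, add0r, subr0, sub0r, oppr0, opprK, scaleNr).
  exists (letter_map (- 1 *: << (y, x) >>)).
    by exists (- 1 *: << (y, x) >>) => //; apply: lie_SL; rewrite eq_sym.
  move=> [t z] /=; rewrite /letter_map linearZ /= lextU /elt /= !xpair_eqE.
  by case: t => [|[|t]] //= _; [case: (z == x) | case: (z == y) |]; rewrite /= ?(mulr1, mulr1n, mulr0n, scale1r, scale0r, scaler0, addr0, add0r, subr0, sub0r, oppr0, opprK, scaleNr).
- rewrite orbF => /eqP -> xby.
  exists (letter_map (<< (x, y) >> - << (y, x) >>)).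
    by exists (<< (x, y) >> - << (y, x) >>) => //; apply: lie_O.
  move=> [t z] /=; rewrite /letter_map linearB /= !lextU /elt /= !xpair_eqE.
  case: t => [|[|[|t]]] //= _; last by rewrite ?(mulr1, mulr1n, mulr0n, scale1r, scale0r, scaler0, addr0, add0r, subr0, sub0r, oppr0, opprK, scaleNr).
  by case: (z == y); case: (z == x); rewrite /= ?(mulr1, mulr1n, mulr0n, scale1r, scale0r, scaler0, addr0, add0r, subr0, sub0r, oppr0, opprK, scaleNr).
rewrite orbF => /eqP -> xby.
exists (letter_map (<< (x, y) >> - (sgn x * sgn y) *: << (flip y, flip x) >>)).
  by exists (<< (x, y) >> - (sgn x * sgn y) *: << (flip y, flip x) >>) => //; apply: lie_SP.
move=> [t z] /=; rewrite /letter_map linearB linearZ /= !lextU /elt /= !xpair_eqE.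
case: t => [|[|[|t]]] //= _.
by rewrite /sgn; case: (z == y); case: (z == flip x); rewrite /= ?(mulr1, mulr1n, mulr0n, scale1r, scale0r, scaler0, addr0, add0r, subr0, sub0r, oppr0, opprK, scaleNr).
Qed.

Lemma sum_mcoeff (A : gl_inf K) k : \sum_(ij <- msupp A) A@_ij * (ij == k)%:R = A@_k.
Proof.
have [kA|kA] := boolP (k \in msupp A).
  rewrite (bigD1_seq k) //= eqxx mulr1 big1 ?addr0 // => ij /negPf ->.
  by rewrite mulr0.
rewrite mcoeff_outdom // big1_seq // => ij /andP[_ ijA].
by case: eqP => [ijk|_]; [rewrite -ijk ijA in kA | rewrite mulr0].
Qed.

(** Invariance of the form under the Lie algebra, with the vector [u] standing for the rest of a
    word. *)
Lemma form_invariant A : lie_inf X A -> forall l l' (V : lmodType K) (u : V),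
  ext (fun m => form K X m l' *: u) (letter_map A l) +
  ext (fun m => form K X l m *: u) (letter_map A l') = 0.
Proof.
move=> LA [t x] [t' x'] V u; set l : letter := (t, x); set l' : letter := (t', x').
rewrite /letter_map /lext !linear_sum -big_split /=.
under eq_bigr => ij _ do rewrite !linearZ /= -scalerDr.
have extE (g : letter -> V) ij m : ext g (elt ij m) =
    if m.1 == 0%N then (m.2 == ij.2)%:R *: g (0%N, ij.1)
    else if m.1 == 1%N then - (m.2 == ij.1)%:R *: g (1%N, ij.2) else 0.
  by rewrite /elt; case: ifP => _; [|case: ifP => _]; rewrite ?linearZ ?linear0 /= ?extU.
(* The effect of the elementary matrix at [ij] on the value of the form. *)
pose S ij : K := if (l.1 == 0%N) && (l'.1 == tb X 0) then
  (l.2 == ij.2)%:R * form K X (0%N, ij.1) l' + (if X is LieSL then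
     - (l'.2 == ij.1)%:R * form K X l (1%N, ij.2) else
     (l'.2 == ij.2)%:R * form K X l (0%N, ij.1)) else 0.
transitivity (\sum_(ij <- msupp A) A@_ij *: (S ij *: u)).
  apply: eq_bigr => ij _; congr (_ *: _); rewrite !extE {}/S {}/l {}/l' /form /bar /tb /=; case: X => /=.
  - by case: t => [|[|t]]; case: t' => [|[|t']];
      rewrite /= ?xpair_eqE /= ?scale0r ?scaler0 ?addr0 ?add0r ?scale0r // scalerDl !scalerA.
  - by case: t => [|[|t]]; case: t' => [|[|t']];
      rewrite /= ?xpair_eqE /= ?scale0r ?scaler0 ?addr0 ?add0r ?scale0r // scalerDl !scalerA.
  by case: t => [|[|t]]; case: t' => [|[|t']];
      rewrite /= ?xpair_eqE /= ?scale0r ?scaler0 ?addr0 ?add0r ?scale0r // scalerDl !scalerA.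
under eq_bigr => ij _ do rewrite scalerA.
rewrite -scaler_suml (_ : \sum_(ij <- msupp A) _ = 0) ?scale0r //.
rewrite {}/S {}/l {}/l' /=.
case: (boolP (_ && _)) => [/andP[/eqP -> /eqP ->]|_]; last first.
  by rewrite big1 // => ij _; rewrite mulr0.
move: LA; rewrite /form /bar /tb /eps; case: X => /= LA.
- rewrite big1 // => ij _; rewrite !xpair_eqE /= (eq_sym ij.2).
  case: eqP => _; case: eqP => _;
    by rewrite ?mulr0 ?mulr1 ?mul0r ?oppr0 ?addr0 ?subrr ?mulr0.
- transitivity (A@_(x', x) + A@_(x, x')).
    rewrite -!sum_mcoeff -big_split; apply: eq_bigr => -[i j] _ /=.
    rewrite -mulrDr !xpair_eqE /= !(eq_sym i) !(eq_sym j).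
    congr (_ * (_ + _)); rewrite ?(andbC (x == i)); case: eqP => _; case: eqP => _;
      by rewrite ?mulr0 ?mulr1 ?mul0r.
  case: LA => n [B BT ->]; have [/andP[xn x'n]|xn] := boolP ((x < n) && (x' < n))%N.
    rewrite (corner_coef B (Ordinal x'n) (Ordinal xn)).
    rewrite (corner_coef B (Ordinal xn) (Ordinal x'n)).
    by have /matrixP/(_ (Ordinal xn) (Ordinal x'n)) := BT; rewrite !mxE => ->; rewrite addNr.
  by rewrite !corner_coef0 ?addr0 // andbC.
transitivity (sgn (flip x') * A@_(flip x', x) + sgn x * A@_(flip x, x')).
  rewrite -!sum_mcoeff !mulr_sumr -big_split; apply: eq_bigr => -[i j] _ /=.
  rewrite -/(sgn _) !xpair_eqE /= mulrDr -/(sgn _).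
  have -> : (x' == flip i) = (i == flip x') by rewrite -(can_eq flipK) flipK eq_sym.
  rewrite !(eq_sym _ j); congr (_ + _).
    case: (i =P flip x') => [->|_]; case: (j == x);
      by rewrite /= ?(mulr0, mul0r, mulr1, mul1r) // mulrC.
  case: (i =P flip x) => [->|_]; case: (j == x');
    by rewrite /= ?(mulr0, mul0r, mulr1, mul1r) // mulrC.
case: LA => n [B /sp_finP BT ->].
have [/andP[xn x'n]|xn] := boolP ((x < n.*2) && (x' < n.*2))%N.
  have [fx fx'] : (flip x < n.*2)%N /\ (flip x' < n.*2)%N by rewrite !flip_lt.
  rewrite (corner_coef B (Ordinal fx') (Ordinal xn)).
  rewrite (corner_coef B (Ordinal fx) (Ordinal x'n)) sgn_flip.
  have := BT (Ordinal xn) (Ordinal x'n) (Ordinal fx) (Ordinal fx') erefl erefl.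
  by move=> /= ->; rewrite mulNr addNr.
by rewrite !corner_coef0 ?mulr0 ?addr0 ?flip_lt // andbC.
Qed.

(** The first two summands of the derivation cancel by [form_invariant]. Together with
    [act_equivariant] this is the converse of [fft]: diagrams are equivariant. *)
Lemma ciw_invariant D i w : lie_maps D ->
  ext (ciw K X i) (derw D w) = ext (derw D) (ciw K X i w).
Proof.
move=> [A LA ->]; set D' := letter_map A.
elim: i w => [|i IHi] w; first by rewrite /= ext_id extU.
case: w => [|l [|l' w]]; first by rewrite /= !linear0.
  rewrite [ciw _ _ _ _]/= [derw _ _]/= !linear0 addr0 linear_ext.
  rewrite -[RHS](@ext_cst0 K _ U (D' l)); apply: eq_ext => m; exact: extU.
have -> : ext (ciw K X i.+1) (derw D' [:: l, l' & w]) =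
    ext (fun m => form K X m l' *: ciw K X i w) (D' l) +
    ext (fun m => form K X l m *: ciw K X i w) (D' l') +
    ext (fun v => form K X l l' *: ciw K X i v) (derw D' w).
  rewrite -[derw _ _]/(ext (fun m => W [:: m, l' & w]) (D' l) + ext (fun v => W (l :: v))
    (ext (fun m => W (m :: w)) (D' l') + ext (fun v => W (l' :: v)) (derw D' w))).
  rewrite linearD linear_ext linearD linearD [X in _ + (X + _)]linear_ext.
  rewrite [X in _ + (X + _)]linear_ext [X in _ + (_ + X)]linear_ext.
  rewrite [X in _ + (_ + X)]linear_ext -addrA.
  congr (_ + (_ + _)); apply: eq_ext => m; rewrite !extU; reflexivity.
rewrite form_invariant // add0r ext_scale IHi; exact/esym/linearZ.
Qed.

Definition updp (p : seq nat) (k : nat) m w :=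
  [seq if (j : nat) == k then m else nth d0 w j | j <- p].

Lemma derw_act D p w : uniq p -> derw D (act p w) =
  \sum_(k <- p) ext (fun m => W (updp p k m w)) (D (nth d0 w k)).
Proof.
elim: p => [|a p IHp] /=; first by rewrite big_nil.
move=> /andP[ap up]; rewrite big_cons eqxx {}IHp // linear_sum; congr (_ + _).
  apply: eq_ext => m; congr (W (_ :: _)); apply/eq_in_map => j jp.
  by case: eqP => // ja; rewrite -ja jp in ap.
rewrite !big_seq; apply: eq_bigr => k kp; rewrite linear_ext; apply: eq_ext => m.
rewrite extU; congr (W (_ :: _)).
by rewrite ifN //; apply: contraNneq ap => ->.
Qed.

Lemma act_iota w : act (iota 0 (size w)) w = w.
Proof. by rewrite /act map_nth_iota0 // take_size. Qed.

Lemma act_equivariant D p w : perm_eq p (iota 0 (size w)) ->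
  ext (fun v => W (act p v)) (derw D w) = derw D (act p w).
Proof.
move=> pw; have up : uniq p by rewrite (perm_uniq pw) iota_uniq.
rewrite derw_act // -{1}[w]act_iota derw_act ?iota_uniq // linear_sum.
rewrite (perm_big _ pw); apply: eq_bigr => k _; rewrite linear_ext; apply: eq_ext => m.
rewrite extU; congr (W _); apply/eq_in_map => j jp.
have jw : (j < size w)%N by move: jp; rewrite (perm_mem pw) mem_iota add0n => /andP[].
by rewrite (nth_map 0%N) ?size_iota // nth_iota.
Qed.

End LetterMaps.

(** * Canonical words for the basis of the tensor space *)

Section Weave.
Variables (K : fieldType) (X : lie_kind) (r : nat).
Local Notation L1 := (fm K letter).
Local Notation U := (fm K word).
Local Notation W w := (bas K (w : word)).
Implicit Types (w v : word) (P : seq nat) (a b : seq nat).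

(** Types alternate between V and its dual as long as possible and then continue with one type only.
    So the first two factors form an edge whenever any two factors do, and removing them leaves a
    canonical type. *)
Fixpoint canon P : bool :=
  if P is s :: P' then
    if P' is t :: P'' then
      if (s == 0%N) && (t == tb X 0) then canon P'' else okt X s && all (pred1 s) P'
    else okt X s
  else true.

Definition valid P := (size P <= r)%N && canon P.

Lemma canon_okt P : canon P -> all (okt X) P.
Proof.
have [n] := ubnP (size P); elim: n P => // n IHn [|s [|t P]] //= nP; first by rewrite andbT.
case: ifP => [/andP[/eqP -> /eqP ->] cP|_ /and3P[os /eqP ts aP]].
  by rewrite (okt_tb (X := X)) //= IHn //; lia.
by rewrite ts os /=; apply: sub_all aP => k /eqP ->.
Qed.

Lemma canon_nonSL P : ~~ is_SL X -> canon P -> all (pred1 0%N) P.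
Proof.
move=> /negbTE nX /canon_okt; apply: sub_all => t.
by rewrite /okt nX orbF.
Qed.

Lemma canon_nseq s n : okt X s -> canon (nseq n s).
Proof.
move=> os; have [m] := ubnP n; elim: m n => // m IHm [|[|n]] //= nm.
case: ifP => _; first by apply: IHm; lia.
by rewrite os eqxx /=; apply/all_pred1P; rewrite size_nseq.
Qed.

Fixpoint weave a b : word :=
  match a, b with
  | x :: a', y :: b' => (0%N, x) :: (1%N, y) :: weave a' b'
  | _, [::] => map (pair 0%N) a
  | [::], _ => map (pair 1%N) b
  end.

Lemma weave0r a : weave a [::] = map (pair 0%N) a.
Proof. by case: a. Qed.
Lemma weave0l b : weave [::] b = map (pair 1%N) b.
Proof. by case: b. Qed.

Definition part (t : nat) w : seq nat := [seq l.2 | l <- w & l.1 == t].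

Lemma part_weave a b : part 0 (weave a b) = a /\ part 1 (weave a b) = b.
Proof.
have part_eq t c : part t (map (pair t) c) = c.
  by elim: c => //= x c IHc; rewrite /part /= eqxx /= -/(part t _) IHc.
have part_neq t t' c : t' != t -> part t (map (pair t') c) = [::].
  by move=> /negbTE tt; elim: c => //= x c IHc; rewrite /part /= tt.
elim: a b => [|x a IHa] b; first by rewrite weave0l part_eq part_neq.
case: b => [|y b]; first by rewrite weave0r part_eq part_neq.
by have [a0 b1] := IHa b; rewrite /part /= -!/(part _ _) a0 b1.
Qed.

Lemma map_pair_part t w : all (pred1 t) (ty w) -> map (pair t) (part t w) = w.
Proof.
elim: w => //= -[s x] w IHw /= /andP[/eqP -> aw].
by rewrite /part /= eqxx /= -/(part t w) IHw.
Qed.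

Lemma part_neq t s w : s != t -> all (pred1 t) (ty w) -> part s w = [::].
Proof.
move=> st; elim: w => //= -[s' x] w IHw /= /andP[/eqP -> aw].
by rewrite /part /= eq_sym (negPf st) -/(part s w) IHw.
Qed.

Lemma weave_part w : canon (ty w) -> weave (part 0 w) (part 1 w) = w.
Proof.
have pure t v : okt X t -> all (pred1 t) (ty v) -> weave (part 0 v) (part 1 v) = v.
  rewrite /okt => /orP[/eqP ->|/andP[_ /eqP ->]] av.
    by rewrite (@part_neq 0 1) // weave0r map_pair_part.
  by rewrite (@part_neq 1 0) // weave0l map_pair_part.
have [slX|nX] := boolP (is_SL X); last by move=> /(canon_nonSL nX); apply: pure.
have [n] := ubnP (size w); elim: n w => // n IHn [|l [|l' w]] nw //=.
  by move=> ol; apply: (pure l.1) => //=; rewrite eqxx.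
case: ifP => [/andP[/eqP l0 /eqP l1] cw|_ /and3P[ol l'l aw]]; last first.
  by apply: (pure l.1); rewrite //= eqxx l'l.
move: l0 l1; rewrite /tb slX; case: l l' nw => [t x] [t' x'] /= nw -> ->.
by rewrite /part /= -!/(part _ _) IHn //; lia.
Qed.

(** A canonical type is the type of a woven word, which depends only on the two counts; hence one
    type can stand for one summand $T^{p,q}$. *)
Lemma canon_inj P P' : canon P -> canon P' -> count_mem 0%N P = count_mem 0%N P' ->
  count_mem 1%N P = count_mem 1%N P' -> P = P'.
Proof.
pose wP P : word := map (fun t => (t, 0%N)) P.
have tyw Q : ty (wP Q) = Q by rewrite /ty -map_comp map_id_in.
have partw t Q : part t (wP Q) = nseq (count_mem t Q) 0%N.
  by elim: Q => //= s Q IHQ; rewrite /part /=; case: (s == t) => /=; rewrite -/(part t _) IHQ.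
have E Q : canon Q ->
    Q = ty (weave (nseq (count_mem 0%N Q) 0%N) (nseq (count_mem 1%N Q) 0%N)).
  by move=> cQ; rewrite -!partw weave_part ?tyw.
by move=> cP cP' c0 c1; rewrite [LHS]E // [RHS]E // c0 c1.
Qed.

Lemma canon_weave a b : is_SL X || nilp b -> canon (ty (weave a b)).
Proof.
move=> sb; have mapE t c : ty (map (pair t) c) = nseq (size c) t.
  by rewrite /ty -map_comp; elim: c => //= x c ->.
elim: a b sb => [|x a IHa] [|y b] sb //.
- by rewrite weave0l mapE canon_nseq // /okt; rewrite orbF in sb; rewrite sb.
- by rewrite weave0r mapE canon_nseq.
by rewrite orbF in sb; rewrite /= /tb sb /= IHa ?sb.
Qed.

Lemma size_weave a b : size (weave a b) = (size a + size b)%N.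
Proof.
elim: a b => [|x a IHa] [|y b] //=; rewrite ?size_map ?addn0 // IHa; lia.
Qed.

Lemma count_weave a b : count_mem 0%N (ty (weave a b)) = size a /\
  count_mem 1%N (ty (weave a b)) = size b.
Proof.
have mapE t c : ty (map (pair t) c) = nseq (size c) t.
  by rewrite /ty -map_comp; elim: c => //= x c ->.
elim: a b => [|x a IHa] [|y b] //=; rewrite ?mapE ?count_nseq /= ?mul1n ?mul0n //.
by have [-> ->] := IHa b.
Qed.

Lemma derw_weave i j a b : derw (elt K (i, j)) (weave a b) =
  \sum_(0 <= k < size a) (nth 0%N a k == j)%:R *: W (weave (set_nth 0%N a k i) b) -
  \sum_(0 <= k < size b) (nth 0%N b k == i)%:R *: W (weave a (set_nth 0%N b k j)).
Proof.
have e0 x w (h : letter -> word) : ext (fun m => W (h m)) (elt K (i, j) (0%N, x)) =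
    (x == j)%:R *: W (h (0%N, i)) by rewrite /elt /= linearZ /= extU.
have e1 x w (h : letter -> word) : ext (fun m => W (h m)) (elt K (i, j) (1%N, x)) =
    - ((x == i)%:R *: W (h (1%N, j))) by rewrite /elt /= linearZ /= extU scaleNr.
elim: a b => [|x a IHa] b.
  rewrite big_geq // sub0r weave0l; elim: b => [|y b IHb]; first by rewrite big_geq ?oppr0.
  rewrite big_nat_recl //= IHb (e1 y [::] (fun m => m :: map (pair 1%N) b)).
  rewrite linearN linear_sum opprD /=; congr (_ - _); apply: eq_bigr => k _.
  by rewrite linearZ /= extU; case: (set_nth _ _ _ _).
case: b => [|y b].
  have := IHa [::]; rewrite !weave0r /= => ->.
  rewrite !(big_geq (m := 0%N) (n := 0%N)) // !subr0 big_nat_recl //=.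
  rewrite (e0 x [::] (fun m => m :: map (pair 0%N) a)) linear_sum.
  by congr (_ + _); apply: eq_bigr => k _; rewrite linearZ /= extU; case: (set_nth _ _ _ _).
rewrite /= IHa !big_nat_recl //= (e0 x [::] (fun m => [:: m, (1%N, y) & weave a b])).
rewrite (e1 y [::] (fun m => m :: weave a b)) !linearD /= !linearN /= linearZ /= extU.
rewrite ?opprD -!addrA; congr (_ + _); rewrite addrCA; congr (_ + (_ - _)).
  by rewrite !linear_sum; apply: eq_bigr => k _; rewrite !linearZ /= !extU.
by rewrite !linear_sum; apply: eq_bigr => k _; rewrite !linearZ /= !extU.
Qed.

Definition wd (x : tbasis X r) : word := let: existT e (a, b) := x in weave a b.

Lemma wd_inj : injective wd.
Proof.
move=> [e [a b]] [e' [a' b']] /= ab.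
have [aa bb] : (a : seq nat) = a' /\ (b : seq nat) = b'.
  have [h0 h1] := part_weave a b; have [h0' h1'] := part_weave a' b'.
  by split; [rewrite -[LHS]h0 ab h0' | rewrite -[LHS]h1 ab h1'].
have ee : e = e'.
  apply/val_inj; case: (val e) (val e') a b a' b' aa bb {ab} => [p q] [p' q'] a b a' b' aa bb.
  by congr pair; apply: val_inj => /=; rewrite -?(size_tuple a) -?(size_tuple b) ?aa ?bb size_tuple.
subst e'; by rewrite (val_inj aa) (val_inj bb).
Qed.

Lemma wd_valid x : valid (ty (wd x)).
Proof.
case: x => [[[p q] /= pq] [a b]] /=; move: (pq) => /= /andP[le qX].
rewrite /valid size_map size_weave !size_tuple le canon_weave //.
by move: qX => /orP[->//|/eqP q0]; rewrite /nilp size_tuple /= q0 orbT.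
Qed.

Lemma wd_surj w : valid (ty w) -> exists x, wd x = w.
Proof.
rewrite /valid => /andP[sw cw]; have wE := weave_part cw.
set a := part 0 w in wE; set b := part 1 w in wE.
have sz : (size a + size b <= r)%N by move: sw; rewrite -wE size_map size_weave.
have [pa pb] : (size a < r.+1)%N /\ (size b < r.+1)%N by split; lia.
have pq : (size a + size b <= r)%N && (is_SL X || (size b == 0%N)).
  rewrite sz; case: (boolP (is_SL X)) => //= nX; rewrite /b (@part_neq 0) //.
  exact: canon_nonSL.
pose e : expo X r := exist _ (Ordinal pa, Ordinal pb) pq.
by exists (existT _ e (in_tuple a, in_tuple b)).
Qed.
End Weave.

(** * Passing between the endomorphism ring and operators on words *)

Section Transport.
Variables (K : fieldType) (X : lie_kind) (r : nat).
Local Notation L1 := (fm K letter).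
Local Notation U := (fm K word).
Local Notation W w := (bas K (w : word)).
Local Notation T := (Tle K X r).
Local Notation A := (Ag K X r).
Local Notation valid := (valid X r).
Local Notation wd := (@wd X r).
Implicit Types (w v : word) (f g : A) (t : T) (u : U).

Lemma linear_lext (I : choiceType) (V V' : lmodType K) (L : {linear V -> V'})
  (h : I -> V) (x : {malg K[I]}) : L (lext h x) = lext (fun k => L (h k)) x.
Proof. by rewrite /lext linear_sum; apply: eq_bigr => k _; rewrite linearZ. Qed.

Lemma eq_lext (I : choiceType) (V : lmodType K) (h h' : I -> V) (x : {malg K[I]}) :
  h =1 h' -> lext h x = lext h' x.
Proof. by move=> hh; apply: eq_bigr => k _; rewrite hh. Qed.

Lemma derw_letter_map (B : gl_inf K) w :
  derw (letter_map B) w = lext (fun ij => derw (elt K ij) w) B.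
Proof.
elim: w => [|l w IHw] /=.
  by rewrite /lext big1 // => k _; rewrite scaler0.
rewrite IHw /letter_map !linear_lext /lext -big_split; apply: eq_bigr => k _ /=.
by rewrite -scalerDr.
Qed.

Definition tw (t : T) : U := lext (fun x => W (wd x)) t.
HB.instance Definition _ := GRing.Linear.copy tw (lext (fun x => W (wd x))).

Lemma twU x : tw << x >> = W (wd x).
Proof. exact: lextU. Qed.

Lemma coef_tw t x : coef (tw t) (wd x) = t@_x.
Proof.
have CE y : coef (t@_y *: W (wd y)) (wd x) = t@_y * (y == x)%:R.
  by rewrite coefZ coef_bas (inj_eq (@wd_inj X r)).
rewrite /tw /lext coef_sum (eq_bigr _ (fun y _ => CE y)).
have [xt|xt] := boolP (x \in msupp t).
  rewrite (bigD1_seq x xt (fset_uniq _)) eqxx mulr1 big1 => [|y /negPf ->].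
    exact: addr0.
  by rewrite mulr0.
rewrite (mcoeff_outdom xt); apply: big1_seq => y /andP[_ yt].
by case: eqP => [yx|_]; [move: xt; rewrite -yx yt | rewrite mulr0].
Qed.

Lemma tw_valid t : supp (fun v => valid (ty v)) (tw t).
Proof. by apply: supp_sum => x _; apply: suppZ; apply: suppU; apply: wd_valid. Qed.

Lemma tw_inj : injective tw.
Proof.
move=> t t' tt; apply/malgP => x; by rewrite -!coef_tw tt.
Qed.

Fact tbasis0_subproof : exists x : tbasis X r, wd x = [::].
Proof. by apply: wd_surj; rewrite /valid. Qed.

Definition basis0 : tbasis X r := projT1 (cid tbasis0_subproof).
Definition wt w : T :=
  if valid (ty w) then << xget basis0 [set x | wd x = w] >> else 0.

Lemma wt_wd x : wt (wd x) = << x >>.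
Proof.
rewrite /wt wd_valid; congr << _ >>; case: xgetP => [y _ /= /wd_inj //|/(_ x)].
by case.
Qed.

Lemma wt_tw t : ext wt (tw t) = t.
Proof.
apply: tw_inj; rewrite /tw linear_lext linear_lext; apply: eq_lext => x.
by rewrite extU wt_wd; apply: twU.
Qed.

Lemma tw_wt u : supp (fun v => valid (ty v)) u -> tw (ext wt u) = u.
Proof.
move=> uv; rewrite linear_ext -[RHS]ext_id; apply: eq_ext_in => w /(suppP uv) vw.
by rewrite -[LHS]/(tw (wt w)); have [x <-] := wd_surj vw; rewrite wt_wd twU.
Qed.

Lemma tw_E_act ij x : tw (E_act K ij x) = derw (elt K ij) (wd x).
Proof.
have setE n (a : n.-tuple nat) (k : 'I_n) i : tset a k i = set_nth 0%N a k i :> seq nat.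
  apply: (@eq_from_nth _ 0%N); first by rewrite size_set_nth !size_tuple (maxn_idPr _).
  move=> m; rewrite size_tuple => mn; rewrite nth_set_nth.
  transitivity (tnth (tset a k i) (Ordinal mn)); first by rewrite (tnth_nth 0%N).
  by rewrite tnth_mktuple -val_eqE /= (tnth_nth 0%N).
case: ij x => [i j] [e [a b]]; rewrite derw_weave (linearB tw) !(linear_sum tw).
rewrite !size_tuple !big_mkord; congr (_ - _); rewrite big_mkcond; apply: eq_bigr => k _.
  rewrite (tnth_nth 0%N) -[(i, j).1]/i -[(i, j).2]/j; case: eqP => _;
    last exact/esym/scale0r.
  rewrite -[true%:R]/(1 : K) scale1r.
  by rewrite -[LHS]/(tw << (existT _ e (tset a k i, b) : tbasis X r) >>) twU /wd setE.
rewrite (tnth_nth 0%N) -[(i, j).1]/i -[(i, j).2]/j; case: eqP => _;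
  last exact/esym/scale0r.
rewrite -[true%:R]/(1 : K) scale1r.
by rewrite -[LHS]/(tw << (existT _ e (a, tset b k j) : tbasis X r) >>) twU /wd setE.
Qed.

Lemma tw_gl_act B t : tw (gl_act X r B t) = ext (derw (letter_map B)) (tw t).
Proof.
rewrite /gl_act /= {2}/tw !linear_lext; apply: eq_lext => x.
by rewrite extU linear_lext derw_letter_map; apply: eq_lext => ij; apply: tw_E_act.
Qed.

(** These conditions single out the operators of the form [hat f], by [hat_good] and [hat_op]. *)
Record good_op (F : word -> U) : Prop := GoodOp {
  good_out : forall w, ~~ valid (ty w) -> F w = 0;
  good_supp : forall w, supp (fun v => valid (ty v)) (F w);
  good_eqv : forall D, lie_maps X D -> forall w,
    valid (ty w) -> ext F (derw D w) = ext (derw D) (F w) }.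

Fact hat_key : unit.
Proof. exact: tt. Qed.

(* Locked: unification would otherwise unfold [hat f w] while looking for basis vectors. *)
Definition hat : A -> word -> U := locked_with hat_key (fun f w => tw (f (wt w))).

Lemma hatE f w : hat f w = tw (f (wt w)).
Proof. by rewrite /hat locked_withE. Qed.

Lemma hat_tw f t : ext (hat f) (tw t) = tw (f t).
Proof.
by rewrite -{2}(wt_tw t) !linear_ext; apply: eq_ext => w; apply: hatE.
Qed.

Lemma hat_wd f x : hat f (wd x) = tw (f << x >>).
Proof. by rewrite hatE wt_wd. Qed.

Lemma equiv_endE f B t : lie_inf X B -> f (gl_act X r B t) = gl_act X r B (f t).
Proof. by case: f => f fP LB; case/equivariantP: (fP) => _ fE; apply: fE LB t. Qed.

Lemma hat_good f : good_op (hat f).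
Proof.
split=> [w vw|w|D [B LB ->] w vw]; first by rewrite hatE /wt (negPf vw) !linear0.
  by rewrite hatE; apply: tw_valid.
have [x <-] := wd_surj vw; rewrite hat_wd -tw_gl_act.
have -> : derw (letter_map B) (wd x) = tw (gl_act X r B << x >>).
  by rewrite tw_gl_act twU extU.
rewrite hat_tw.
by rewrite equiv_endE.
Qed.

Lemma hat_inj f g : (forall w, valid (ty w) -> hat f w = hat g w) -> f = g.
Proof.
move=> fg; apply: equiv_endP => t; apply: tw_inj; rewrite -!hat_tw.
by apply: eq_ext_in => w wt'; apply: fg; apply: (suppP (tw_valid t) wt').
Qed.

Lemma hatM f g w : hat (f * g) w = ext (hat f) (hat g w).
Proof. by rewrite [hat g w]hatE hat_tw hatE. Qed.
Lemma hatD f g w : hat (f + g) w = hat f w + hat g w.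
Proof. rewrite !hatE -linearD; congr tw; rewrite -[LHS]/(val (f + g) (wt w)) raddfD; reflexivity. Qed.
Lemma hatN f w : hat (- f) w = - hat f w.
Proof. rewrite !hatE -linearN; congr tw; rewrite -[LHS]/(val (- f) (wt w)) raddfN; reflexivity. Qed.
Lemma hat0 w : hat 0 w = 0.
Proof. rewrite hatE -[RHS](linear0 tw); congr tw; rewrite -[LHS]/(val (0 : A) (wt w)) raddf0; reflexivity. Qed.
Lemma hat_sum (I : Type) (s : seq I) (F : I -> A) w :
  hat (\sum_(i <- s) F i) w = \sum_(i <- s) hat (F i) w.
Proof.
by elim: s => [|i s IHs]; rewrite ?big_nil ?hat0 // !big_cons hatD IHs.
Qed.
Lemma hat1 w : valid (ty w) -> hat 1 w = W w.
Proof. by move=> /wd_surj[x <-]; rewrite hat_wd twU. Qed.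

(** The condition stands inside the existential so that [op] is defined on every operator. *)
Lemma op_exists (F : word -> U) : exists f : A, good_op F -> forall w, hat f w = F w.
Proof.
have [gF|] := pselect (good_op F); last by exists 0.
have [L Llin LE] : exists2 L : T -> T, linear L & forall t, tw (L t) = ext F (tw t).
  exists (fun t => ext wt (ext F (tw t))) => [c t t'|t].
    by rewrite (linearP tw) linearP linearP.
  by rewrite tw_wt //; apply: supp_ext => w _; apply: (good_supp gF).
have Leq : L \in equivariant (@gl_act K X r) (lie_inf X).
  apply/equivariantP; split=> // B LB t.
  move: (gl_act X r B) (tw_gl_act B) => G GE.
  refine (tw_inj (_ : tw (L (G t)) = tw (G (L t)))); rewrite LE !GE LE.
  rewrite linear_ext [RHS]linear_ext.
  apply: eq_ext_in => w wt'.
  by apply: (good_eqv gF); [exists B | apply: (suppP (tw_valid t) wt')].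
exists (EquivEnd Leq) => _ w; have [vw|vw] := boolP (valid (ty w)).
  by have [x <-] := wd_surj vw; rewrite hat_wd -[equiv_fun _ _]/(L << x >>) LE twU extU.
by rewrite (good_out (hat_good _) vw) (good_out gF vw).
Qed.

Definition op F : A := projT1 (cid (op_exists F)).
Lemma hat_op F : good_op F -> forall w, hat (op F) w = F w.
Proof. exact: projT2 (cid (op_exists F)). Qed.

(** The grading in canonical coordinates: a map of degree i strips i edges from the front of the
    type. *)
Definition deg (i : nat) : set A :=
  [set f | forall w, supp (fun v => ty w = edges X i ++ ty v) (hat f w)].

Definition type_of_exp (x : tbasis X r) := ((val (tag x)).1 : nat, (val (tag x)).2 : nat).

Lemma count_wd x : count_mem 0%N (ty (wd x)) = (val (tag x)).1 /\
  count_mem 1%N (ty (wd x)) = (val (tag x)).2.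
Proof.
by case: x => [e [a b]] /=; have [-> ->] := count_weave a b; rewrite !size_tuple.
Qed.

Lemma TpqE p q t : Tpq p q t <-> supp (fun v => count_mem 0%N (ty v) = p /\
  count_mem 1%N (ty v) = q) (tw t).
Proof.
split=> [tpq|tpq x]; last first.
  move=> xt; have [<- <-] := count_wd x; apply: (suppP tpq).
  by rewrite mem_fsup coef_tw mcoeff_neq0.
apply: supp_sum => x _; have [xt|xt] := boolP (x \in msupp t).
  by apply: suppZ; apply: suppU; have [-> ->] := count_wd x; apply: tpq.
by rewrite mcoeff_outdom // scale0r; apply: supp0.
Qed.

Lemma count_edges i : count_mem 0%N (edges X i) = (if is_SL X then i else i.*2) /\
  count_mem 1%N (edges X i) = (if is_SL X then i else 0%N).
Proof.
rewrite /edges; elim: i => [|i [IH0 IH1]]; first by case: ifP.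
by rewrite /= IH0 IH1 /tb; case: (is_SL X) => /=; lia.
Qed.

Lemma canon_edges i P : canon X (edges X i ++ P) = canon X P.
Proof. by rewrite /edges; elim: i => //= i IHi; rewrite eqxx. Qed.

(** Prepending edges keeps a type canonical, so by [canon_inj] comparing exponents and comparing
    whole types come to the same ([relP]). *)
Lemma deg_Ag i : deg i = @Ag_deg K X r i.
Proof.
have cnt1 v : ~~ is_SL X -> valid (ty v) -> count_mem 1%N (ty v) = 0%N.
  move=> nX /andP[_ /(canon_nonSL nX)] av; apply/count_memPn/negP => /(allP av).
  by [].
have relP w v : valid (ty w) -> valid (ty v) -> ty w = edges X i ++ ty v <->
    if is_SL X then count_mem 0%N (ty w) = (i + count_mem 0%N (ty v))%N /\
      count_mem 1%N (ty w) = (i + count_mem 1%N (ty v))%N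
    else count_mem 0%N (ty w) = (i.*2 + count_mem 0%N (ty v))%N.
  move=> vw vv; have [c0 c1] := count_edges i; split=> [->|].
    by rewrite !count_cat c0 c1; case: (is_SL X).
  move=> cnt; case/andP: (vw) => _ cw; case/andP: (vv) => _ cv.
  apply: (canon_inj (X := X) cw); rewrite ?canon_edges // count_cat.
    by rewrite c0; move: cnt; case: (is_SL X) => // -[].
  rewrite c1; move: cnt; case: (boolP (is_SL X)) => [_ [] //|nX _].
  by rewrite !cnt1.
apply/seteqP; split=> f.
  move=> df; have fT p q t : Tpq p q t -> forall v, v \in fsup (tw (f t)) ->
      valid (ty v) /\ exists2 w, (count_mem 0%N (ty w) = p /\ count_mem 1%N (ty w) = q) /\
        valid (ty w) & ty w = edges X i ++ ty v.
    move=> /TpqE tpq v vf; split; first exact: (suppP (tw_valid _) vf).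
    have S : supp (fun v => exists2 w, (count_mem 0%N (ty w) = p /\
        count_mem 1%N (ty w) = q) /\ valid (ty w) & ty w = edges X i ++ ty v) (tw (f t)).
      rewrite -hat_tw; apply: supp_ext => w wt'; apply: sub_supp (df w) => v' wv.
      by exists w => //; split; [apply: (suppP tpq wt') | apply: (suppP (tw_valid _) wt')].
    exact: (suppP S vf).
  have f0 t : (forall v, v \in fsup (tw (f t)) -> False) -> f t = 0.
    move=> vF; apply: tw_inj; rewrite linear0; apply: coef_inj => v; rewrite coef0.
    by apply: coef_out; apply/negP => /vF.
  rewrite /Ag_deg /=; have [slX|nX] : is_SL X \/ ~~ is_SL X by case: (is_SL X); [left | right].
    rewrite ifT // => p q t tpq.
    have [/andP[ip iq]|ipq] := boolP ((i <= p)%N && (i <= q)%N).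
      apply/TpqE; split=> v /(fT p q t tpq)[vv [w [[<- <-] vw]]].
      by move=> /(relP w v vw vv); rewrite slX => -[-> ->]; split; lia.
    apply: f0 => v /(fT p q t tpq)[vv [w [[wp wq] vw]]] /(relP w v vw vv).
    by rewrite slX wp wq => -[h1 h2]; move: ipq; rewrite h1 h2 !leq_addr.
  rewrite ifN // => p t tpq; have [ip|/negP ip] := boolP (i.*2 <= p)%N.
    apply/TpqE; split=> v /(fT p 0%N t tpq)[vv [w [[<- _] vw]]].
    move=> /(relP w v vw vv); rewrite (negPf nX) => ->; rewrite cnt1 //.
    by split=> //; lia.
  apply: f0 => v /(fT p 0%N t tpq)[vv [w [[wp _] vw]]] /(relP w v vw vv).
  by rewrite (negPf nX) wp => h1; apply: ip; rewrite h1 leq_addr.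
move=> df w; have [vw|vw] := boolP (valid (ty w)); last first.
  by rewrite (good_out (hat_good f) vw); apply: supp0.
have [x xw] := wd_surj vw; rewrite -xw hat_wd.
have [c0 c1] := count_wd x.
have tx p q : (val (tag x)).1 = p :> nat -> (val (tag x)).2 = q :> nat ->
    Tpq p q (<< x >> : T).
  by move=> xp xq; apply/TpqE; rewrite twU; apply: suppU; rewrite c0 c1.
have slnX : is_SL X \/ ~~ is_SL X by case: (is_SL X); [left | right].
have {}df : if is_SL X then forall p q t, Tpq p q t ->
    if (i <= p)%N && (i <= q)%N then Tpq (p - i)%N (q - i)%N (f t) else f t = 0
    else forall p t, Tpq p 0%N t ->
    if (i.*2 <= p)%N then Tpq (p - i.*2)%N 0%N (f t) else f t = 0 := df.
case: slnX => [slX|nX]; move: df.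
  rewrite ifT // => df; have := df _ _ _ (tx _ _ erefl erefl).
  set bb := (_ && _); have [/andP[ip iq]|_ ->] := boolP bb; last first.
    by rewrite linear0; apply: supp0.
  move=> /TpqE fx; split=> v vf; have vv := suppP (tw_valid _) vf.
  have [v0 v1] := suppP fx vf; rewrite xw; apply/relP => //.
  by rewrite slX v0 v1 -xw c0 c1 !subnKC.
rewrite ifN // => df.
have x1 : (val (tag x)).2 = 0%N :> nat by rewrite -c1 xw cnt1.
have := df _ _ (tx _ _ erefl x1).
set bb := (_ <= _)%N; have [ip|_ ->] := boolP bb; last first.
  by rewrite linear0; apply: supp0.
move=> /TpqE fx; split=> v vf; have vv := suppP (tw_valid _) vf.
have [v0 v1] := suppP fx vf; rewrite xw; apply/relP => //.
by rewrite (negPf nX) v0 -xw c0 subnKC.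
Qed.

End Transport.

(** * Scalars, the contraction and the permutations generate the ring *)

Section Operators.
Variables (K : fieldType) (X : lie_kind) (r : nat).
Hypothesis char0 : forall n, n.+1%:R != 0 :> K.
Local Notation U := (fm K word).
Local Notation W w := (bas K (w : word)).
Local Notation A := (Ag K X r).
Local Notation valid := (valid X r).
Local Notation deg := (@deg K X r).
Local Notation op := (@op K X r).
Local Notation d0 := (2%N, 0%N).
Implicit Types (w v : word) (f g : A) (u : U) (P : seq nat).

Lemma valid_okt P : valid P -> all (okt X) P.
Proof. by case/andP => _ /canon_okt. Qed.

Lemma nth_valid P (j : nat) : valid P -> (nth 2%N P j == 2%N) = (size P <= j)%N.
Proof.
move=> vP; apply/eqP/idP => [Pj|Pj]; last by rewrite nth_default.
rewrite leqNgt; apply/negP => jP; have := allP (valid_okt vP) _ (mem_nth 2%N jP).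
by rewrite Pj okt2.
Qed.

Lemma ty_act p w : ty (act p w) = [seq nth 2%N (ty w) j | j <- p].
Proof.
rewrite /ty /act -map_comp; apply: eq_map => j /=.
have [jw|jw] := ltnP j (size w); first by rewrite (nth_map d0).
by rewrite !nth_default ?size_map.
Qed.

Lemma ciw_ty i w : supp (fun v => ty v = drop i.*2 (ty w)) (ciw K X i w).
Proof.
elim: i w => [|i IHi] w; first by apply: suppU; rewrite drop0.
case: w => [|l [|l' w]]; [exact: supp0 | exact: supp0 | apply: suppZ; exact: IHi].
Qed.

Definition stable_perm P (p : seq nat) :=
  perm_eq p (iota 0 (size P)) && ([seq nth 2%N P j | j <- p] == P).

Lemma stable_perm_ty P p w : stable_perm P p -> ty w = P -> ty (act p w) = P.
Proof. by move=> /andP[_ /eqP pP] wP; rewrite ty_act wP. Qed.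

Definition shape P (ip : nat * seq nat) :=
  stable_perm P ip.2 && (take ip.1.*2 P == edges X ip.1).

(** [fft] gives diagrams with arbitrary permutations; those whose output type is not canonical
    cancel out of [hat f], and the others turn out to preserve the type. *)
Lemma hat_span f P : valid P -> exists2 J : seq (K * (nat * seq nat)),
  all (fun j => shape P j.2) J &
  forall w, ty w = P -> hat f w = \sum_(j <- J) j.1 *: ciw K X j.2.1 (act j.2.2 w).
Proof.
move=> vP; have hf := hat_good f.
have eqf : equivariant_on (lie_maps (K := K) X) P (hat f).
  by move=> D LD w wP; apply: (good_eqv hf LD); rewrite wP.
have spf w : ty w = P -> supp (okz X [::]) (hat f w).
  move=> wP; have := good_supp hf w; apply: sub_supp => v /valid_okt okv.
  have av : all (okl X) v by apply: okw_ty.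
  rewrite /okz av /=; suff -> : filter frozen v = [::] by [].
  apply/eqP; rewrite -[_ == _]negbK -has_filter; apply/hasPn => l lv.
  apply/eqP => l2; have := allP okv _ (map_f fst lv); by rewrite l2 okt2.
have [J gJ JE] := fft char0
  (fun D l (H : lie_maps X D) => let: ex_intro2 B _ E := H in
     fun l2 => etrans (congr1 (fun D' => D' l) E) (letter_map2 B l2))
  (fun D l (H : lie_maps X D) => let: ex_intro2 B _ E := H in
     eq_ind_r (fun D' => supp (fun l' => l'.1 = l.1) (D' l)) (letter_map_ty B l) E)
  (fun D (H : lie_maps X D) => let: ex_intro2 B _ E := H in
     eq_ind_r (fun D' => exists n, forall l, ((n <= l.2)%N -> D' l = 0) /\
       supp (fun l' => (l'.2 < n)%N) (D' l)) (letter_map_fin B) E)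
  (@lie_mapsP K X) (valid_okt vP) eqf spf.
(* Diagrams with an invalid output type are dropped; the projection [pr] below justifies this. *)
pose Jv := [seq j <- J | valid (drop j.2.1.*2 [seq nth 2%N P a | a <- j.2.2])].
exists Jv.
  apply/allP => j; rewrite mem_filter => /andP[vj /(allP gJ)].
  rewrite /good addn0 map_take => /andP[pj /eqP tj].
  have cnt t : count_mem t [seq nth 2%N P a | a <- j.2.2] = count_mem t P.
    have /seq.permP -> := perm_map (nth 2%N P) pj.
    by rewrite map_nth_iota0 // take_size.
  (* The permuted type consists of edges followed by a canonical type, so it is canonical, and its
     counts are those of [P]. *)
  have jP : [seq nth 2%N P a | a <- j.2.2] = P.
    apply: (canon_inj (X := X)); rewrite ?cnt //; last by case/andP: vP.
    rewrite -(cat_take_drop j.2.1.*2 [seq nth 2%N P a | a <- j.2.2]) tj canon_edges.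
    by case/andP: vj.
  by rewrite /shape /stable_perm pj jP eqxx -tj jP eqxx.
move=> w wP; pose pr v : U := if valid (ty v) then W v else 0.
have -> : hat f w = ext pr (hat f w).
  rewrite [RHS](ext_id_in (h := pr)) // => v vf; rewrite /pr.
  by rewrite (suppP (good_supp hf w) vf).
rewrite JE // /diag cats0 linear_sum big_filter [RHS]big_mkcond; apply: eq_bigr => j _.
rewrite linearZ /=; have cty := ciw_ty j.2.1 (act j.2.2 w).
have tyE : ty (act j.2.2 w) = [seq nth 2%N P a | a <- j.2.2] by rewrite ty_act wP.
case: ifP => vj; last first.
  rewrite (eq_ext_in (h' := fun=> 0)) ?ext_cst0 ?scaler0 // => v vf.
  by rewrite /pr (suppP cty vf) tyE vj.
by rewrite ext_id_in // => v vf; rewrite /pr (suppP cty vf) tyE vj.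
Qed.

Lemma stable_perm_size P p : stable_perm P p -> size p = size P.
Proof. by move=> /andP[/perm_size -> _]; rewrite size_iota. Qed.

Lemma hat_size f w : supp (fun v => (size v <= size w)%N) (hat f w).
Proof.
have [vw|vw] := boolP (valid (ty w)); last first.
  by rewrite (good_out (hat_good f) vw); apply: supp0.
have [J /allP JP ->] := hat_span f vw => //; rewrite big_seq.
apply: supp_sum => j /JP /andP[/stable_perm_size pj _]; apply: suppZ.
apply: sub_supp (ciw_ty _ _) => v /(congr1 size).
by rewrite size_drop !size_map pj size_map => ->; apply: leq_subr.
Qed.

Lemma hat_out f w : ~~ valid (ty w) -> hat f w = 0.
Proof. exact: (good_out (hat_good f)). Qed.

Lemma hat_supp f w : supp (fun v => valid (ty v)) (hat f w).
Proof. exact: (good_supp (hat_good f)). Qed.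

Lemma lie_maps_ty (D : letter -> fm K letter) l : lie_maps X D -> supp (fun l' => l'.1 = l.1) (D l).
Proof. by move=> [B _ ->]; apply: letter_map_ty. Qed.

Lemma eq_derw_ty (D : letter -> fm K letter) w (h h' : word -> U) : lie_maps X D ->
  (forall v, ty v = ty w -> h v = h' v) -> ext h (derw D w) = ext h' (derw D w).
Proof.
move=> LD hh; apply: eq_ext_in => v vf; apply: hh.
by apply: (suppP (derw_ty _) vf) => l _; apply: lie_maps_ty LD.
Qed.

Lemma good_valid (F : word -> U) :
  (forall w, valid (ty w) -> supp (fun v => valid (ty v)) (F w)) ->
  (forall D, lie_maps X D -> forall w, valid (ty w) ->
     ext F (derw D w) = ext (derw D) (F w)) ->
  good_op X r (fun w => if valid (ty w) then F w else 0).
Proof.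
move=> Fs Fe; split=> [w /negPf -> //|w|D LD w vw].
  by case: ifP => [/Fs//|_]; apply: supp0.
by rewrite vw -(Fe D LD w vw); apply: eq_derw_ty => // v ->; rewrite vw.
Qed.

Definition PO (cond : pred (seq nat)) (pp : seq nat -> seq nat) : A :=
  op (fun w => if valid (ty w) then
                 if cond (ty w) then W (act (pp (ty w)) w) else 0 else 0).

Lemma hat_PO (cond : pred (seq nat)) pp :
  (forall P, valid P -> cond P -> stable_perm P (pp P)) ->
  forall w, valid (ty w) ->
  hat (PO cond pp) w = if cond (ty w) then W (act (pp (ty w)) w) else 0.
Proof.
move=> st w vw; rewrite /PO hat_op ?vw //; apply: good_valid => {w vw} [w vw|D LD w vw].
  case: ifP => cw; last exact: supp0.
  by apply: suppU; rewrite (stable_perm_ty (st _ vw cw)).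
transitivity (ext (fun v => if cond (ty w) then W (act (pp (ty w)) v) else 0) (derw D w)).
  by apply: eq_derw_ty => // v ->.
case: ifP => cw; last by rewrite ext_cst0 linear0.
by rewrite extU act_equivariant //; case/andP: (st _ vw cw); rewrite size_map.
Qed.

Definition kapf (a : K) : A := op (fun w => if valid (ty w) then a *: W w else 0).

Lemma hat_kap a w : valid (ty w) -> hat (kapf a) w = a *: W w.
Proof.
move=> vw; rewrite /kapf hat_op ?vw //; apply: good_valid => {w vw} [w vw|D LD w vw].
  by apply: suppZ; apply: suppU.
by rewrite ext_scale ext_id linearZ /= extU.
Qed.

Fact kapf_zmod : zmod_morphism kapf.
Proof.
move=> a b; apply: hat_inj => w vw; rewrite hatD hatN !hat_kap //.
by rewrite scalerBl.
Qed.
Fact kapf_monoid : monoid_morphism kapf.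
Proof.
split=> [|a b]; apply: hat_inj => w vw; first by rewrite hat_kap // hat1 // scale1r.
by rewrite hatM !hat_kap // linearZ /= extU hat_kap // scalerA mulrC.
Qed.
HB.instance Definition _ := GRing.isZmodMorphism.Build K A kapf kapf_zmod.
HB.instance Definition _ := GRing.isMonoidMorphism.Build K A kapf kapf_monoid.

Lemma hat_kapM a f w : hat (kapf a * f) w = a *: hat f w.
Proof.
rewrite hatM -[in RHS](ext_id (hat f w)) -ext_scale.
apply: eq_ext_in => v vf; rewrite hat_kap //.
exact: (suppP (hat_supp f w) vf).
Qed.

Lemma kapfC a f : kapf a * f = f * kapf a.
Proof.
apply: hat_inj => w vw; rewrite hat_kapM hatM hat_kap // linearZ /=.
by rewrite extU.
Qed.

Definition c : A := op (fun w => if valid (ty w) then ciw K X 1 w else 0).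

Lemma form_ty l l' : form K X l l' != 0 -> l.1 = 0%N /\ l'.1 = tb X 0.
Proof.
rewrite /form; case: ifP => [/andP[/eqP l0 /eqP ->] _|_]; last by rewrite eqxx.
by rewrite bar1 l0.
Qed.

Lemma valid_edge P : valid (0%N :: tb X 0 :: P) -> valid P.
Proof. by move=> /andP[sP] /=; rewrite eqxx => cP; rewrite /valid cP andbT ltnW // ltnW. Qed.

Lemma hat_c w : valid (ty w) -> hat c w = ciw K X 1 w.
Proof.
move=> vw; rewrite /c hat_op ?vw //; apply: good_valid => {w vw} [w vw|D LD w vw].
  case: w vw => [|l [|l' w]] vw; [exact: supp0 | exact: supp0 | ].
  rewrite [ciw _ _ _ _]/=; have [->|/form_ty[l0 l1]] := eqVneq (form K X l l') 0.
    by rewrite scale0r; apply: supp0.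
  by apply: suppZ; apply: suppU; apply: valid_edge; move: vw; rewrite /= l0 l1.
exact: ciw_invariant.
Qed.

Lemma ciwS i w : ext (ciw K X i) (ciw K X 1 w) = ciw K X i.+1 w.
Proof.
case: w => [|l [|l' w]]; rewrite ?linear0 //= linearZ /= extU //.
Qed.

Lemma hat_cX i w : valid (ty w) -> hat (c ^+ i) w = ciw K X i w.
Proof.
elim: i w => [|i IHi] w vw; first by rewrite expr0 hat1.
rewrite exprSr hatM hat_c // -(ciwS i); apply: eq_ext_in => v vf.
by apply: IHi; apply: (suppP (hat_supp c w)); rewrite hat_c.
Qed.

(* Types determine the exponents, so the pair of exponents indexes the types. *)
Definition expT := ('I_r.+1 * 'I_r.+1)%type.
Definition Pe (e : expT) : seq nat := ty (weave (nseq e.1 0%N) (nseq e.2 0%N)).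

Lemma Pe_inj : injective Pe.
Proof.
move=> e e' ee; have [c0 c1] := count_weave (nseq e.1 0%N) (nseq e.2 0%N).
have [c0' c1'] := count_weave (nseq e'.1 0%N) (nseq e'.2 0%N).
move: c0 c1; rewrite -/(Pe e) ee c0' c1' !size_nseq => h1 h2.
by case: e e' h1 h2 {ee c0' c1'} => [p q] [p' q'] /= h1 h2; congr pair; apply: val_inj.
Qed.

Lemma Pe_surj P : valid P -> exists e, Pe e = P.
Proof.
move=> /andP[sP cP].
have cle t : (count_mem t P < r.+1)%N by rewrite ltnS (leq_trans (count_size _ _)).
exists (Ordinal (cle 0%N), Ordinal (cle 1%N)); rewrite /Pe /=.
have [c0 c1] := count_weave (nseq (count_mem 0%N P) 0%N) (nseq (count_mem 1%N P) 0%N).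
apply: (canon_inj (X := X)) => //; last first.
- by rewrite c1 size_nseq.
- by rewrite c0 size_nseq.
apply: canon_weave; case: (boolP (is_SL X)) => //= nX.
rewrite /nilp size_nseq; apply/eqP/count_memPn/negP => /(allP (canon_nonSL nX cP)).
by [].
Qed.

(** One group of permutations of r positions serves all types: positions past the end of a type read
    as type 2, and [stab] keeps them apart from the others. *)
Definition pos1 (s : 'S_r) (j : nat) : nat := if insub j is Some i then val (s i) else j.
Definition pos (s : 'S_r) (n : nat) := map (pos1 s) (iota 0 n).
Definition stab P (s : 'S_r) := [forall i : 'I_r, nth 2%N P (s i) == nth 2%N P i].

Lemma pos1M s t j : pos1 (s * t)%g j = pos1 t (pos1 s j).
Proof.
rewrite /pos1; case: insubP => [i _ ij|jr]; first by rewrite valK permM.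
by rewrite insubN.
Qed.

Lemma pos1_1 j : pos1 1%g j = j.
Proof. by rewrite /pos1; case: insubP => [i _ <-|]; rewrite ?perm1. Qed.

Lemma pos1_inj s : injective (pos1 s).
Proof. by apply: (can_inj (g := pos1 s^-1%g)) => j; rewrite -pos1M mulgV pos1_1. Qed.

Lemma stabP P s : stab P s -> forall j, nth 2%N P (pos1 s j) = nth 2%N P j.
Proof.
by move=> /forallP st j; rewrite /pos1; case: insubP => [i _ <-|//]; apply: (eqP (st i)).
Qed.

Lemma stab1 P : stab P 1%g.
Proof. by apply/forallP => i; rewrite perm1. Qed.

Lemma stabM P s t : stab P s -> stab P (s * t)%g = stab P t.
Proof.
move=> st; apply/forallP/forallP => h i; have := h ((s^-1)%g i); have := h i.
  move=> _; rewrite permM permKV => /eqP ->; have /forallP/(_ (s^-1%g i)) := st.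
  by rewrite permKV eq_sym.
by move=> _ _; rewrite permM (eqP (h _)); apply: (forallP st).
Qed.

Lemma stabMr P s t : stab P t -> stab P (s * t)%g = stab P s.
Proof.
move=> st; apply/forallP/forallP => h i; have := h i; rewrite permM.
  by have /forallP/(_ (s i))/eqP -> := st.
by move=> /eqP <-; apply: (forallP st).
Qed.

Lemma stabV P s : stab P s^-1%g = stab P s.
Proof.
apply/idP/idP => st; last by have := stabMr s^-1%g st; rewrite mulVg stab1 => /esym.
by have := stabMr s st; rewrite mulgV stab1 => /esym.
Qed.

Lemma pos1_lt P s j : valid P -> stab P s -> (pos1 s j < size P)%N = (j < size P)%N.
Proof. by move=> vP st; rewrite !ltnNge -!(nth_valid _ vP) stabP. Qed.

Lemma stab_stable P s : valid P -> stab P s -> stable_perm P (pos s (size P)).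
Proof.
move=> vP st; have up : uniq (pos s (size P)).
  by rewrite map_inj_uniq ?iota_uniq //; apply: pos1_inj.
apply/andP; split; last first.
  rewrite /pos -map_comp (eq_map (g := nth 2%N P)); last by move=> j /=; rewrite stabP.
  by rewrite map_nth_iota0 // take_size.
have [||_ mi] := uniq_min_size (s2 := iota 0 (size P)) up.
- by move=> _ /mapP[j jP ->]; move: jP; rewrite !mem_iota !add0n !leq0n /= pos1_lt.
- by rewrite size_map !size_iota.
by apply: uniq_perm => //; apply: iota_uniq.
Qed.

Lemma perm_ext P p : valid P -> stable_perm P p ->
  exists2 s, stab P s & pos s (size P) = p.
Proof.
move=> vP sp; have szp := stable_perm_size sp; case/andP: (sp) => pp /eqP tp.
have up : uniq p by rewrite (perm_uniq pp) iota_uniq.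
have Pr : (size P <= r)%N by case/andP: vP.
have pl (j : nat) : (j < size P)%N -> (nth 0%N p j < size P)%N.
  move=> jP; have : nth 0%N p j \in p by rewrite mem_nth ?szp.
  by rewrite (perm_mem pp) mem_iota add0n.
pose h (j : nat) := if (j < size P)%N then nth 0%N p j else j.
have hr (i : 'I_r) : (h i < r)%N.
  by rewrite /h; case: ifP => [/pl/leq_trans->|_].
have hinj : injective (fun i : 'I_r => Ordinal (hr i)).
  move=> i i' [] hh; apply: val_inj; move: hh; rewrite /h.
  case: (ltnP i _) => iP; case: (ltnP i' _) => iP' //.
  - by move=> /eqP; rewrite nth_uniq ?szp // => /eqP.
  - by move=> hh; have := pl _ iP; rewrite hh ltnNge iP'.
  by move=> hh; have := pl _ iP'; rewrite -hh ltnNge iP.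
have posE j : (j < size P)%N -> pos1 (perm hinj) j = nth 0%N p j.
  move=> jP; rewrite /pos1 insubT ?(leq_trans jP) // => jr.
  by rewrite permE /= /h jP.
exists (perm hinj).
  apply/forallP => i; rewrite permE /= /h; case: ifP => // iP.
  by rewrite -{2}tp (nth_map 0%N) ?szp.
rewrite /pos -[RHS](mkseq_nth 0%N) szp; apply/eq_in_map => j.
by rewrite mem_iota add0n => /posE.
Qed.

Definition pm (q : expT * 'S_r) : A :=
  PO (fun P => (P == Pe q.1) && stab P q.2) (fun P => pos q.2 (size P)).

Lemma hat_pm q w : valid (ty w) -> hat (pm q) w =
  if (ty w == Pe q.1) && stab (ty w) q.2 then W (act (pos q.2 (size w)) w) else 0.
Proof.
move=> vw; rewrite hat_PO ?size_map // => P vP /andP[_ st]; exact: stab_stable.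
Qed.

Lemma act_pos P s t w : valid P -> ty w = P -> stab P s ->
  act (pos s (size w)) (act (pos t (size w)) w) = act (pos (s * t)%g (size w)) w.
Proof.
move=> vP wP st; have szw : size w = size P by rewrite -wP size_map.
rewrite /act -!map_comp; apply/eq_in_map => j; rewrite mem_iota add0n => /andP[_ jw] /=.
have sj : (pos1 s j < size w)%N by rewrite szw pos1_lt // -szw.
by rewrite (nth_map 0%N) ?size_iota // nth_iota // add0n pos1M.
Qed.

Lemma size_act_pos s w : size (act (pos s (size w)) w) = size w.
Proof. by rewrite !size_map size_iota. Qed.

Lemma pm0 e s : ~~ stab (Pe e) s -> pm (e, s) = 0.
Proof.
move=> st; apply: hat_inj => w vw; rewrite hat_pm // hat0 /=.
by case: eqP => //= ->; rewrite (negPf st).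
Qed.

(** If only one of the two permutations stabilizes the type, both sides are zero. *)
Lemma pmM e e' s t : stab (Pe e) s || stab (Pe e) t ->
  pm (e, s) * pm (e', t) = if e == e' then pm (e, (s * t)%g) else 0.
Proof.
move=> st; apply: hat_inj => w vw; rewrite hatM hat_pm //=.
case: eqP => [we|we] /=; last first.
  rewrite linear0; case: eqP => ee; last by rewrite hat0.
  by rewrite hat_pm //= ee; case: eqP.
case: ifP => [tt|tt]; last first.
  rewrite linear0; case: eqP => ee; last by rewrite hat0.
  subst e'; rewrite hat_pm //= we eqxx /=; rewrite we in tt.
  move: st; rewrite tt orbF => st; by rewrite stabM // tt.
have ta : ty (act (pos t (size w)) w) = ty w.
  by apply: stable_perm_ty (erefl _); have := stab_stable vw tt; rewrite size_map.
rewrite extU hat_pm ?ta //= size_act_pos.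
have [ee|ee] := eqVneq e e'; last first.
  by rewrite hat0 we (inj_eq Pe_inj) eq_sym (negPf ee).
rewrite ee hat_pm //= {1 3}we eqxx /= stabMr //; case: ifP => // ss.
by rewrite (act_pos t vw (erefl _) ss).
Qed.

Lemma sum_pm1 : \sum_(e : expT) pm (e, 1%g) = 1.
Proof.
apply: hat_inj => w vw; rewrite hat_sum hat1 //; have [e ew] := Pe_surj vw.
rewrite (bigD1 e) //= big1 ?addr0 => [|e' ee].
  rewrite hat_pm //= ew eqxx stab1 /=; congr (W _); rewrite /pos.
  by rewrite (eq_map pos1_1) map_id act_iota.
by rewrite hat_pm //= -ew (inj_eq Pe_inj) eq_sym (negPf ee).
Qed.

Definition comb (b : expT * 'S_r -> K) : A := \sum_q kapf (b q) * pm q.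

Lemma hat_comb b w e : valid (ty w) -> Pe e = ty w -> hat (comb b) w =
  \sum_(s | stab (ty w) s) b (e, s) *: W (act (pos s (size w)) w).
Proof.
move=> vw ew; rewrite hat_sum; under eq_bigr => q _ do rewrite hat_kapM hat_pm //.
transitivity (\sum_e' \sum_s b (e', s) *: (if (ty w == Pe e') && stab (ty w) s
  then W (act (pos s (size w)) w) else 0)).
  by rewrite pair_bigA; apply: eq_bigr => -[e' s] _.
rewrite (bigD1 e) //= [X in _ + X]big1 ?addr0.
  rewrite ew eqxx /= [RHS]big_mkcond; apply: eq_bigr => s _.
  by case: ifP; rewrite ?scaler0.
move=> e' ee; rewrite big1 // => s _.
by rewrite -ew (inj_eq Pe_inj) eq_sym (negPf ee) scaler0.
Qed.

Lemma span_ops f : exists b : nat -> expT * 'S_r -> K,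
  (forall i q, b i q != 0 -> stab (Pe q.1) q.2) /\
  f = \sum_(i < r.+1) c ^+ i * comb (b i).
Proof.
pose R e (J : seq (K * (nat * 'S_r))) := valid (Pe e) ->
  all (fun j => stab (Pe e) j.2.2 && (j.2.1 < r.+1)%N) J /\
  forall w, ty w = Pe e ->
    hat f w = \sum_(j <- J) j.1 *: ciw K X j.2.1 (act (pos j.2.2 (size w)) w).
have [J JP] : {J & forall e, R e (J e)}.
  apply: choice => e; rewrite /R.
  have [vP|vP] := boolP (valid (Pe e)); last by exists [::].
  have [J gJ JE] := hat_span f vP.
  have [S SP] : {S : seq nat -> 'S_r & forall p, stable_perm (Pe e) p ->
      stab (Pe e) (S p) /\ pos (S p) (size (Pe e)) = p}.
    apply: (choice (P := fun p s => stable_perm (Pe e) p ->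
      stab (Pe e) s /\ pos s (size (Pe e)) = p)) => p.
    have [sp|sp] := boolP (stable_perm (Pe e) p); last by exists 1%g.
    by have [s h1 h2] := perm_ext vP sp; exists s.
  exists [seq (j.1, (j.2.1, S j.2.2)) | j <- J] => _; split.
    apply/allP => _ /mapP[j /(allP gJ)/andP[sj /eqP tj] ->] /=.
    rewrite (SP _ sj).1 /= ltnS; apply: leq_trans (_ : (j.2.1.*2 <= _)%N).
      by rewrite -addnn leq_addr.
    rewrite -(size_edges X) -tj size_take; case: ltnP => // h; last by case/andP: vP.
    by case/andP: vP => sP _; apply: leq_trans (ltnW h) sP.
  move=> w wP; rewrite JE // big_map !big_seq; apply: eq_bigr => j /(allP gJ)/andP[sj _].
  by rewrite /= -(size_map fst w) -/(ty w) wP (SP _ sj).2.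
pose b i (q : expT * 'S_r) := if valid (Pe q.1) then
  \sum_(j <- J q.1 | (j.2.1 == i) && (j.2.2 == q.2)) j.1 else 0.
exists b; split=> [i [e s]|].
  rewrite /b; case: ifP => [vP|_]; last by rewrite eqxx.
  apply: contraNT => ns; rewrite big1_seq // => j /andP[/andP[_ /eqP js] jJ].
  have [/allP/(_ _ jJ)/andP[+ _] _] := JP e vP; by rewrite js (negPf ns).
apply: hat_inj => w vw; have [e ew] := Pe_surj vw.
have [/allP JA JE] := JP e (eq_ind_r valid vw ew).
rewrite (JE w (esym ew)) hat_sum.
transitivity (\sum_(i < r.+1) \sum_(s | stab (ty w) s)
    b i (e, s) *: ciw K X i (act (pos s (size w)) w)); last first.
  apply: eq_bigr => i _; rewrite hatM (hat_comb _ vw ew) linear_sum.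
  apply: eq_bigr => s st; rewrite linearZ /= extU hat_cX //.
  rewrite (stable_perm_ty (P := ty w)) //.
  by have := stab_stable vw st; rewrite size_map.
symmetry; transitivity (\sum_(j <- J e) \sum_(i < r.+1) \sum_(s | stab (ty w) s)
    if (j.2.1 == i) && (j.2.2 == s) then j.1 *: ciw K X i (act (pos s (size w)) w) else 0).
  rewrite [RHS]exchange_big; apply: eq_bigr => i _ /=; rewrite [RHS]exchange_big.
  by apply: eq_bigr => s _; rewrite /b /= ew vw scaler_suml big_mkcond.
rewrite !big_seq; apply: eq_bigr => j /JA /andP[js ji].
rewrite (bigD1 (Ordinal ji)) //= (bigD1 j.2.2) ?ew //=; last by rewrite -ew.
rewrite !eqxx big1 ?addr0 => [|s /andP[_ /negPf sj]]; last by rewrite eq_sym sj andbF.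
rewrite big1 ?addr0 // => i /negPf ij; rewrite big1 // => s _.
by rewrite -(inj_eq val_inj) in ij; rewrite eq_sym ij.
Qed.

Lemma deg_pure i f w v : deg i f -> v \in fsup (hat f w) -> ty w = edges X i ++ ty v.
Proof. by move=> df; apply: (suppP (df w)). Qed.

Lemma deg0f i : deg i 0.
Proof. by move=> w; rewrite hat0; apply: supp0. Qed.

Lemma degB i f g : deg i f -> deg i g -> deg i (f - g).
Proof. by move=> df dg w; rewrite hatD hatN; apply: suppD (df w) (suppN (dg w)). Qed.

Lemma degD i f g : deg i f -> deg i g -> deg i (f + g).
Proof. by move=> df dg w; rewrite hatD; apply: suppD (df w) (dg w). Qed.

Lemma deg_sum i (I : Type) (s : seq I) (F : I -> A) :
  (forall k, deg i (F k)) -> deg i (\sum_(k <- s) F k).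
Proof.
by move=> dF; elim: s => [|k s IHs]; rewrite ?big_nil ?big_cons; [apply: deg0f | apply: degD].
Qed.

Lemma edgesD i j : edges X (i + j) = edges X i ++ edges X j.
Proof. by rewrite /edges nseqD flatten_cat. Qed.

Lemma degM i j f g : deg i f -> deg j g -> deg (i + j) (f * g).
Proof.
move=> df dg w; rewrite hatM; apply: supp_ext => v vg; have wv := deg_pure dg vg.
by apply: sub_supp (df v) => v' vv; rewrite wv vv catA -edgesD addnC.
Qed.

Lemma deg_kap a : deg 0 (kapf a).
Proof.
move=> w; have [vw|vw] := boolP (valid (ty w)); last by rewrite hat_out //; apply: supp0.
by rewrite hat_kap //; apply: suppZ; apply: suppU.
Qed.

Lemma deg_1 : deg 0 1.
Proof. by rewrite -(rmorph1 kapf); apply: deg_kap. Qed.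

Lemma deg_PO (cond : pred (seq nat)) (pp : seq nat -> seq nat) : (forall P, valid P -> cond P -> stable_perm P (pp P)) ->
  deg 0 (PO cond pp).
Proof.
move=> st w; have [vw|vw] := boolP (valid (ty w)); last by rewrite hat_out //; apply: supp0.
rewrite hat_PO //; case: ifP => cw; last exact: supp0.
by apply: suppU; rewrite (stable_perm_ty (st _ vw cw)).
Qed.

Lemma deg_pm q : deg 0 (pm q).
Proof. by apply: deg_PO => P vP /andP[_ st]; apply: stab_stable. Qed.

Lemma deg_comb b : deg 0 (comb b).
Proof. by apply: deg_sum => q; apply: (degM (deg_kap _) (deg_pm q)). Qed.

Lemma deg_c : deg 1 c.
Proof.
move=> w; have [vw|vw] := boolP (valid (ty w)); last by rewrite hat_out //; apply: supp0.
rewrite hat_c //; case: w vw => [|l [|l' w]] vw; [exact: supp0 | exact: supp0 | ].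
rewrite [ciw _ _ _ _]/=; have [->|/form_ty[l0 l1]] := eqVneq (form K X l l') 0.
  by rewrite scale0r; apply: supp0.
by apply: suppZ; apply: suppU; rewrite /= l0 l1.
Qed.

Lemma deg_cX i : deg i (c ^+ i).
Proof.
elim: i => [|i IHi]; first by rewrite expr0; apply: deg_1.
by rewrite exprS -add1n; apply: degM deg_c IHi.
Qed.

Lemma deg_direct (s : seq nat) (y : nat -> A) : uniq s -> (forall i, deg i (y i)) ->
  \sum_(i <- s) y i = 0 -> forall i, i \in s -> y i = 0.
Proof.
move=> us dy ys i iS; apply: hat_inj => w _; rewrite hat0; apply: coef_inj => v.
rewrite coef0; have [vi|/coef_out//] := boolP (v \in fsup (hat (y i) w)).
have := congr1 (fun u : U => coef u v) (congr1 (fun f => hat f w) ys).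
rewrite hat0 coef0 hat_sum coef_sum (bigD1_seq i) //= big1 ?addr0 // => k ki.
apply: coef_out; apply/negP => vk.
have := congr1 size (deg_pure (dy i) vi); rewrite (deg_pure (dy k) vk) !size_cat !size_edges.
by move=> /addIn /double_inj ki'; rewrite ki' eqxx in ki.
Qed.

Lemma deg_graded : graded_ring deg.
Proof.
split; [split | exact: deg_1 | exact: degM].
- by move=> i; split; [apply: deg0f | move=> f g; apply: degB].
- move=> f; have [b [_ fE]] := span_ops f.
  exists (index_iota 0 r.+1), (fun i => c ^+ i * comb (b i)); split.
  + exact: iota_uniq.
  + by move=> i; have := degM (deg_cX i) (deg_comb (b i)); rewrite addn0.
  by rewrite big_mkord.
exact: deg_direct.
Qed.

Lemma deg_big i f : (r < i.*2)%N -> deg i f -> f = 0.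
Proof.
move=> ri df; apply: hat_inj => w /andP[sw _]; rewrite hat0; apply: coef_inj => v.
rewrite coef0; apply: coef_out; apply/negP => /(deg_pure df) /(congr1 size).
by rewrite size_cat size_edges => h; move: sw; rewrite h; lia.
Qed.

(** By directness of the grading only the i-th summand of [span_ops] survives in degree i. *)
Lemma deg_comp i f : deg i f -> exists2 b, (forall q, b q != 0 -> stab (Pe q.1) q.2) &
  f = c ^+ i * comb b.
Proof.
move=> df; have [b [bs fE]] := span_ops f; exists (b i); first exact: bs.
have dk k : deg k (c ^+ k * comb (b k)).
  by have := degM (deg_cX k) (deg_comb (b k)); rewrite addn0.
have [ir|ri] := ltnP i r.+1; last first.
  have ri2 : (r < i.*2)%N by rewrite -addnn; apply: leq_trans ri (leq_addr _ _).
  by rewrite (deg_big ri2 df) (deg_big ri2 (dk i)).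
pose y k := c ^+ k * comb (b k) - (if k == i then f else 0).
have := @deg_direct (index_iota 0 r.+1) y (iota_uniq _ _) _ _ i.
rewrite /y eqxx mem_index_iota ir => /(_ _ _ isT) H; apply/esym/eqP; rewrite -subr_eq0.
apply/eqP; apply: H => [k|].
  by apply: degB (dk k) _; case: eqP => [->|_] //; apply: deg0f.
rewrite sumrB big_mkord -fE big_mkord (bigD1 (Ordinal ir)) //= eqxx big1 ?addr0 ?subrr //.
by move=> k ki; rewrite ifN //; apply: contraNN ki => /eqP ki; apply/eqP/val_inj.
Qed.

Lemma cX0 : c ^+ r.+1 = 0.
Proof. by apply: deg_big (deg_cX _); lia. Qed.

(** * Shift, flip and swap of edges and their relations *)

Definition edge P := if P is [:: a, b & _] then (a == 0%N) && (b == tb X 0) else false.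

Lemma edgeP w : edge (ty w) -> exists l l' w', [/\ w = [:: l, l' & w'], l.1 = 0%N &
  l'.1 = tb X 0].
Proof.
case: w => [|l [|l' w]] //= /andP[/eqP l0 /eqP l1].
by exists l, l', w.
Qed.

Lemma edge_cons l l' w : l.1 = 0%N -> l'.1 = tb X 0 -> edge (ty [:: l, l' & w]).
Proof. by move=> l0 l1; rewrite /edge /= l0 l1 !eqxx. Qed.

Lemma valid_drop l l' w : l.1 = 0%N -> l'.1 = tb X 0 -> valid (ty [:: l, l' & w]) ->
  valid (ty w).
Proof. by move=> l0 l1; rewrite /= l0 l1; apply: valid_edge. Qed.

(** The first edge is kept and [f] acts behind it. Words without an initial edge go to 0, so the
    image of 1 under [th] is the projection [e1] and not 1. *)
Definition TF f w : U :=
  if edge (ty w) then ext (fun v => W (take 2 w ++ v)) (hat f (drop 2 w)) else 0.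

Definition th f : A := op (fun w => if valid (ty w) then TF f w else 0).

Lemma ext_exchange (I J : choiceType) (h : I -> J -> U) (x : fm K I) (y : fm K J) :
  ext (fun i => ext (h i) y) x = ext (fun j => ext (fun i => h i j) x) y.
Proof.
rewrite extE [RHS]extE; under eq_bigr => i _ do rewrite extE scaler_sumr.
rewrite exchange_big; apply: eq_bigr => j _ /=; rewrite extE scaler_sumr.
by apply: eq_bigr => i _; rewrite !scalerA mulrC.
Qed.

Lemma valid_cons f l l' w v : valid (ty [:: l, l' & w]) -> l.1 = 0%N -> l'.1 = tb X 0 ->
  v \in fsup (hat f w) -> valid (ty [:: l, l' & v]).
Proof.
move=> vw l0 l1 vf; have /andP[_ cv] := suppP (hat_supp f w) vf.
have := suppP (hat_size f w) vf; move: vw; rewrite /valid /= l0 l1 !eqxx /= cv !andbT.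
by rewrite !size_map => /andP[h _] h'; apply: leq_trans h; rewrite !ltnS.
Qed.

Lemma hat_th f w : valid (ty w) -> hat (th f) w = TF f w.
Proof.
move=> vw; rewrite /th hat_op ?vw //; apply: good_valid => {w vw} [w vw|D LD w vw].
  rewrite /TF; case: ifP => [ew|_]; last exact: supp0.
  have [l [l' [w' [wE l0 l1]]]] := edgeP ew; subst w; rewrite /= take0 drop0.
  by apply: supp_ext => v vf; apply: suppU; apply: (@valid_cons f l l' w' v vw l0 l1 vf).
transitivity (if edge (ty w) then
    ext (fun v => ext (fun v' => W (take 2 v ++ v')) (hat f (drop 2 v))) (derw D w) else 0).
  case: ifP => ew; last rewrite -[RHS](@ext_cst0 K _ U (derw D w)).
    by apply: eq_derw_ty => // v vE; rewrite /TF vE ew.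
  by apply: eq_derw_ty => // v vE; rewrite /TF vE ew.
rewrite /TF; case: ifP => [ew|_]; last by rewrite linear0.
have [l [l' [w' [wE l0 l1]]]] := edgeP ew; subst w; rewrite /= take0 drop0.
have vw' := valid_drop l0 l1 vw; have fE := good_eqv (hat_good f) LD vw'.
set H := fun v => ext _ _.
(* The derivation hits the first letter, the second letter or the rest of the word; equivariance of
   [f] enters in the third case only. *)
have H1 : ext H (ext (fun m => W [:: m, l' & w']) (D l)) =
    ext (fun v => ext (fun m => W [:: m, l' & v]) (D l)) (hat f w').
  rewrite -(ext_exchange (fun m v => W [:: m, l' & v])) linear_ext; apply: eq_ext => m.
  by rewrite extU /H /= drop0 take0.
have H2 : ext H (ext (fun v => W (l :: v)) (ext (fun m => W (m :: w')) (D l'))) =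
    ext (fun v => ext (fun m => W [:: l, m & v]) (D l')) (hat f w').
  rewrite -(ext_exchange (fun m v => W [:: l, m & v])) !linear_ext; apply: eq_ext => m.
  by rewrite !extU /H /= drop0 take0.
have H3 : ext H (ext (fun v => W (l :: v)) (ext (fun v => W (l' :: v)) (derw D w'))) =
    ext (fun v => ext (fun v' => W [:: l, l' & v']) (derw D v)) (hat f w').
  have E2 B : ext (fun v => W (l :: v)) (ext (fun v => W (l' :: v)) B) =
      ext (fun v => W [:: l, l' & v]) B.
    by rewrite (linear_ext (ext (fun v => W (l :: v)))); apply: eq_ext => v; rewrite extU.
  transitivity (ext (fun v => W [:: l, l' & v]) (ext (hat f) (derw D w'))).
    rewrite E2 (linear_ext (ext H)) (linear_ext (ext (fun v => W [:: l, l' & v]))).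
    apply: eq_ext => v; refine (etrans (extU H _) _).
    by rewrite /H /= drop0 take0.
  by rewrite fE linear_ext.
rewrite linearD linearD linearD /= H1 H2 H3 -!extD linear_ext; apply: eq_ext => v.
by rewrite extU /= linearD /= !linear_ext; congr (_ + (_ + _)); apply: eq_ext => m; rewrite extU.
Qed.

Lemma hat_thE f l l' w : valid (ty [:: l, l' & w]) -> l.1 = 0%N -> l'.1 = tb X 0 ->
  hat (th f) [:: l, l' & w] = ext (fun v => W [:: l, l' & v]) (hat f w).
Proof. by move=> vw l0 l1; rewrite hat_th // /TF edge_cons //= drop0 take0. Qed.

Lemma hat_th0 f w : valid (ty w) -> ~~ edge (ty w) -> hat (th f) w = 0.
Proof. by move=> vw ew; rewrite hat_th // /TF (negPf ew). Qed.

Lemma hat_edge f g :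
  (forall w, valid (ty w) -> ~~ edge (ty w) -> hat f w = hat g w) ->
  (forall l l' w, valid (ty [:: l, l' & w]) -> l.1 = 0%N -> l'.1 = tb X 0 ->
     hat f [:: l, l' & w] = hat g [:: l, l' & w]) -> f = g.
Proof.
move=> h0 h1; apply: hat_inj => w vw; have [ew|ew] := boolP (edge (ty w)); last exact: h0.
by have [l [l' [w' [wE l0 l1]]]] := edgeP ew; subst w; apply: h1.
Qed.

Fact th_zmod : zmod_morphism th.
Proof.
move=> f g; apply: hat_edge => [w vw ew|l l' w vw l0 l1].
  by rewrite hatD hatN !hat_th0 // subrr.
by rewrite hatD hatN !hat_thE // hatD hatN linearB.
Qed.
HB.instance Definition _ := GRing.isZmodMorphism.Build A A th th_zmod.

Lemma thM f g : th (f * g) = th f * th g.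
Proof.
apply: hat_edge => [w vw ew|l l' w vw l0 l1].
  by rewrite hatM !hat_th0 // linear0.
rewrite hatM !hat_thE // hatM !linear_ext; apply: eq_ext_in => v vf.
by rewrite extU hat_thE //; apply: (valid_cons vw l0 l1 vf).
Qed.

Lemma thK a f : th (kapf a * f) = kapf a * th f.
Proof.
apply: hat_edge => [w vw ew|l l' w vw l0 l1].
  by rewrite hat_kapM !hat_th0 // scaler0.
by rewrite hat_kapM !hat_thE // hat_kapM linearZ.
Qed.

Lemma deg_th i f : deg i f -> deg i (th f).
Proof.
move=> df w; have [vw|vw] := boolP (valid (ty w)); last by rewrite hat_out //; apply: supp0.
have [ew|ew] := boolP (edge (ty w)); last by rewrite hat_th0 //; apply: supp0.
have [l [l' [w' [wE l0 l1]]]] := edgeP ew; subst w; rewrite hat_thE //.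
apply: supp_ext => v vf; apply: suppU; rewrite /= (deg_pure df vf) l0 l1.
by have := congr1 (cat^~ (ty v)) (edgesD i 1); rewrite addn1 -catA.
Qed.

Lemma hat_c0 w : valid (ty w) -> ~~ edge (ty w) -> hat c w = 0.
Proof.
move=> vw ew; rewrite hat_c //; case: w vw ew => [|l [|l' w]] // vw ew.
rewrite [ciw _ _ _ _]/=; have [->|/form_ty[l0 l1]] := eqVneq (form K X l l') 0.
  by rewrite scale0r.
by rewrite edge_cons in ew.
Qed.

Lemma cth f : f * c = c * th f.
Proof.
apply: hat_edge => [w vw ew|l l' w vw l0 l1].
  by rewrite !hatM hat_c0 // hat_th0 // !linear0.
rewrite !hatM hat_c // hat_thE // [ciw _ _ _ _]/= linearZ /= extU linear_ext.
rewrite -[in LHS](ext_id (hat f w)) -ext_scale; apply: eq_ext_in => v vf.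
by rewrite extU hat_c //; apply: (valid_cons vw l0 l1 vf).
Qed.

(** The sign of the form when the two ends of an edge are exchanged by [f1] and [f2]. For sl the
    ends have different types and stay in place. *)
Definition sg : K := if X is LieSP then -1 else 1.
Definition f1 (l l' : letter) := if is_SL X then l else l'.
Definition f2 (l l' : letter) := if is_SL X then l' else l.

Lemma f1_ty l l' : l.1 = 0%N -> l'.1 = tb X 0 -> (f1 l l').1 = 0%N.
Proof. by rewrite /f1 /tb; case: (is_SL X). Qed.
Lemma f2_ty l l' : l.1 = 0%N -> l'.1 = tb X 0 -> (f2 l l').1 = tb X 0.
Proof. by rewrite /f2 /tb; case: (is_SL X). Qed.
Lemma f1K l l' : f1 (f1 l l') (f2 l l') = l.
Proof. by rewrite /f1 /f2; case: (is_SL X). Qed.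
Lemma f2K l l' : f2 (f1 l l') (f2 l l') = l'.
Proof. by rewrite /f1 /f2; case: (is_SL X). Qed.
Lemma sg_sqr : sg * sg = 1.
Proof. by rewrite /sg; case: X; rewrite ?mulrNN mulr1. Qed.

Definition fl_pos P := if is_SL X then iota 0 (size P) else [:: 1%N, 0%N & iota 2 (size P - 2)].
Definition fl : A := PO edge fl_pos.
Definition e1 : A := PO edge (fun P => iota 0 (size P)).
Definition edge2 P := edge P && edge (drop 2 P).
Definition sw : A := PO edge2 (fun P => [:: 2, 3, 0, 1 & iota 4 (size P - 4)]%N).
(** Projects the first edge onto the part that [c] sees: symmetric for o, skew for sp, and
    everything for sl. *)
Definition g : A := locked_with hat_key (kapf 2^-1 * (e1 + kapf sg * fl)).
Lemma gE : g = kapf 2^-1 * (e1 + kapf sg * fl).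
Proof. by rewrite /g locked_withE. Qed.
(** The swap of the first two edges, cut down to words in which both have been projected by [g]. *)
Definition t : A := sw * (g * th g).

Lemma nth_iotaE (x0 : nat) P i : [seq nth x0 P j | j <- iota i (size P - i)] = drop i P.
Proof.
have [h|h] := leqP i (size P).
  by rewrite map_nth_iota ?subnKC // take_oversize ?size_drop.
by rewrite drop_oversize ?(ltnW h) // (_ : _ - _ = 0)%N //; lia.
Qed.

Lemma iota_stable P : stable_perm P (iota 0 (size P)).
Proof. by rewrite /stable_perm perm_refl map_nth_iota0 // take_size eqxx. Qed.

Lemma fl_stable P : valid P -> edge P -> stable_perm P (fl_pos P).
Proof.
rewrite /fl_pos; case: (boolP (is_SL X)) => slX; first by move=> *; apply: iota_stable.
case: P => [|a [|b P]] //= _; rewrite /tb (negPf slX) => /andP[/eqP -> /eqP ->].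
apply/andP; split; first by apply/seq.permP => k /=; rewrite addnCA subn2.
by rewrite /= -/(size [:: 0, 0 & P]%N) nth_iotaE /= drop0.
Qed.

Lemma sw_stable P : valid P -> edge2 P ->
  stable_perm P [:: 2, 3, 0, 1 & iota 4 (size P - 4)]%N.
Proof.
case: P => [|a [|b [|a' [|b' P]]]]; rewrite /edge2 /= ?andbF // => _ /andP[/andP[/eqP -> /eqP ->] /andP[/eqP -> /eqP ->]].
apply/andP; split; first by apply/seq.permP => k /=; rewrite !subSS subn0; lia.
by rewrite /= -/(size [:: 0, 0, 0, 0 & P]%N) (nth_iotaE 2 [:: 0, tb X 0, 0, tb X 0 & P]%N 4) /= drop0.
Qed.

Lemma hat_e1 w : valid (ty w) -> hat e1 w = if edge (ty w) then W w else 0.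
Proof.
move=> vw; rewrite hat_PO // => [|P _ _]; last exact: iota_stable.
by rewrite size_map act_iota.
Qed.

Lemma act_drop w i : act (iota i (size w - i)) w = drop i w.
Proof.
rewrite /act; have [h|h] := leqP i (size w).
  by rewrite map_nth_iota ?subnKC // take_oversize ?size_drop.
by rewrite drop_oversize ?(ltnW h) // (_ : _ - _ = 0)%N //; lia.
Qed.

Lemma hat_fl l l' w : valid (ty [:: l, l' & w]) -> l.1 = 0%N -> l'.1 = tb X 0 ->
  hat fl [:: l, l' & w] = W [:: f1 l l', f2 l l' & w].
Proof.
move=> vw l0 l1; rewrite hat_PO ?edge_cons //; last exact: fl_stable.
rewrite /fl_pos /f1 /f2; case: (is_SL X); first by rewrite size_map act_iota.
rewrite size_map; congr (W _); rewrite -[LHS]/[:: l', l & act (iota 2 (size [:: l, l' & w] - 2)) [:: l, l' & w]].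
by rewrite act_drop /= drop0.
Qed.

Lemma hat_fl0 w : valid (ty w) -> ~~ edge (ty w) -> hat fl w = 0.
Proof. by move=> vw ew; rewrite hat_PO ?(negPf ew) //; apply: fl_stable. Qed.

Lemma hat_sw a b a' b' w : valid (ty [:: a, b, a', b' & w]) ->
  a.1 = 0%N -> b.1 = tb X 0 -> a'.1 = 0%N -> b'.1 = tb X 0 ->
  hat sw [:: a, b, a', b' & w] = W [:: a', b', a, b & w].
Proof.
move=> vw h1 h2 h3 h4; rewrite hat_PO //; last exact: sw_stable.
rewrite /edge2 /= h1 h2 h3 h4 !eqxx /= size_map; congr (W _).
rewrite -[LHS]/[:: a', b', a, b & act (iota 4 (size [:: a, b, a', b' & w] - 4)) [:: a, b, a', b' & w]].
by rewrite act_drop /= drop0.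
Qed.

Lemma edge2P w : edge2 (ty w) -> exists a b a' b' w', [/\ w = [:: a, b, a', b' & w'],
  a.1 = 0%N, b.1 = tb X 0, a'.1 = 0%N & b'.1 = tb X 0].
Proof.
case: w => [|a [|b [|a' [|b' w]]]]; rewrite /edge2 /= ?andbF // => /andP[/andP[/eqP h1 /eqP h2] /andP[/eqP h3 /eqP h4]].
by exists a, b, a', b', w.
Qed.

Lemma hat_sw0 w : valid (ty w) -> ~~ edge2 (ty w) -> hat sw w = 0.
Proof. by move=> vw ew; rewrite hat_PO ?(negPf ew) //; apply: sw_stable. Qed.

Lemma deg_g : deg 0 g.
Proof.
rewrite gE; apply: (degM (deg_kap _)); apply: degD; first by apply: deg_PO => P _ _; apply: iota_stable.
by apply: (degM (deg_kap _)); apply: deg_PO; apply: fl_stable.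
Qed.

Lemma deg_t : deg 0 t.
Proof.
by apply: (degM (deg_PO sw_stable)); apply: (degM deg_g); apply: deg_th deg_g.
Qed.

Lemma mul2K : (2^-1 : K) + 2^-1 = 1.
Proof.
by rewrite -mulr2n -[_ *+ 2]mulr_natr mulVf // (char0 1).
Qed.

Lemma kap2 f : kapf 2^-1 * (f + f) = f.
Proof.
by rewrite mulrDr -mulrDl -rmorphD mul2K rmorph1 mul1r.
Qed.

Lemma kapS f : kapf sg * (kapf sg * f) = f.
Proof.
by rewrite mulrA -rmorphM sg_sqr rmorph1 mul1r.
Qed.

Lemma kapCA a f h : f * (kapf a * h) = kapf a * (f * h).
Proof.
by rewrite mulrA -kapfC mulrA.
Qed.

Lemma ty_f l l' w : l.1 = 0%N -> l'.1 = tb X 0 ->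
  ty [:: f1 l l', f2 l l' & w] = ty [:: l, l' & w].
Proof.
by move=> l0 l1; rewrite /= f1_ty // f2_ty // l0 l1.
Qed.

Lemma e1_th f : e1 * th f = th f.
Proof.
apply: hat_edge => [w vw ew|l l' w vw l0 l1]; first by rewrite hatM hat_th0 // linear0.
rewrite hatM hat_thE // linear_ext; apply: eq_ext_in => v vf.
by rewrite extU hat_e1 ?edge_cons //; apply: (valid_cons vw l0 l1 vf).
Qed.

Lemma th_e1 f : th f * e1 = th f.
Proof.
apply: hat_edge => [w vw ew|l l' w vw l0 l1].
  by rewrite hatM hat_e1 // (negPf ew) linear0 hat_th0.
by rewrite hatM hat_e1 // edge_cons // extU.
Qed.

Lemma fl_th f : fl * th f = th f * fl.
Proof.
apply: hat_edge => [w vw ew|l l' w vw l0 l1].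
  by rewrite !hatM hat_fl0 // hat_th0 // !linear0.
have v' : valid (ty [:: f1 l l', f2 l l' & w]) by rewrite ty_f.
have k1 := f1_ty l0 l1; have k2 := f2_ty l0 l1.
rewrite !hatM hat_fl // extU (hat_thE f vw l0 l1) (hat_thE f v' k1 k2) linear_ext.
apply: eq_ext_in => v vf.
by rewrite extU hat_fl //; apply: (valid_cons vw l0 l1 vf).
Qed.

Lemma th1 : th 1 = e1.
Proof.
apply: hat_edge => [w vw ew|l l' w vw l0 l1].
  by rewrite hat_th0 // hat_e1 // (negPf ew).
by rewrite hat_thE // hat_e1 // edge_cons // hat1 ?extU //; apply: (valid_drop l0 l1 vw).
Qed.

Lemma e1e1 : e1 * e1 = e1.
Proof.
by rewrite -th1 -thM mulr1.
Qed.
Lemma e1fl : e1 * fl = fl.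
Proof.
apply: hat_edge => [w vw ew|l l' w vw l0 l1]; first by rewrite hatM hat_fl0 // linear0.
by rewrite hatM hat_fl // extU hat_e1 ?ty_f // edge_cons.
Qed.
Lemma fle1 : fl * e1 = fl.
Proof.
by rewrite -th1 fl_th th1 e1fl.
Qed.
Lemma flfl : fl * fl = e1.
Proof.
apply: hat_edge => [w vw ew|l l' w vw l0 l1].
  by rewrite hatM hat_fl0 // linear0 hat_e1 // (negPf ew).
have v' : valid (ty [:: f1 l l', f2 l l' & w]) by rewrite ty_f.
rewrite hatM hat_fl // extU (hat_fl v' (f1_ty l0 l1) (f2_ty l0 l1)) f1K f2K.
by rewrite hat_e1 // edge_cons.
Qed.

Lemma e1g : e1 * g = g.
Proof.
by rewrite gE kapCA mulrDr e1e1 kapCA e1fl.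
Qed.
Lemma flg : fl * g = kapf sg * g.
Proof.
rewrite gE kapCA mulrDr fle1 kapCA flfl kapCA; congr (_ * _).
by rewrite mulrDr kapS addrC.
Qed.
Lemma gg : g * g = g.
Proof.
rewrite {1}gE -mulrA mulrDl e1g -mulrA flg kapS; exact: kap2.
Qed.
Lemma g_th f : g * th f = th f * g.
Proof.
transitivity (kapf 2^-1 * (th f + kapf sg * (th f * fl))).
  by rewrite gE -mulrA mulrDl e1_th -(mulrA (kapf sg)) fl_th.
by rewrite [in RHS]gE kapCA; congr (_ * _); rewrite mulrDr th_e1 kapCA.
Qed.

Lemma form_f l l' : l.1 = 0%N -> l'.1 = tb X 0 ->
  form K X (f1 l l') (f2 l l') = sg * form K X l l'.
Proof.
case: l l' => [a x] [b y] /= -> ->; rewrite /form /f1 /f2 /sg /tb /bar /eps.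
case: X => /=; rewrite ?mul1r // !xpair_eqE /= ?(eq_sym y) //.
have -> : (x == flip y) = (y == flip x) by rewrite -(can_eq flipK) flipK eq_sym.
rewrite (eq_sym (flip x)); case: (y =P flip x) => [->|_]; rewrite ?mulr0 // odd_flip.
by case: (odd x); rewrite ?mulN1r ?mulr1 ?opprK.
Qed.

Lemma c_e1 : c * e1 = c.
Proof.
by rewrite -th1 -cth mul1r.
Qed.
Lemma c_fl : c * fl = kapf sg * c.
Proof.
apply: hat_edge => [w vw ew|l l' w vw l0 l1].
  by rewrite hatM hat_kapM hat_fl0 // hat_c0 // linear0 scaler0.
rewrite hatM hat_kapM hat_fl // extU !hat_c ?ty_f //.
by rewrite [ciw _ _ _ _]/= form_f // [in RHS]/= scalerA.
Qed.
Lemma cg : c * g = c.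
Proof.
by rewrite gE kapCA mulrDr c_e1 kapCA c_fl kapS kap2.
Qed.

Lemma hat_edge2 f h :
  (forall w, valid (ty w) -> ~~ edge2 (ty w) -> hat f w = hat h w) ->
  (forall a b a' b' w, valid (ty [:: a, b, a', b' & w]) -> a.1 = 0%N -> b.1 = tb X 0 ->
     a'.1 = 0%N -> b'.1 = tb X 0 ->
     hat f [:: a, b, a', b' & w] = hat h [:: a, b, a', b' & w]) -> f = h.
Proof.
move=> h0 h1; apply: hat_inj => w vw; have [ew|ew] := boolP (edge2 (ty w)); last exact: h0.
by have [a [b [a' [b' [w' [wE k1 k2 k3 k4]]]]]] := edge2P ew; subst w; apply: h1.
Qed.

Lemma hat_th0' f w : valid (ty w) -> ~~ edge2 (ty w) ->
  (forall v, valid (ty v) -> ~~ edge (ty v) -> hat f v = 0) -> hat (th f) w = 0.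
Proof.
move=> vw; have [ew|ew] := boolP (edge (ty w)); last by rewrite hat_th0.
have [l [l' [w' [wE l0 l1]]]] := edgeP ew; subst w; rewrite /edge2 ew /= drop0 => ew' f0.
by rewrite hat_thE // f0 ?linear0 //; apply: (valid_drop l0 l1 vw).
Qed.

Lemma hat_e10 w : valid (ty w) -> ~~ edge (ty w) -> hat e1 w = 0.
Proof.
by move=> vw ew; rewrite hat_e1 // (negPf ew).
Qed.

Lemma ty_sw a b a' b' w : a.1 = 0%N -> b.1 = tb X 0 -> a'.1 = 0%N -> b'.1 = tb X 0 ->
  ty [:: a', b', a, b & w] = ty [:: a, b, a', b' & w].
Proof.
by move=> /= -> -> -> ->.
Qed.

Lemma e1_sw : e1 * sw = sw.
Proof.
apply: hat_edge2 => [w vw ew|a b a' b' w vw h1 h2 h3 h4].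
  by rewrite hatM hat_sw0 // linear0.
have v2 := vw; rewrite -ty_sw // in v2.
by rewrite hatM (hat_sw vw h1 h2 h3 h4) extU (hat_e1 v2) (edge_cons _ h3 h4).
Qed.

Lemma sw_e1 : sw * e1 = sw.
Proof.
apply: hat_edge2 => [w vw ew|a b a' b' w vw h1 h2 h3 h4].
  rewrite hatM hat_e1 //; case: ifP => _; last by rewrite linear0 hat_sw0.
  by rewrite extU.
by rewrite hatM hat_e1 // edge_cons // extU.
Qed.

Lemma swsw : sw * sw = th e1.
Proof.
apply: hat_edge2 => [w vw ew|a b a' b' w vw h1 h2 h3 h4].
  by rewrite hatM hat_sw0 // linear0 (hat_th0' vw ew hat_e10).
have v2 := vw; rewrite -ty_sw // in v2.
rewrite hatM (hat_sw vw h1 h2 h3 h4) extU (hat_sw v2 h3 h4 h1 h2) (hat_thE _ vw h1 h2).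
by rewrite (hat_e1 (valid_drop h1 h2 vw)) (edge_cons _ h3 h4) extU.
Qed.

Lemma thfl_sw : th fl * sw = sw * fl.
Proof.
apply: hat_edge2 => [w vw ew|a b a' b' w vw h1 h2 h3 h4].
  rewrite !hatM hat_sw0 // linear0; have [ew'|ew'] := boolP (edge (ty w)); last first.
    by rewrite hat_fl0 // linear0.
  have [l [l' [w' [wE l0 l1]]]] := edgeP ew'; subst w.
  by rewrite hat_fl // extU hat_sw0 // ty_f.
have vw' := vw; rewrite -ty_sw // in vw'; have vd := valid_drop h3 h4 vw'.
have v' : valid (ty [:: f1 a b, f2 a b, a', b' & w]) by rewrite ty_f.
rewrite !hatM hat_sw // hat_fl // !extU (hat_sw v' (f1_ty h1 h2) (f2_ty h1 h2) h3 h4).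
by rewrite hat_thE // hat_fl // extU.
Qed.

Lemma fl_sw : fl * sw = sw * th fl.
Proof.
apply: hat_edge2 => [w vw ew|a b a' b' w vw h1 h2 h3 h4].
  by rewrite !hatM hat_sw0 // linear0 (hat_th0' vw ew hat_fl0) linear0.
have vw' := valid_drop h1 h2 vw.
have v2 := vw; rewrite -ty_sw // in v2; have k1 := f1_ty h3 h4; have k2 := f2_ty h3 h4.
have v3 : valid (ty [:: a, b, f1 a' b', f2 a' b' & w]).
  by move: vw; rewrite /= k1 k2 h3 h4.
rewrite !hatM hat_sw // extU hat_fl // hat_thE // hat_fl // !extU.
by rewrite (hat_sw v3 h1 h2 k1 k2).
Qed.

Lemma the1_sw : th e1 * sw = sw.
Proof.
apply: hat_edge2 => [w vw ew|a b a' b' w vw h1 h2 h3 h4].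
  by rewrite !hatM hat_sw0 // linear0.
have vw' := vw; rewrite -ty_sw // in vw'.
rewrite hatM hat_sw // extU hat_thE // hat_e1; last exact: (valid_drop h3 h4 vw').
by rewrite edge_cons // extU.
Qed.

Lemma sw_the1 : sw * th e1 = sw.
Proof.
apply: hat_edge2 => [w vw ew|a b a' b' w vw h1 h2 h3 h4].
  by rewrite hatM (hat_th0' vw ew hat_e10) linear0 hat_sw0.
rewrite hatM hat_thE // hat_e1; last exact: (valid_drop h1 h2 vw).
by rewrite edge_cons // !extU.
Qed.

Lemma thg : th g = kapf 2^-1 * (th e1 + kapf sg * th fl).
Proof.
by rewrite gE thK raddfD /= thK.
Qed.

Lemma g_sw : g * sw = sw * th g.
Proof.
transitivity (kapf 2^-1 * (sw + kapf sg * (sw * th fl))).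
  by rewrite gE -mulrA mulrDl e1_sw -(mulrA (kapf sg)) fl_sw.
by rewrite thg kapCA; congr (_ * _); rewrite mulrDr sw_the1 kapCA.
Qed.

Lemma thg_sw : th g * sw = sw * g.
Proof.
transitivity (kapf 2^-1 * (sw + kapf sg * (sw * fl))).
  by rewrite thg -mulrA mulrDl the1_sw -(mulrA (kapf sg)) thfl_sw.
by rewrite [in RHS]gE kapCA; congr (_ * _); rewrite mulrDr sw_e1 kapCA.
Qed.

Lemma sw_thth f : sw * th (th f) = th (th f) * sw.
Proof.
apply: hat_edge2 => [w vw ew|a b a' b' w vw h1 h2 h3 h4].
  rewrite !hatM (hat_sw0 vw ew) linear0 (hat_th0' vw ew) ?linear0 // => v; exact: hat_th0.
have vw' := vw; rewrite -ty_sw // in vw'.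
rewrite !hatM hat_sw // extU !hat_thE //; first last.
- exact: (valid_drop h1 h2 vw).
- exact: (valid_drop h3 h4 vw').
rewrite !linear_ext; apply: eq_ext_in => v vf; rewrite !extU hat_sw //.
have v1 := valid_cons (valid_drop h1 h2 vw) h3 h4 vf.
have vf2 : [:: a', b' & v] \in fsup (hat (th f) [:: a', b' & w]).
  rewrite hat_thE //; last exact: (valid_drop h1 h2 vw).
  rewrite mem_fsup extE coef_sum (bigD1_seq v) ?fsup_uniq //= coefZ coef_bas eqxx mulr1.
  rewrite big1 ?addr0 -?mem_fsup // => v' vv; rewrite coefZ coef_bas.
  by case: eqP => [[vv']|]; rewrite ?mulr0 //; rewrite vv' eqxx in vv.
exact: (valid_cons vw h1 h2 vf2).
Qed.

Lemma ccsw : c * c * sw = c * c.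
Proof.
transitivity (c * c * th e1); last by rewrite -mulrA -cth mulrA c_e1.
apply: hat_edge2 => [w vw ew|a b a' b' w vw h1 h2 h3 h4].
  by rewrite hatM [RHS]hatM hat_sw0 // (hat_th0' vw ew hat_e10).
rewrite hatM [RHS]hatM hat_sw // hat_thE // hat_e1; last exact: (valid_drop h1 h2 vw).
have v2 := vw; rewrite -ty_sw // in v2.
rewrite (edge_cons _ h3 h4) !extU -expr2 (hat_cX _ v2) (hat_cX _ vw).
by rewrite /= !scalerA mulrC.
Qed.

Lemma thgg : th g * th g = th g.
Proof.
by rewrite -thM gg.
Qed.
Lemma g_thg : g * th g = th g * g.
Proof.
exact: g_th.
Qed.

Lemma tt : t * t = g * th g.
Proof.
rewrite /t; transitivity (sw * sw * (g * th g)).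
  rewrite -!mulrA; congr (_ * _).
  by rewrite (mulrA (th g)) thg_sw -!mulrA (mulrA g sw) g_sw -!mulrA (mulrA g g) gg g_thg
             (mulrA (th g)) thgg.
by rewrite swsw mulrA -g_th -mulrA -thM e1g.
Qed.
Lemma gt : g * t = t.
Proof.
by rewrite /t mulrA g_sw -mulrA g_thg (mulrA (th g)) thgg.
Qed.
Lemma tg : t * g = t.
Proof.
by rewrite /t -!mulrA -g_thg (mulrA g g) gg.
Qed.
Lemma thgt : th g * t = t.
Proof.
by rewrite /t mulrA thg_sw -mulrA (mulrA g g) gg.
Qed.
Lemma tthg : t * th g = t.
Proof.
by rewrite /t -!mulrA thgg.
Qed.
Lemma cct : c * c * t = c * c.
Proof.
by rewrite /t mulrA ccsw mulrA -(mulrA c c) cg -mulrA -cth mulrA cg.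
Qed.
Lemma t_thth f : t * th (th f) = th (th f) * t.
Proof.
have h1 : th g * th (th f) = th (th f) * th g by rewrite -!thM g_th.
by rewrite /t -!mulrA h1 (mulrA g) (g_th (th f)) -!mulrA (mulrA sw) sw_thth -!mulrA.
Qed.

Lemma sw_braid : sw * th sw * sw = th sw * sw * th sw.
Proof.
have nedge w : valid (ty w) -> ~~ edge2 (ty (drop 2 w)) -> hat (th sw) w = 0.
  move=> vw ew; have [ed|ed] := boolP (edge (ty w)); last exact: hat_th0.
  have [l [l' [w' [wE l0 l1]]]] := edgeP ed; subst w; rewrite /= drop0 in ew.
  by rewrite hat_thE // hat_sw0 ?linear0 //; apply: (valid_drop l0 l1 vw).
apply: hat_edge2 => [w vw ew|a b a' b' w vw h1 h2 h3 h4].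
  rewrite !hatM (hat_sw0 vw ew) linear0; have [ed|ed] := boolP (edge (ty w)); last first.
    by rewrite hat_th0 // !linear0.
  rewrite nedge ?linear0 //; have [l [l' [w' [wE l0 l1]]]] := edgeP ed; subst w.
  by move: ew; rewrite /edge2 ed /= !drop0 => /negPf ->.
have vw' := vw; rewrite -ty_sw // in vw'.
have [ed|ed] := boolP (edge (ty w)); last first.
  have ne x1 x2 x3 x4 : ~~ edge2 (ty (drop 2 [:: x1, x2, x3, x4 & w])).
    rewrite -[drop 2 _]/(drop 0 [:: x3, x4 & w]) drop0 /edge2.
    by rewrite -[drop 2 (ty _)]/(drop 0 (ty w)) drop0 (negPf ed) andbF.
  rewrite [RHS]hatM (nedge _ vw (ne _ _ _ _)) linear0 hatM (hat_sw vw h1 h2 h3 h4) extU.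
  by rewrite hatM (nedge _ vw' (ne _ _ _ _)) linear0.
have [l [l' [w' [wE l0 l1]]]] := edgeP ed; subst w.
have V x1 x2 x3 x4 x5 x6 : x1.1 = 0%N -> x2.1 = tb X 0 -> x3.1 = 0%N -> x4.1 = tb X 0 ->
  x5.1 = 0%N -> x6.1 = tb X 0 -> valid (ty [:: x1, x2, x3, x4, x5, x6 & w']).
  by move=> k1 k2 k3 k4 k5 k6; move: vw; rewrite /= h1 h2 h3 h4 l0 l1 k1 k2 k3 k4 k5 k6.
have S x1 x2 x3 x4 x5 x6 : x1.1 = 0%N -> x2.1 = tb X 0 -> x3.1 = 0%N -> x4.1 = tb X 0 ->
  x5.1 = 0%N -> x6.1 = tb X 0 -> hat (th sw) [:: x1, x2, x3, x4, x5, x6 & w'] =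
  W [:: x1, x2, x5, x6, x3, x4 & w'].
  move=> k1 k2 k3 k4 k5 k6; have v6 := V _ _ _ _ _ _ k1 k2 k3 k4 k5 k6.
  by rewrite hat_thE // hat_sw ?extU //; apply: (valid_drop k1 k2 v6).
have -> : hat (sw * th sw * sw) [:: a, b, a', b', l, l' & w'] =
    W [:: l, l', a', b', a, b & w'].
  rewrite -mulrA hatM hatM (hat_sw vw h1 h2 h3 h4) extU S // extU.
  by rewrite (hat_sw (V _ _ _ _ _ _ h3 h4 l0 l1 h1 h2) h3 h4 l0 l1).
rewrite -mulrA hatM hatM S // extU.
by rewrite (hat_sw (V _ _ _ _ _ _ h1 h2 l0 l1 h3 h4) h1 h2 l0 l1) extU S.
Qed.

(** All projections are moved to the right, past the swaps that permute them, and collected there;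
    what remains is [sw_braid]. *)
Lemma braid : t * th t * t = th t * t * th t.
Proof.
pose p := g; pose q := th g; pose s := th (th g); pose a := sw; pose b := th sw.
have tE : t = a * p * q by rewrite /t mulrA.
have thtE : th t = b * q * s by rewrite /t !thM mulrA.
have pa x : x * p * a = x * a * q by rewrite -mulrA g_sw mulrA.
have qa x : x * q * a = x * a * p by rewrite -mulrA thg_sw mulrA.
have sa x : x * s * a = x * a * s by rewrite -mulrA -sw_thth mulrA.
have qb x : x * q * b = x * b * s by rewrite -mulrA -thM g_sw thM mulrA.
have sb x : x * s * b = x * b * q by rewrite -mulrA -thM thg_sw thM mulrA.
have pb x : x * p * b = x * b * p by rewrite -mulrA g_th mulrA.
have pp x : x * p * p = x * p by rewrite -mulrA gg.
have qq x : x * q * q = x * q by rewrite -mulrA thgg.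
have ss x : x * s * s = x * s by rewrite -mulrA -!thM gg.
have qp x : x * q * p = x * p * q by rewrite -mulrA -g_th mulrA.
have sp x : x * s * p = x * p * s by rewrite -mulrA -g_th mulrA.
have sq x : x * s * q = x * q * s by rewrite -mulrA -thM -g_th thM mulrA.
rewrite thtE tE !mulrA !(pa, qa, sa, qb, sb, pb) !(qp, sp, sq, pp, qq, ss).
by have := sw_braid; rewrite -/a -/b => ->.
Qed.

(** * Faithfulness of the contraction modulo the symmetries of edges *)

Definition flw w : word := if w is [:: a, b & v] then [:: f1 a b, f2 a b & v] else w.
Definition sww w : word := if w is [:: a, b, a', b' & v] then [:: a', b', a, b & v] else w.
Definition bump l (h : word -> word) w : word := take l.*2 w ++ h (drop l.*2 w).

Lemma flwK : involutive flw.
Proof. by case=> [|a [|b v]] //=; rewrite f1K f2K. Qed.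
Lemma swwK : involutive sww.
Proof. by case=> [|a [|b [|a' [|b' v]]]]. Qed.

Lemma bumpK l h : involutive h -> h [::] = [::] -> involutive (bump l h).
Proof.
move=> hK h0 w; rewrite /bump; have [lw|lw] := leqP l.*2 (size w).
  by rewrite take_size_cat ?size_takel // drop_size_cat ?size_takel // hK cat_take_drop.
by rewrite !(drop_oversize (ltnW lw)) h0 cats0 !take_oversize ?drop_oversize ?h0 ?cats0 // ltnW.
Qed.

Lemma coef_ext_inj (h : word -> word) u w : injective h ->
  coef (ext (fun v => W (h v)) u) (h w) = coef u w.
Proof.
move=> hi; rewrite extE coef_sum; have [wu|wu] := boolP (w \in fsup u).
  rewrite (bigD1_seq w) ?fsup_uniq //= coefZ coef_bas eqxx mulr1 big1 ?addr0 // => v vw.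
  by rewrite coefZ coef_bas (inj_eq hi) (negPf vw) mulr0.
rewrite (coef_out wu) big1_seq // => v /andP[_ vu]; rewrite coefZ coef_bas (inj_eq hi).
by case: eqP => [vw|_]; [rewrite -vw vu in wu | rewrite mulr0].
Qed.

Lemma hat_iter l f w : valid (ty w) -> take l.*2 (ty w) = edges X l ->
  valid (ty (drop l.*2 w)) /\
  hat (iter l th f) w = ext (fun v => W (take l.*2 w ++ v)) (hat f (drop l.*2 w)).
Proof.
elim: l w => [|l IHl] w vw.
  rewrite double0 !drop0 => _; split; first exact: vw.
  by rewrite /= -[LHS]ext_id; apply: eq_ext => v; rewrite take0.
case: w vw => [|a [|b w]] // vw [a0 b1 tw'].
have [vd IH] := IHl w (valid_drop a0 b1 vw) tw'; split=> //.
rewrite iterS (hat_thE _ vw a0 b1) IH (linear_ext (ext (fun v => W [:: a, b & v]))).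
apply: eq_ext => v; exact: extU.
Qed.

Lemma edge_drop l w : take l.+1.*2 (ty w) = edges X l.+1 ->
  take l.*2 (ty w) = edges X l /\ edge (ty (drop l.*2 w)).
Proof.
elim: l w => [|l IHl] w; case: w => [|a [|b w]] //.
  by move=> [a0 b1]; rewrite take0 drop0; split=> //; apply: edge_cons.
move=> [a0 b1 tw']; have [h1 h2] := IHl w tw'; split=> //.
by rewrite -[LHS]/[:: a.1, b.1 & take l.*2 (ty w)] h1 a0 b1.
Qed.

Lemma hat_iter_fl l w : valid (ty w) -> take l.+1.*2 (ty w) = edges X l.+1 ->
  hat (iter l th fl) w = W (bump l flw w).
Proof.
move=> vw /edge_drop[h1 h2]; have [vd ->] := hat_iter fl vw h1; rewrite /bump.
have [a [b [w' [wE a0 b1]]]] := edgeP h2; rewrite wE in vd *.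
by rewrite hat_fl // extU.
Qed.

Lemma hat_iter_sw l w : valid (ty w) -> take l.+2.*2 (ty w) = edges X l.+2 ->
  hat (iter l th sw) w = W (bump l sww w).
Proof.
move=> vw tw2; have [h1 h2] := edge_drop tw2; have [h3 h4] := edge_drop h1.
have [vd ->] := hat_iter sw vw h3; rewrite /bump.
have [a [b [w' [wE a0 b1]]]] := edgeP h4; rewrite wE in vd *.
have dE : drop l.+1.*2 w = w' by rewrite doubleS -addn2 addnC -drop_drop wE /= drop0.
rewrite dE in h2; have [a' [b' [w'' [wE' a0' b1']]]] := edgeP h2.
by rewrite wE' in vd *; rewrite hat_sw // extU.
Qed.

Lemma g_e1 : g * e1 = g. Proof. by rewrite -th1 g_th th1 e1g. Qed.

Lemma hat_iter_g0 l w : valid (ty w) -> take l.+1.*2 (ty w) <> edges X l.+1 ->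
  hat (iter l th g) w = 0.
Proof.
elim: l w => [|l IHl] w vw nw.
  rewrite /= -g_e1 hatM hat_e10 ?linear0 //; apply: contra_notN nw => /edgeP.
  by move=> [a [b [w' [-> a0 b1]]]]; rewrite /= take0 a0 b1.
rewrite iterS; have [ew|ew] := boolP (edge (ty w)); last exact: hat_th0.
have [a [b [w' [wE a0 b1]]]] := edgeP ew; subst w.
rewrite hat_thE // IHl ?linear0 //; first exact: (valid_drop a0 b1 vw).
move=> tw'; apply: nw.
by rewrite -[LHS]/[:: a.1, b.1 & take l.+1.*2 (ty w')] tw' a0 b1.
Qed.

(** Permutations of positions ignore the letters themselves; this reduces [faithful] to words with
    distinct letters and lets the contracted word be relabelled. *)
Lemma hat_relabel b (phi : letter -> letter) w : valid (ty w) ->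
  {in w, forall l, (phi l).1 = l.1} ->
  hat (comb b) (map phi w) = ext (fun v => W (map phi v)) (hat (comb b) w).
Proof.
move=> vw pw; have tyE : ty (map phi w) = ty w.
  by rewrite /ty -map_comp; apply/eq_in_map => l /pw.
have [e ew] := Pe_surj vw; rewrite (hat_comb _ vw ew) (@hat_comb b (map phi w) e) ?tyE //.
rewrite linear_sum; apply: eq_bigr => s st; rewrite linearZ /= extU size_map act_map //.
apply/allP => j; have /andP[/perm_mem + _] := stab_stable vw st; rewrite size_map => ->.
by rewrite mem_iota.
Qed.

Lemma supp_comb b w : valid (ty w) ->
  supp (fun v => ty v = ty w /\ perm_eq v w) (hat (comb b) w).
Proof.
move=> vw; have [e ew] := Pe_surj vw; rewrite (hat_comb _ vw ew).
apply: supp_sum => s st; apply: suppZ; apply: suppU.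
have sp := stab_stable vw st; rewrite size_map in sp; split.
  exact: (stable_perm_ty sp).
case/andP: sp; rewrite size_map => pp _.
have := perm_map (nth (2%N, 0%N) w) pp.
by rewrite -[X in perm_eq _ X]/(act (iota 0 (size w)) w) act_iota.
Qed.

Definition flat (E : seq (letter * letter)) : word := flatten [seq [:: e.1; e.2] | e <- E].

Lemma flat_cat E E' : flat (E ++ E') = flat E ++ flat E'.
Proof. by rewrite /flat map_cat flatten_cat. Qed.

Lemma size_flat E : size (flat E) = (size E).*2.
Proof. by elim: E => //= e E IHE; rewrite IHE. Qed.

Lemma map_flat (phi : letter -> letter) E :
  map phi (flat E) = flat [seq (phi e.1, phi e.2) | e <- E].
Proof. by elim: E => //= e E IHE; rewrite -/(flat E) IHE. Qed.

Lemma mem_flat E l : (l \in flat E) = has (fun e => (l == e.1) || (l == e.2)) E.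
Proof. by elim: E => //= e E IHE; rewrite !inE -/(flat E) IHE orbA. Qed.

Lemma flat_exists i w : (i.*2 <= size w)%N -> exists E w', w = flat E ++ w' /\ size E = i.
Proof.
elim: i w => [|i IHi] w; first by exists [::], w.
case: w => [|a [|b w]] // iw; have [E [w' [wE sE]]] := IHi w iw.
by exists ((a, b) :: E), w'; rewrite /flat /= -/(flat E) -wE sE.
Qed.

Lemma coef_ciw E w v : coef (ciw K X (size E) (flat E ++ w)) v =
  (\prod_(e <- E) form K X e.1 e.2) * (w == v)%:R.
Proof.
elim: E => [|e E IHE] /=; first by rewrite big_nil mul1r coef_bas.
by rewrite -/(flat E) coefZ IHE big_cons mulrA.
Qed.

(** Adjacent transpositions generate all permutations; [mv] carries an entry to the front of a
    block. *)
Lemma perm_invariant (T : eqType) (n : nat) (F : seq T -> K) :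
  (forall s a b s', size (s ++ a :: b :: s') = n ->
     F (s ++ a :: b :: s') = F (s ++ b :: a :: s')) ->
  forall s s', perm_eq s s' -> size s = n -> F s = F s'.
Proof.
move=> Fsw; suff H s : forall pre s', perm_eq s s' -> size (pre ++ s) = n ->
  F (pre ++ s) = F (pre ++ s') by move=> s s'; apply: (H s [::]).
have mv x a : forall pre post, size (pre ++ a ++ x :: post) = n ->
    F (pre ++ a ++ x :: post) = F (pre ++ x :: a ++ post).
  elim: a => // y a IHa pre post sz.
  rewrite -[LHS]/(F (pre ++ y :: a ++ x :: post)) -cat_rcons IHa ?cat_rcons // Fsw //.
  by rewrite -sz !size_cat /= !size_cat /=; lia.
elim: s => [|x s IHs] pre s' ss' sz.
  by move: ss'; rewrite perm_sym => /perm_nilP ->.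
have xs' : x \in s' by rewrite -(perm_mem ss') mem_head.
case/splitPr: xs' ss' => a post ss'.
rewrite mv; last by rewrite -sz !(size_cat pre) (perm_size ss').
rewrite -!cat_rcons; apply: IHs; last by rewrite cat_rcons.
by move: ss'; rewrite perm_sym perm_catC /= perm_cons perm_catC perm_sym.
Qed.

Lemma half_odd (a : nat) : odd a -> a./2.*2.+1 = a.
Proof. lia. Qed.
Lemma half_even (a : nat) : ~~ odd a -> a./2.*2 = a.
Proof. lia. Qed.
Lemma half_eq_odd (a b : nat) : odd a -> b./2 = a./2 -> b != a -> a./2.*2 = b.
Proof. lia. Qed.
Lemma half_eq_even (a b : nat) : ~~ odd a -> b./2 = a./2 -> b != a -> a./2.*2.+1 = b.
Proof. lia. Qed.

Section Faithful.
Variables (i : nat) (u : U) (P : seq nat) (v0 : word).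
Hypothesis u_ty : supp (fun v => ty v = P /\ perm_eq v v0) u.
Hypothesis Pi : take i.*2 P = edges X i.
Hypothesis u_fl : forall l v, (l < i)%N -> coef u (bump l flw v) = sg * coef u v.
Hypothesis u_sw : forall l v, (l.+1 < i)%N -> coef u (bump l sww v) = coef u v.
Hypothesis v0_ty : ty v0 = P.
Hypothesis v0_uniq : uniq v0.

(** Turns the first i edges of [v0] into dual pairs on different indices. Every other letter gets
    twice its position as index, out of reach of those pairs and of one another. *)
Definition relab (l : letter) : letter :=
  let k := index l v0 in
  if (k < i.*2)%N then if odd k then bar X (0%N, k.-1) else (0%N, k) else (l.1, k.*2).

Lemma size_i : (i.*2 <= size v0)%N.
Proof.
rewrite -(size_map fst) -/(ty v0) v0_ty -(size_edges X i) -Pi size_take.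
by case: ltnP => // /ltnW.
Qed.

Lemma nth_edges k : (k < i.*2)%N -> nth 2%N (edges X i) k = if odd k then tb X 0 else 0%N.
Proof.
rewrite /edges; elim: i k => // n IHn [|[|k]] //= kn.
by rewrite negbK IHn.
Qed.

Lemma ty_index l : l \in v0 -> (index l v0 < i.*2)%N ->
  l.1 = if odd (index l v0) then tb X 0 else 0%N.
Proof.
move=> lv li; rewrite -(nth_edges li) -Pi nth_take // -v0_ty /ty (nth_map (2%N, 0%N)) ?index_mem //.
by rewrite nth_index.
Qed.

Lemma relab_ty l : l \in v0 -> (relab l).1 = l.1.
Proof.
move=> lv; rewrite /relab; case: ifP => // li; rewrite (ty_index lv li).
by case: ifP => //; rewrite bar1.
Qed.

Lemma bar_half l : (bar X l).2./2 = l.2./2.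
Proof. by rewrite /bar; case: X => //=; rewrite /flip; case: (boolP (odd l.2)) => /=; lia. Qed.

Lemma relab_half l : (index l v0 < i.*2)%N -> (relab l).2./2 = (index l v0)./2.
Proof.
move=> li; rewrite /relab li; case: (boolP (odd (index l v0))) => //= ol.
by rewrite bar_half /=; lia.
Qed.

Lemma relab_inj l l' : l \in v0 -> l' \in v0 -> (i.*2 <= index l v0)%N ->
  relab l' = relab l -> l' = l.
Proof.
move=> lv lv' li; have [li'|li'] := ltnP (index l' v0) i.*2.
  move=> h; have := relab_half li'; rewrite h {1}/relab ltnNge li /=; lia.
rewrite /relab !ltnNge li li' /= => -[_ /double_inj ii].
by rewrite -(nth_index (2%N, 0%N) lv') ii nth_index.
Qed.

(** Coefficient times form values: reordering edges changes neither factor, and flipping an edge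
    changes both by the same sign. *)
Let F (E : seq (letter * letter)) : K :=
  coef u (flat E ++ drop i.*2 v0) * \prod_(e <- E) form K X (relab e.1) (relab e.2).

Lemma F_swap s a b s' : size (s ++ a :: b :: s') = i ->
  F (s ++ a :: b :: s') = F (s ++ b :: a :: s').
Proof.
move=> sz; rewrite /F; congr (_ * _); last first.
  by rewrite !big_cat !big_cons /= (mulrCA (form _ _ _ _)).
rewrite -(u_sw (l := size s)); last by rewrite -sz size_cat /=; lia.
congr coef; rewrite /bump !flat_cat -!catA.
by rewrite take_size_cat ?size_flat // drop_size_cat ?size_flat.
Qed.

(** Orients an edge so that the end at an even position of [v0] comes first. *)
Definition nrm (e : letter * letter) := if odd (index e.1 v0) then (e.2, e.1) else e.

Lemma F_nrm s e s' : size (s ++ e :: s') = i -> e.1 \in v0 -> (index e.1 v0 < i.*2)%N ->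
  form K X (relab e.1) (relab e.2) != 0 ->
  F (s ++ e :: s') = F (s ++ nrm e :: s').
Proof.
move=> sz ev ei fe; rewrite /nrm; case: ifP => // oe.
have [r1 r2] := form_ty fe; have f1' := r1; rewrite (relab_ty ev) in f1'.
have slX : is_SL X = false.
  by move: f1'; rewrite (ty_index ev ei) oe /tb; case: (is_SL X).
have E2 : form K X (relab e.2) (relab e.1) = sg * form K X (relab e.1) (relab e.2).
  by have := form_f r1 r2; rewrite /f1 /f2 slX.
rewrite /F; have -> : coef u (flat (s ++ (e.2, e.1) :: s') ++ drop i.*2 v0) =
    sg * coef u (flat (s ++ e :: s') ++ drop i.*2 v0).
  rewrite -(u_fl (l := size s)); last by rewrite -sz size_cat /=; lia.
  congr coef; rewrite /bump !flat_cat -!catA.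
  by rewrite take_size_cat ?size_flat // drop_size_cat ?size_flat // /= /f1 /f2 slX.
rewrite !big_cat !big_cons /= E2 -!mulrA (mulrCA (\prod_(e0 <- s) _) sg).
by rewrite (mulrCA (coef _ _) sg) [RHS]mulrA sg_sqr mul1r.
Qed.

Lemma F_nrms s s' : size (s ++ s') = i ->
  {in s', forall e, [/\ e.1 \in v0, (index e.1 v0 < i.*2)%N &
    form K X (relab e.1) (relab e.2) != 0]} ->
  F (s ++ s') = F (s ++ map nrm s').
Proof.
elim: s' s => // e s' IHs s sz H; have [h1 h2 h3] := H e (mem_head _ _).
rewrite F_nrm //= -cat_rcons IHs ?cat_rcons // => [|e' es].
  by rewrite -sz !size_cat.
by apply: H; rewrite inE es orbT.
Qed.

Let kappa v := coef (ciw K X i (map relab v)) (map relab (drop i.*2 v0)).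
Let E0 := [seq (nth (2%N, 0%N) v0 k.*2, nth (2%N, 0%N) v0 k.*2.+1) | k <- iota 0 i].

Lemma flat_E0 : flat E0 = take i.*2 v0.
Proof.
rewrite /E0; have := size_i; elim: i v0 => [|n IHn] w; first by rewrite take0.
case: w => [|a [|b w]] // nw; rewrite -[iota 0 n.+1]/(0%N :: iota 1 n) (iotaDl 1 0 n).
rewrite map_cons -map_comp /flat /= -IHn //; congr [:: _, _ & flatten (map _ _)].
Qed.

Lemma kappa_v0 : kappa v0 = 1.
Proof.
rewrite /kappa -{1}(cat_take_drop i.*2 v0) -flat_E0 map_cat map_flat.
have sE : size [seq (relab e.1, relab e.2) | e <- E0] = i by rewrite !size_map size_iota.
rewrite -{1}sE coef_ciw eqxx mulr1 big_map big_map big1_seq // => k /andP[_].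
rewrite mem_iota add0n /= => ki; have [k1 k2] : (k.*2 < i.*2)%N /\ (k.*2.+1 < i.*2)%N by lia.
have := size_i => si; rewrite /relab !index_uniq ?(leq_trans _ si) // k1 k2 /= odd_double /=.
by rewrite /form /= eqxx /eps /= odd_double; case: X.
Qed.

(** A word that contributes to the chosen output word has the tail of [v0], and its edges are those
    of [v0] in another order and orientation; the invariance of [F] carries it to [v0]. *)
Lemma kappa_F v : v \in fsup u -> kappa v != 0 -> coef u v * kappa v = coef u v0.
Proof.
move=> vu kv; have [vP pv] := suppP u_ty vu; have szv : size v = size v0 by apply: perm_size.
have [E [rho [vE sE]]] : exists E w', v = flat E ++ w' /\ size E = i.
  by apply: flat_exists; rewrite szv size_i.
have uv : uniq v by rewrite (perm_uniq pv).
pose E' := [seq (relab e.1, relab e.2) | e <- E].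
have sE' : size E' = i by rewrite size_map.
have kE : kappa v = (\prod_(e <- E) form K X (relab e.1) (relab e.2)) *
    (map relab rho == map relab (drop i.*2 v0))%:R.
  by rewrite /kappa vE map_cat map_flat -{1}sE' coef_ciw big_map.
move: kv; rewrite kE.
case: (map relab rho =P map relab (drop i.*2 v0)) => rr; last by rewrite mulr0 eqxx.
rewrite mulr1 => pE.
(* Letters of the tail of [v0] have labels of their own ([relab_inj]), so equal labels mean equal
   tails. *)
have rhoE : rho = drop i.*2 v0.
  have szr : size rho = size (drop i.*2 v0) by rewrite -(size_map relab) rr size_map.
  apply: (@eq_from_nth _ (2%N, 0%N)) => // j jr; rewrite szr in jr.
  have jd : (i.*2 + j < size v0)%N by move: jr; rewrite size_drop; lia.
  have rj : nth (2%N, 0%N) rho j \in v0.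
    by rewrite -(perm_mem pv) vE mem_cat mem_nth ?orbT // szr.
  apply: relab_inj => //.
  - by rewrite nth_drop mem_nth.
  - by rewrite nth_drop index_uniq // leq_addr.
  have := congr1 (fun s => nth (2%N, 0%N) s j) rr.
  by rewrite !(nth_map (2%N, 0%N)) ?szr.
have pfl : perm_eq (flat E) (take i.*2 v0).
  by move: pv; rewrite vE rhoE -{2}(cat_take_drop i.*2 v0) perm_cat2r.
have fE e : e \in E -> form K X (relab e.1) (relab e.2) != 0.
  by move=> eE; move: pE; apply: contraNneq => f0; rewrite (big_rem e) //= f0 mul0r.
have idx l : l \in flat E -> l \in v0 /\ (index l v0 < i.*2)%N.
  rewrite (perm_mem pfl) => lt; split; first exact: mem_take lt.
  exact: index_ltn.
have inE1 e : e \in E -> e.1 \in flat E /\ e.2 \in flat E.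
  by move=> eE; rewrite !mem_flat; split; apply/hasP; exists e; rewrite ?eqxx ?orbT.
(* A nonzero form value makes the labels dual, so their indices have equal halves: the letters are
   ends of one edge of [v0], and they differ because the letters of the word are distinct. *)
have he e : e \in E -> (index e.2 v0)./2 = (index e.1 v0)./2 /\ index e.2 v0 != index e.1 v0.
  move=> eE; have [m1 m2] := inE1 e eE; have [w1 l1] := idx _ m1; have [w2 l2] := idx _ m2.
  have := fE e eE; rewrite /form; case: ifP; last by rewrite eqxx.
  move=> /andP[_ /eqP r2] _; rewrite -!relab_half // r2 bar_half; split=> //.
  apply/eqP => ii; have ee : e.2 = e.1 by rewrite -(nth_index (2%N, 0%N) w2) ii nth_index.
  case/splitPr: eE vE => s1 s2 vE; move: uv; rewrite vE flat_cat -catA cat_uniq.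
  by case/and3P => _ _; rewrite /flat /= ee inE eqxx.
pose M := [seq (index e.1 v0)./2 | e <- E].
have nE : map nrm E = [seq (nth (2%N, 0%N) v0 k.*2, nth (2%N, 0%N) v0 k.*2.+1) | k <- M].
  rewrite -map_comp; apply/eq_in_map => e eE /=; have [m1 m2] := inE1 e eE.
  have [w1 _] := idx _ m1; have [w2 _] := idx _ m2; have [h1 h2] := he e eE.
  rewrite /nrm; case: (boolP (odd (index e.1 v0))) => oe.
    by rewrite (half_odd oe) (half_eq_odd oe h1 h2) !nth_index.
  rewrite (half_eq_even oe h1 h2) (half_even oe).
  by rewrite !nth_index //; case: (e).
(* The numbers of the edges form a list of length i that covers 0, ..., i-1. *)
have pM : perm_eq (map nrm E) E0.
  rewrite nE; apply: perm_map; rewrite perm_sym.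
  have subM : {subset iota 0 i <= M}.
    move=> k; rewrite mem_iota add0n => /andP[_ ki].
    have k1 : (k.*2 < i.*2)%N by rewrite ltn_double.
    have k2 := leq_trans k1 size_i; have : nth (2%N, 0%N) v0 k.*2 \in flat E.
      by rewrite (perm_mem pfl) -(nth_take _ k1) mem_nth // size_takel ?size_i.
    rewrite mem_flat => /hasP[e eE /orP[]/eqP ke].
      by apply/mapP; exists e => //; rewrite -ke index_uniq // doubleK.
    apply/mapP; exists e => //; rewrite -(he e eE).1 -ke index_uniq // doubleK //.
  have szM : (size M <= size (iota 0 i))%N by rewrite size_map size_iota sE.
  have [_ mi] := uniq_min_size (iota_uniq 0 i) subM szM.
  apply: uniq_perm => //; first exact: iota_uniq.
  apply: leq_size_uniq (iota_uniq 0 i) subM szM.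
rewrite vE rhoE -/(F E) -[E]cat0s F_nrms ?cat0s //; last first.
  by move=> e eE; have [m1 _] := inE1 e eE; have [w1 l1] := idx _ m1; split=> //; apply: fE.
rewrite (perm_invariant F_swap pM) ?size_map // /F flat_E0 cat_take_drop.
have := kappa_v0; rewrite /kappa -{1}(cat_take_drop i.*2 v0) -flat_E0 map_cat map_flat.
have sE0 : size [seq (relab e.1, relab e.2) | e <- E0] = i by rewrite !size_map size_iota.
by rewrite -{1}sE0 coef_ciw eqxx mulr1 big_map => ->; rewrite mulr1.
Qed.

(** Every contributing word adds the same amount, the coefficient of [v0], and [v0] itself
    contributes; a positive multiple of it cannot vanish in characteristic zero. *)
Lemma coef_v0 : v0 \in fsup u ->
  ext (fun v => ciw K X i (map relab v)) u = 0 -> False.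
Proof.
move=> vu; rewrite extE => /(congr1 (fun x : U => coef x (map relab (drop i.*2 v0)))).
rewrite coef0 coef_sum; under eq_bigr => v _ do rewrite coefZ -/(kappa v).
have -> : \sum_(v <- fsup u) coef u v * kappa v =
    \sum_(v <- fsup u | kappa v != 0) coef u v0.
  rewrite [RHS]big_mkcond !big_seq; apply: eq_bigr => v vf.
  by case: eqP => [->|/eqP kv] /=; [rewrite mulr0 | apply: kappa_F].
rewrite big_const_seq iter_addr_0 => /eqP; rewrite -mulr_natr mulf_eq0.
move: (vu); rewrite mem_fsup => /negPf -> /=.
have : has (fun v => kappa v != 0) (fsup u).
  by apply/hasP; exists v0; rewrite ?kappa_v0 ?oner_eq0.
by rewrite has_count; case: (count _ _) => // n _; rewrite (negPf (char0 n)).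
Qed.
End Faithful.

(** On a word with distinct letters, a nonzero coefficient in the image would contradict [coef_v0]:
    contracting the relabelled image must give 0, since [y] commutes with relabelling. *)
Lemma faithful i y : deg 0 y -> c ^+ i * y = 0 ->
  (forall l, (l < i)%N -> iter l th g * y = y) ->
  (forall l, (l.+1 < i)%N -> iter l th t * y = y) -> y = 0.
Proof.
case: i => [|i] dy cy gy ty'; first by rewrite expr0 mul1r in cy.
have [b _ yE] := deg_comp dy; rewrite expr0 mul1r in yE.
have iterM l f h : iter l th (f * h) = iter l th f * iter l th h.
  by elim: l => //= l ->; rewrite thM.
have iterK l a f : iter l th (kapf a * f) = kapf a * iter l th f.
  by elim: l => //= l ->; rewrite thK.
have fly l : (l < i.+1)%N -> iter l th fl * y = kapf sg * y.
  by move=> li; rewrite -{1}(gy l li) mulrA -iterM flg iterK -mulrA gy.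
have swy l : (l.+1 < i.+1)%N -> iter l th sw * y = y.
  move=> li; rewrite -{2}(ty' l li) /t (iterM l sw (g * th g)) (iterM l g (th g)) -!mulrA.
  by have := gy _ li; rewrite iterSr => ->; rewrite gy // ltnW.
(* Any word is a relabelling of a word of the same type whose letters are numbered by their
   positions. *)
suff H w : valid (ty w) -> uniq w -> hat y w = 0.
  apply: hat_inj => w vw; rewrite hat0.
  pose w0 : word := [seq (nth 2%N (ty w) k, k) | k <- iota 0 (size w)].
  have tw0 : ty w0 = ty w.
    by rewrite /ty -map_comp /= -(size_map fst w) map_nth_iota0 // take_size.
  pose phi (l : letter) : letter := (l.1, (nth (2%N, 0%N) w l.2).2).
  have -> : w = map phi w0.
    rewrite -[LHS](act_iota w) -map_comp; apply/eq_in_map => k; rewrite mem_iota add0n.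
    by move=> /andP[_ kw]; rewrite /phi /= (nth_map (2%N, 0%N)) // -surjective_pairing.
  rewrite yE hat_relabel ?tw0 // -yE H ?tw0 ?linear0 //.
  by apply: (map_uniq (f := snd)); rewrite -map_comp map_id_in ?iota_uniq.
move=> vw uw; have u_ty := supp_comb b vw; rewrite -yE in u_ty.
(* If the type does not start with all these edges, the last projection kills the image. *)
have [Pi|Pi] := eqVneq (take i.+1.*2 (ty w)) (edges X i.+1); last first.
  rewrite -(gy i) // hatM -[RHS](@ext_cst0 K _ U (hat y w)); apply: eq_ext_in => v vf.
  have [vt _] := suppP u_ty vf; apply: hat_iter_g0; rewrite vt //; exact/eqP.
apply: coef_inj => v0; rewrite coef0; have [vu|/coef_out//] := boolP (v0 \in fsup (hat y w)).
have [v0t v0p] := suppP u_ty vu; exfalso.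
have key (h : word -> word) l f : involutive h -> h [::] = [::] ->
    (forall v, ty v = ty w -> hat f v = W (bump l h v)) ->
    hat (f * y) w = ext (fun v => W (bump l h v)) (hat y w).
  move=> _ _ fE; rewrite hatM; apply: eq_ext_in => v vf.
  by apply: fE; have [] := suppP u_ty vf.
apply: (@coef_v0 i.+1 (hat y w) (ty w) v0) => //.
- split=> v vf; have [vt vp] := suppP u_ty vf; split=> //.
  by apply: perm_trans vp _; rewrite perm_sym.
- move=> l v li; have Bi : injective (bump l flw) by apply/inv_inj/bumpK => //; apply: flwK.
  rewrite -[in RHS](coef_ext_inj (hat y w) v Bi).
  rewrite -(key flw l (iter l th fl)) //; last first.
  + move=> v' v't; apply: hat_iter_fl; rewrite v't //.
    by have := congr1 (take l.+1.*2) Pi; rewrite take_takel ?leq_double // => ->;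
      rewrite -(subnKC li) edgesD take_size_cat // size_edges.
  + exact: flwK.
  by rewrite fly // hat_kapM coefZ mulrA sg_sqr mul1r.
- move=> l v li; have Bi : injective (bump l sww) by apply/inv_inj/bumpK => //; apply: swwK.
  rewrite -[in RHS](coef_ext_inj (hat y w) v Bi).
  rewrite -(key sww l (iter l th sw)) ?swy //; last first.
  + move=> v' v't; apply: hat_iter_sw; rewrite v't //.
    by have := congr1 (take l.+2.*2) Pi; rewrite take_takel ?leq_double // => ->;
      rewrite -(subnKC li) edgesD take_size_cat // size_edges.
  exact: swwK.
- by rewrite (perm_uniq v0p).
have := congr1 (fun f => hat f (map (relab i.+1 v0) w)) cy; rewrite hat0 hatM.
have rt : {in w, forall l, (relab i.+1 v0 l).1 = l.1}.
  move=> l lw; apply: (@relab_ty i.+1 (ty w) v0) => //; by rewrite (perm_mem v0p).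
have vw' : valid (ty (map (relab i.+1 v0) w)).
  by rewrite (_ : ty _ = ty w) // /ty -map_comp; apply/eq_in_map => l /rt.
rewrite {1}yE hat_relabel // -yE linear_ext => <-; apply: eq_ext_in => v vf.
rewrite extU hat_cX //; have [vt vp] := suppP u_ty vf.
have -> : ty (map (relab i.+1 v0) v) = ty v.
  rewrite /ty -map_comp; apply/eq_in_map => l lv.
  by apply: rt; rewrite -(perm_mem vp).
by rewrite vt.
Qed.

(** * The Casimir element of the degree zero part *)

Definition thA : {additive A -> A} := th.

Definition Qt := (expT * 'S_r)%type.
Definition ord_stab (e : expT) : K := #|[pred s | stab (Pe e) s]|%:R.
(** For each type this is the group algebra element $|S|^{-1} \sum_{s \in S} s \otimes s^{-1}$ with
    S the stabilizer of the type; [pm] vanishes on the other permutations. *)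
Definition uq (q : Qt) : A := kapf (ord_stab q.1)^-1 * pm q.
Definition vq (q : Qt) : A := pm (q.1, q.2^-1%g).

Lemma deg_uq q : deg 0 (uq q).
Proof. exact: (degM (deg_kap _) (deg_pm q)). Qed.

Lemma deg_vq q : deg 0 (vq q).
Proof. exact: deg_pm. Qed.

Lemma ord_stab_neq0 e : ord_stab e != 0.
Proof.
rewrite /ord_stab; have : (0 < #|[pred s | stab (Pe e) s]|)%N.
  by apply/card_gt0P; exists 1%g; apply: stab1.
by case: #|_| => // n _; apply: char0.
Qed.

Lemma sum_uv : \sum_q uq q * vq q = 1.
Proof.
rewrite -sum_pm1 /uq /vq; transitivity (\sum_e \sum_s kapf (ord_stab e)^-1 *
    (pm (e, s) * pm (e, s^-1%g))).
  by rewrite pair_bigA; apply: eq_bigr => -[e s] _ /=; rewrite -mulrA.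
apply: eq_bigr => e _; rewrite (bigID (stab (Pe e))) /= [X in _ + X]big1 ?addr0; last first.
  by move=> s /pm0 ->; rewrite mul0r mulr0.
rewrite (eq_bigr (fun=> kapf (ord_stab e)^-1 * pm (e, 1%g))) => [|s st]; last first.
  by rewrite pmM ?st // eqxx mulgV.
rewrite sumr_const -mulr_natl mulrA -(rmorph_nat kapf) -rmorphM.
by rewrite -/(ord_stab e) mulfV ?ord_stab_neq0 // rmorph1 mul1r.
Qed.

Lemma sep f : deg 0 f -> exists w : Qt -> Qt -> K, forall q k,
  f * uq q = \sum_k kapf (w q k) * uq k /\ vq k * f = \sum_q kapf (w q k) * vq q.
Proof.
move=> df; have [b bs] := deg_comp df; rewrite expr0 mul1r => fE.
(* The entry from s to k is the coefficient of $k s^{-1}$ in f, the permutation that carries s to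
   k. *)
exists (fun q k => if q.1 == k.1 then b (q.1, (k.2 * q.2^-1)%g) else 0).
have b0 e s : ~~ stab (Pe e) s -> b (e, s) = 0.
  by move=> st; apply/eqP; apply: contraNT st => /bs.
have bM e s e' s' : kapf (b (e, s)) * (pm (e, s) * pm (e', s')) =
    if e == e' then kapf (b (e, s)) * pm (e, (s * s')%g) else 0.
  have [st|st] := boolP (stab (Pe e) s); last by rewrite b0 // rmorph0 !mul0r; case: ifP.
  by rewrite pmM ?st //; case: ifP; rewrite ?mulr0.
have Mb e s e' s' : kapf (b (e, s)) * (pm (e', s') * pm (e, s)) =
    if e' == e then kapf (b (e, s)) * pm (e, (s' * s)%g) else 0.
  have [st|st] := boolP (stab (Pe e) s); last by rewrite b0 // rmorph0 !mul0r; case: ifP.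
  case: (e' =P e) => [->|/eqP ee]; first by rewrite pmM ?st ?orbT // eqxx.
  have [st'|st'] := boolP (stab (Pe e') s'); last by rewrite pm0 // mul0r mulr0.
  by rewrite pmM ?st' // (negPf ee) mulr0.
move=> [e s] [e' s']; split.
  rewrite /uq kapCA fE mulr_suml.
  transitivity (kapf (ord_stab e)^-1 * \sum_k kapf (b (e, k)) * pm (e, (k * s)%g)).
    congr (_ * _); transitivity (\sum_e1 \sum_k
        (if e1 == e then kapf (b (e1, k)) * pm (e1, (k * s)%g) else 0)).
      rewrite pair_bigA; apply: eq_bigr => -[e1 k] _ /=; by rewrite -mulrA bM.
    rewrite (bigD1 e) //= [X in _ + X]big1 ?addr0 => [|e1 /negPf e1e].
      by apply: eq_bigr => k _; rewrite eqxx.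
    by rewrite big1 // => k _; rewrite e1e.
  transitivity (\sum_e1 \sum_k (if e == e1 then kapf (b (e, (k * s^-1)%g)) *
      (kapf (ord_stab e)^-1 * pm (e, k)) else 0)); last first.
    rewrite pair_bigA; apply: eq_bigr => -[e1 k] _ /=.
    by case: eqP => [->|]; rewrite ?rmorph0 ?mul0r.
  rewrite [RHS](bigD1 e) //= [X in _ + X]big1 ?addr0 => [|e1 /negPf e1e]; last first.
    by rewrite big1 // => k _; rewrite eq_sym e1e.
  rewrite mulr_sumr (reindex_inj (mulIg s^-1)%g) /=; apply: eq_bigr => k _.
  by rewrite eqxx mulgKV kapCA.
rewrite /vq fE mulr_sumr /=.
transitivity (\sum_k kapf (b (e', k)) * pm (e', (s'^-1 * k)%g)).
  transitivity (\sum_e1 \sum_k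
      (if e' == e1 then kapf (b (e1, k)) * pm (e1, (s'^-1 * k)%g) else 0)).
    rewrite pair_bigA; apply: eq_bigr => -[e1 k] _ /=; by rewrite kapCA Mb.
  rewrite (bigD1 e') //= [X in _ + X]big1 ?addr0 => [|e1 /negPf e1e].
    by apply: eq_bigr => k _; rewrite eqxx.
  by rewrite big1 // => k _; rewrite eq_sym e1e.
transitivity (\sum_e1 \sum_k (if e1 == e' then kapf (b (e', (s' * k^-1)%g)) *
    pm (e', k^-1%g) else 0)); last first.
  rewrite pair_bigA; apply: eq_bigr => -[e1 k] _ /=.
  by case: eqP => [->|]; rewrite ?rmorph0 ?mul0r.
rewrite [RHS](bigD1 e') //= [X in _ + X]big1 ?addr0 => [|e1 /negPf e1e]; last first.
  by rewrite big1 // => k _; rewrite e1e.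
rewrite (reindex_inj (mulgI s')) (reindex_inj invg_inj) /=; apply: eq_bigr => k _.
by rewrite eqxx mulKg.
Qed.
End Operators.

(** * Verification of the criterion over the complex numbers *)

Theorem theorem5p5 (R : realType) (X : lie_kind) (r : nat) :
  koszul (@Ag_deg (complex R) X r).
Proof.
have char0 n : n.+1%:R != 0 :> complex R by rewrite Num.Theory.pnatr_eq0.
have -> : @Ag_deg (complex R) X r = @deg (complex R) X r.
  by apply/funext => i; rewrite deg_Ag.
pose K : numFieldType := complex R.
refine (@koszul_criterion K (Ag K X r) (@deg K X r) (@kapf K X r) (@thA K X r char0)
  (@c K X r) (@g K X r) (@t K X r) r _ _ _ _ _ _ _ _ _ _ _ _ _ _ _ _ _ _ _ _ _ _ _ _ _
  (Qt r) (@uq K X r) (@vq K X r) _ _ _ _).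
- exact: deg_graded.
- exact: kapfC.
- exact: deg_kap.
- by move=> x; apply: deg_th.
- by move=> x y _ _; apply: thM.
- by move=> a x _; apply: thK.
- exact: deg_c.
- by move=> x _; apply: cth.
- by move=> i x /(deg_comp char0)[b _ ->]; exists (comb X b); [apply: deg_comb |].
- exact: cX0.
- exact: deg_g.
- exact: deg_t.
- exact: gg.
- exact: cg.
- by rewrite -[thA _ _ _ _]/(th _) th1 // e1g.
- by move=> x _; apply: g_th.
- exact: tt.
- exact: gt.
- exact: tg.
- exact: thgt.
- exact: tthg.
- exact: cct.
- by move=> x _; apply: t_thth.
- exact: braid.
- exact: faithful.
- exact: deg_uq.
- exact: deg_vq.
- exact: sum_uv.
move=> f /(sep char0)[w H]; exists w.
by split=> [q|k]; [have [] := H q q | have [] := H k k].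
Unshelve.
all: exact char0.
Qed.
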